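(* Let $1<p<\infty$ and let $X$ be a Banach space with the UMD property. Then there is a constant $C>0$, depending only on the UMD constant $\mathscr U_p(X)$, such that for every $m\in\mathbb Z$ with $m\ge1$, all $0\le i\le K(m)$ and all $\varepsilon\in\{0,1\}$ the estimates $$\big\|U_m\circ P_i^{(0)}u\big\|_{L_X^p}\le C\cdot\big\|P_i^{(0)}u\big\|_{L_X^p},\qquad\big\|U_m\circ P_i^{(1,\varepsilon)}u\big\|_{L_X^p}\le C\cdot\big\|P_i^{(1,\varepsilon)}u\big\|_{L_X^p}$$ hold for all $u\in L_X^p$. Furthermore $K(m)\le7+2\log_2(m)$.
   Context: $L_X^p=L^p(\mathbb R;X)$ is the Bochner space with respect to Lebesgue measure. $X$ has the UMD property if for $1<p<\infty$ there is a constant $\mathscr U_p(X)$ (the UMD constant) with $\|\sum_j\varepsilon_jd_j\|_{L^p(\Omega,\mu;X)}\le\mathscr U_p(X)\|\sum_jd_j\|_{L^p(\Omega,\mu;X)}$ for all $X$-valued martingale difference sequences $\{d_j\}$ and all signs $\varepsilon_j\in\{-1,1\}$. For $j\in\mathbb Z$ let $\mathscr D_j=\{[2^{-j}k,2^{-j}(k+1)[\ :k\in\mathbb Z\}$ and $\mathscr D=\bigcup_{j\in\mathbb Z}\mathscr D_j$. The Haar functions are $h_{[0,1[}=1_{[0,1/2[}-1_{[1/2,1[}$ and $h_I(t)=h_{[0,1[}((t-\inf I)/|I|)$, $I\in\mathscr D$. Let $\tau_m(I)=I+m|I|$. $U_m$ is the linear operator given by $U_mh_I=1_{\tau_m(I)}-1_I$,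 $I\in\mathscr D$ (coefficients in $X$ being carried along; defined on finite linear combinations and extended by continuity). Collections for fixed $m\ge1$. If $m\ge2$ let $\lambda$ be the integer with $2^{\lambda-3}\le m<2^{\lambda-2}$; if $m=1$ let $\lambda=4$. Put $L(m)=\lambda-1$, $K(m)=2L(m)+1$. For $0\le i\le L(m)$ let $\mathscr A_i=\bigcup_{j\in\mathbb Z}\{I\in\mathscr D:|I|=2^{-(\lambda j+i)}\}$, let $\mathscr A_i^{(0)}$ be the set of all $J\in\mathscr A_i$ for which there is $I\in\mathscr A_i$ with $|J|=2^{-\lambda}|I|$, $J\subset I$ and $\tau_m(J)\subset I$, and $\mathscr A_i^{(1)}=\mathscr A_i\setminus\mathscr A_i^{(0)}$. Let $\mathscr D_{\mathrm{even}}$ (respectively $\mathscr D_{\mathrm{odd}}$) be the set of $[2^{-j}k,2^{-j}(k+1)[\,\in\mathscr D$ with $\lfloor k/m\rfloor$ even (respectively odd). For $0\le i\le L(m)$, $\delta\in\{0,1\}$ put $\mathscr B_i^{(\delta)}=\mathscr A_i^{(\delta)}\cap\mathscr D_{\mathrm{even}}$ and $\mathscr B_{i+L(m)+1}^{(\delta)}=\mathscr A_i^{(\delta)}\cap\mathscr D_{\mathrm{odd}}$. For $I\in\mathscr D$ let $\pi^\lambda(I)$ be the unique interval in $\mathscr D$ of length $2^\lambda|I|$ containing $I$. For $0\le i\le K(m)$ set $$\mathscr B_i^{(1,0)}=\{I\in\mathscr B_i^{(1)}:\inf\tau_m(I)\ne\inf\pi^\lambda(\tau_m(I))\},\qquad\mathscr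 B_i^{(1,1)}=\{I\in\mathscr B_i^{(1)}:\inf\tau_m(I)=\inf\pi^\lambda(\tau_m(I))\}.$$ Projections on $L_X^p$: with $\langle u,h_I\rangle=\int_{\mathbb R}u\,h_I\,dt$, $$P_i^{(0)}u=\sum_{I\in\mathscr B_i^{(0)}}\langle u,h_I\rangle h_I|I|^{-1},\qquad P_i^{(1,\varepsilon)}u=\sum_{I\in\mathscr B_i^{(1,\varepsilon)}}\langle u,h_I\rangle h_I|I|^{-1}.$$ *)

(* Defs.v *)
From HB Require Import structures.
From mathcomp Require Import all_boot all_order all_algebra finmap.
From mathcomp Require Import all_classical all_reals all_analysis.

Set Implicit Arguments.
Unset Strict Implicit.
Unset Printing Implicit Defensive.

Import Order.TTheory GRing.Theory Num.Theory.
Import numFieldNormedType.Exports.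

Local Open Scope classical_set_scope.
Local Open Scope ring_scope.

(** * Bochner spaces

    Elements of L^p(T; X) are represented by functions; every notion below is
    invariant under modification on a null set. *)

(* A finite sequence [(A_1, x_1); ...] encodes the step function
   \sum_k 1_(A_k) x_k; the A_k need not be disjoint. *)
Definition step_fun {R : realType} {X : completeNormedModType R} {T : Type}
    (s : seq (set T * X)) (t : T) : X :=
  \sum_(e <- s) (\1_(e.1) t : R) *: e.2.

Definition step_int {R : realType} {X : completeNormedModType R}
    d (T : measurableType d) (mu : {measure set T -> \bar R})
    (s : seq (set T * X)) : X :=
  \sum_(e <- s) fine (mu e.1) *: e.2.

Definition step_over {R : realType} {X : completeNormedModType R}
    d (T : measurableType d) (mu : {measure set T -> \bar R})
    (G : set (set T)) (s : seq (set T * X)) : Prop :=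
  forall e, e \in s -> G e.1 /\ (mu e.1 < +oo)%E.

(* Strong mu-measurability with respect to a sub-sigma-algebra G. *)
Definition strongly_measurable {R : realType} {X : completeNormedModType R}
    d (T : measurableType d) (mu : {measure set T -> \bar R})
    (G : set (set T)) (f : T -> X) : Prop :=
  exists s : nat -> seq (set T * X),
    (forall n, step_over mu G (s n)) /\
    {ae mu, forall t, step_fun (s n) t @[n --> \oo] --> f t}.

Definition is_bochner {R : realType} {X : completeNormedModType R}
    d (T : measurableType d) (mu : {measure set T -> \bar R})
    (f : T -> X) (v : X) : Prop :=
  strongly_measurable mu measurable f /\
  exists s : nat -> seq (set T * X),
    [/\ forall n, step_over mu measurable (s n),
        (\int[mu]_t (`|f t - step_fun (s n) t|)%:E)%E @[n --> \oo] --> 0%E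
      & step_int mu (s n) @[n --> \oo] --> v].

Definition bochner {R : realType} {X : completeNormedModType R}
    d (T : measurableType d) (mu : {measure set T -> \bar R})
    (f : T -> X) : X :=
  xget 0 (is_bochner mu f).

Definition Lpnorm {R : realType} {X : completeNormedModType R}
    d (T : measurableType d) (mu : {measure set T -> \bar R})
    (p : R) (f : T -> X) : \bar R :=
  Lnorm mu p%:E (fun t => (`|f t|)%:E).

Definition in_Lp {R : realType} {X : completeNormedModType R}
    d (T : measurableType d) (mu : {measure set T -> \bar R})
    (p : R) (f : T -> X) : Prop :=
  strongly_measurable mu measurable f /\ (Lpnorm mu p f < +oo)%E.

(** * The UMD property *)

Definition filtration d (T : measurableType d) (F : nat -> set (set T)) : Prop :=
  (forall j, sigma_algebra setT (F j) /\ F j `<=` measurable) /\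
  (forall j, F j `<=` F j.+1).

(* E[d_(j+1) | F_j] = 0 is expressed by vanishing integrals over the sets of
   F_j; the first term d_0 is arbitrary, being the difference f_0 - 0.
   A finite sequence is extended by zero. *)
Definition martingale_difference {R : realType} {X : completeNormedModType R}
    d (T : measurableType d) (P : probability T R) (p : R)
    (F : nat -> set (set T)) (D : nat -> T -> X) : Prop :=
  [/\ filtration F,
      forall j, in_Lp P p (D j),
      forall j, strongly_measurable P (F j) (D j)
    & forall j A, F j A ->
        is_bochner P (fun t => (\1_A t : R) *: D j.+1 t) 0].

Definition umd_bound {R : realType} (X : completeNormedModType R) (p b : R)
    : Prop :=
  forall (d : measure_display) (T : measurableType d) (P : probability T R)
    (F : nat -> set (set T)) (D : nat -> T -> X),
    martingale_difference P p F D ->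
    forall (n : nat) (eps : nat -> bool),
      (Lpnorm P p (fun t => (\sum_(j < n) (-1) ^+ (eps j) *: D j t)%R) <=
       b%:E * Lpnorm P p (fun t => (\sum_(j < n) D j t)%R))%E.

Definition UMD {R : realType} (X : completeNormedModType R) : Prop :=
  forall p : R, 1 < p -> exists b : R, umd_bound X p b.

(* The restriction 0 <= b only matters when X is trivial. *)
Definition umd_constant {R : realType} (X : completeNormedModType R) (p : R)
    : R :=
  inf [set b : R | 0 <= b /\ umd_bound X p b].

(** * Dyadic intervals and the Haar system *)

(* The pair (j, k) stands for the interval [2^-j k, 2^-j (k + 1)[; distinct
   pairs give distinct intervals. *)
Notation dyadic := (int * int)%type.

Definition dlen (R : realType) (I : dyadic) : R := 2 ^ (- I.1).

Definition dinf (R : realType) (I : dyadic) : R := dlen R I * I.2%:~R.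

Definition ditv (R : realType) (I : dyadic) : set R :=
  `[dlen R I * I.2%:~R, dlen R I * (I.2 + 1)%:~R[.
Arguments ditv R I : clear implicits.

Definition haar01 {R : realType} (t : R) : R :=
  \1_(`[0, 2^-1[ : set R) t - \1_(`[2^-1, 1[ : set R) t.

Definition haar {R : realType} (I : dyadic) (t : R) : R :=
  haar01 ((t - dinf R I) / dlen R I).

Definition tau (m : nat) (I : dyadic) : dyadic := (I.1, I.2 + m%:Z).

Definition haar_sum {R : realType} {X : completeNormedModType R}
    (S : {fset dyadic}) (c : dyadic -> X) (t : R) : X :=
  \sum_(I <- S) haar I t *: c I.

(* U_m applied to [haar_sum S c]. *)
Definition U_haar_sum {R : realType} {X : completeNormedModType R} (m : nat)
    (S : {fset dyadic}) (c : dyadic -> X) (t : R) : X :=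
  \sum_(I <- S) ((\1_(ditv R (tau m I)) t : R) - \1_(ditv R I) t) *: c I.

(* [is_U p m w g] : g = U_m w in L^p, for the continuous extension of U_m, i.e.
   (w, g) lies in the L^p-closure of the graph of U_m on finite Haar sums. *)
Definition is_U {R : realType} {X : completeNormedModType R} (p : R) (m : nat)
    (w g : R -> X) : Prop :=
  [/\ in_Lp lebesgue_measure p w, in_Lp lebesgue_measure p g &
      exists (S : nat -> {fset dyadic}) (c : nat -> dyadic -> X),
        Lpnorm lebesgue_measure p (fun t => w t - haar_sum (S n) (c n) t)
          @[n --> \oo] --> 0%E /\
        Lpnorm lebesgue_measure p (fun t => g t - U_haar_sum m (S n) (c n) t)
          @[n --> \oo] --> 0%E].

Definition haar_pairing {R : realType} {X : completeNormedModType R}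
    (u : R -> X) (I : dyadic) : X :=
  bochner lebesgue_measure (fun t => haar I t *: u t).

(* [is_haar_proj p B u w] : w is the unconditional sum in L^p of the series
   \sum_(I in B) <u, h_I> h_I |I|^-1. *)
Definition is_haar_proj {R : realType} {X : completeNormedModType R} (p : R)
    (B : set dyadic) (u w : R -> X) : Prop :=
  let c I := (dlen R I)^-1 *: haar_pairing u I in
  in_Lp lebesgue_measure p w /\
  forall e : R, 0 < e -> exists S0 : {fset dyadic},
    [set` S0] `<=` B /\
    forall S : {fset dyadic}, [set` S0] `<=` [set` S] -> [set` S] `<=` B ->
      (Lpnorm lebesgue_measure p (fun t => (w t - haar_sum S c t)%R) <= e%:E)%E.

(** * The collections of dyadic intervals *)

(* For m >= 2, [trunc_log 2 m] is the e with 2^e <= m < 2^(e+1). *)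
Definition lam (m : nat) : nat :=
  if (m <= 1)%N then 4 else (trunc_log 2 m + 3)%N.

Definition L_ (m : nat) : nat := (lam m - 1)%N.

Definition K_ (m : nat) : nat := (2 * L_ m + 1)%N.

Definition calA (R : realType) (m i : nat) : set dyadic :=
  [set I | exists j : int, dlen R I = 2 ^ (- ((lam m)%:Z * j + i%:Z))].

Definition calA0 (R : realType) (m i : nat) : set dyadic :=
  [set J | calA R m i J /\
    exists I, [/\ calA R m i I, dlen R J = 2 ^- (lam m) * dlen R I,
      ditv R J `<=` ditv R I & ditv R (tau m J) `<=` ditv R I]].

Definition calA1 (R : realType) (m i : nat) : set dyadic :=
  calA R m i `\` calA0 R m i.

(* [(k %/ m)%Z] is the floor of k / m for m > 0. *)
Definition Deven (m : nat) : set dyadic := [set I | (2 %| (I.2 %/ m)%Z)%Z].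

Definition Dodd (m : nat) : set dyadic := [set I | ~~ (2 %| (I.2 %/ m)%Z)%Z].

Definition calB0 (R : realType) (m i : nat) : set dyadic :=
  if (i <= L_ m)%N then calA0 R m i `&` Deven m
  else calA0 R m (i - (L_ m + 1)) `&` Dodd m.

Definition calB1 (R : realType) (m i : nat) : set dyadic :=
  if (i <= L_ m)%N then calA1 R m i `&` Deven m
  else calA1 R m (i - (L_ m + 1)) `&` Dodd m.

(* The dyadic interval of length 2^l |I| containing I; it exists and is unique,
   so the default value of [xget] is never used. *)
Definition ancestor (R : realType) (l : nat) (I : dyadic) : dyadic :=
  xget I [set J | dlen R J = 2 ^+ l * dlen R I /\ ditv R I `<=` ditv R J].

(* [calB1e R m i eps] is \mathscr B_i^(1,eps), with true for eps = 1. *)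
Definition calB1e (R : realType) (m i : nat) (eps : bool) : set dyadic :=
  [set I | calB1 R m i I /\
    if eps then dinf R (tau m I) = dinf R (ancestor R (lam m) (tau m I))
    else dinf R (tau m I) <> dinf R (ancestor R (lam m) (tau m I))].

(* ||U_m (P u)|| <= C ||P u|| for the Haar projection P onto B, including that
   P u and U_m (P u) exist. They are unique up to null sets, hence the
   quantification over all representatives. *)
Definition U_proj_estimate {R : realType} {X : completeNormedModType R} (p : R)
    (m : nat) (B : set dyadic) (C : R) (u : R -> X) : Prop :=
  (exists w, is_haar_proj p B u w) /\
  forall w, is_haar_proj p B u w ->
    (exists g, is_U p m w g) /\
    forall g, is_U p m w g ->
      (Lpnorm lebesgue_measure p g <= C%:E * Lpnorm lebesgue_measure p w)%E.

(* Main.v *)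
Require Import Defs.
From HB Require Import structures.
From mathcomp Require Import all_boot all_order all_algebra finmap.
From mathcomp Require Import all_classical all_reals all_analysis.
From mathcomp Require Import measurable_realfun ring lra zify.

Set Implicit Arguments.
Unset Strict Implicit.
Unset Printing Implicit Defensive.

Import Order.TTheory GRing.Theory Num.Theory.
Import numFieldNormedType.Exports.

Local Open Scope classical_set_scope.
Local Open Scope ring_scope.

(** The theorem is an inequality between finite Haar sums, obtained by
    rearranging the real line, and then carried to L^p by density.

    The inequality. Call functions [f 0], [f 1], ... on a finite set alternating
    when each [f i] is reversed by a permutation of the set which leaves the
    earlier members unchanged. Then the functions [f i *: c i] are a martingale
    difference sequence for the uniform measure, and the UMD property says that
    signs in front of them cost at most b, the UMD constant
    ([umd_constant_unconditional]). The Haar functions, sorted by decreasing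
    length, are alternating: exchange the two halves of an interval. Averaging
    over all signs leads to randomised sums [radnorm], which depend only on the
    absolute values of the functions and which change by a factor of at most b
    when each function is moved to another place by an exchange that the earlier
    members do not notice ([radnorm_swap]).

    Two intervals of one of the collections have lengths whose quotient is a
    power of 2^lambda, where 4 m < 2^lambda, and the parity condition forbids
    that one is the m-th translate of the other. Let I be an interval of the
    collection.

    - In the collections of type (0) the intervals I and tau_m(I) lie in one
      dyadic interval of length 2^lambda |I|, which is contained in or disjoint
      from each longer interval of the collection and from its translate. So I
      and tau_m(I) can be exchanged directly ([shift_estimate]).

    - In the collections of type (1) the translation crosses an endpoint of a
      dyadic interval of length 2^lambda |I|, perhaps an endpoint of a longer
      interval of the collection as well. The remedy is to cut all intervals
      into three equal parts. No power of 2 is divisible by 3, so the points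
      which cut a longer interval are at distance at least 2^lambda |I| / 3 from
      the crossed endpoint, whereas I and tau_m(I) are within m |I|, which is
      less than 2^lambda |I| / 4. Hence the middle thirds of I and of tau_m(I)
      can be exchanged. The outer thirds are first exchanged with the middle
      third of the same interval ([third_estimate]).

    Both cases together are [cell_estimate], stated on a grid of cells so fine
    that all halves and thirds are unions of cells, and [shift_haar_sum_le] is
    the same inequality on the line.

    The passage to L^p. Haar sums are dense ([haar_dense_Lp]), so the Haar
    coefficients of a function are the limits of the coefficients of the Haar
    sums approaching it ([pairing_limit]). Omitting terms of a Haar sum costs a
    factor 1 + b ([haar_sum_sub_le]). From these the Haar series of a function,
    restricted to any collection, satisfies the Cauchy criterion for
    unconditional convergence ([haar_proj_cauchy]), and completeness gives the
    projection. All dyadic intervals fall into finitely many classes on which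
    the inequality holds, so U_m is bounded on all Haar sums with some constant
    depending on m ([shift_bounded]). This makes its extension to L^p single
    valued; on the range of a projection the extension can then be computed
    along sums over the collection, and there it obeys the inequality with the
    constant [shift_constant b] that does not depend on m ([U_proj_le]). *)

(** * Unconditionality of alternating families *)

Section uniform_nat.
Context {R : realType} (n : nat).

(** The uniform probability on {0, ..., n}, carried by [nat] where every set is
    measurable, so that functions on a finite set need no measurability proof. *)
Definition unif_nat : set nat -> \bar R :=
  mscale (n.+1%:R^-1)%:nng (msum (fun k => \d_k) n.+1).

HB.instance Definition _ := Measure.on unif_nat.

Lemma integral_unif_nat (f : nat -> R) : (forall k, 0 <= f k) ->
  (\int[unif_nat]_k (f k)%:E)%E = (n.+1%:R^-1 * \sum_(k < n.+1) f k)%:E.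
Proof.
move=> f0.
have mf : measurable_fun [set: nat] (fun k => (f k)%:E) by [].
rewrite ge0_integral_mscale//; last by move=> k _; rewrite lee_fin.
rewrite ge0_integral_measure_sum//; last by move=> k _; rewrite lee_fin.
rewrite EFinM; congr (_ * _)%E.
rewrite -sumEFin; apply: eq_bigr => k _.
by rewrite integral_dirac// diracT mul1e.
Qed.

Lemma unif_natE (A : set nat) :
  unif_nat A = (n.+1%:R^-1 * \sum_(k < n.+1) \1_A (k : nat))%:E.
Proof.
rewrite /unif_nat /mscale /msum EFinM -sumEFin; congr (_ * _)%E.
Qed.

Lemma unif_nat_setT : unif_nat [set: nat] = 1%E.
Proof.
rewrite unif_natE; under eq_bigr do rewrite indicT.
by rewrite sumr_const card_ord mulVf// pnatr_eq0.
Qed.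

HB.instance Definition _ :=
  Measure_isProbability.Build _ _ _ unif_nat unif_nat_setT.

End uniform_nat.

Section Lpnorm_basics.
Context {R : realType} {X : completeNormedModType R}.
Context d (T : measurableType d) (mu : {measure set T -> \bar R}).
Implicit Types (f g : T -> X) (p : R).

Lemma LpnormE p f : Lpnorm mu p f =
  ((\int[mu]_t (`|f t| `^ p)%:E) `^ p^-1)%E.
Proof.
rewrite /Lpnorm Lnorm.unlock.
by under eq_integral do rewrite /= normr_id.
Qed.

Lemma eq_Lpnorm p f g : f =1 g -> Lpnorm mu p f = Lpnorm mu p g.
Proof. by move=> /funext ->. Qed.

Lemma Lpnorm_ge0 p f : (0 <= Lpnorm mu p f)%E.
Proof. exact: Lnorm_ge0. Qed.

End Lpnorm_basics.

Section finite_valued.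
Context {R : realType} {X : completeNormedModType R}.
Implicit Types (c : X).

(** The step function taking the value v *: c on the level set {f = v}. Duplicates
    in [s] would count a level twice. *)
Definition level_list {T : Type} (f : T -> R) (s : seq R) c : seq (set T * X) :=
  [seq (f @^-1` [set v], v *: c) | v <- undup s].

Lemma step_fun_level T (f : T -> R) (s : seq R) c t : (forall t, f t \in s) ->
  step_fun (level_list f s c) t = f t *: c.
Proof.
move=> fs; rewrite /step_fun big_map /=.
rewrite (bigD1_seq (f t)) ?undup_uniq ?mem_undup//=.
rewrite big1 ?addr0; first by rewrite indicE mem_set// scale1r.
move=> v vf; rewrite indicE memNset ?scale0r//= => /esym/eqP.
by rewrite (negbTE vf).
Qed.

Context d (T : measurableType d) (P : probability T R).

Lemma strongly_measurable_level (G : set (set T)) (f : T -> R) (s : seq R) c :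
    (forall t, f t \in s) -> (forall v, G (f @^-1` [set v])) ->
    (forall A, G A -> measurable A) ->
  strongly_measurable P G (fun t => f t *: c).
Proof.
move=> fs Gf Gm; exists (fun=> level_list f s c); split.
  move=> _ e /mapP[v _ ->] /=; split=> //.
  by rewrite (le_lt_trans (probability_le1 P _)) ?ltry//; exact: Gm.
apply: aeW => t /=; under eq_fun do rewrite step_fun_level//.
exact: cvg_cst.
Qed.

Lemma is_bochner_level (f : T -> R) (s : seq R) c :
    (forall t, f t \in s) -> (forall v, measurable (f @^-1` [set v])) ->
  is_bochner P (fun t => f t *: c) (step_int P (level_list f s c)).
Proof.
move=> fs mf; split; first exact: strongly_measurable_level.
exists (fun=> level_list f s c); split.
- move=> k e /mapP[v _ ->] /=; split=> //.
  by rewrite (le_lt_trans (probability_le1 P _)) ?ltry//; exact: mf.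
- rewrite (_ : (fun _ => _) = cst 0%E); first exact: cvg_cst.
  apply/funext => k; rewrite integral0_eq// => t _.
  by rewrite step_fun_level// subrr normr0.
- exact: cvg_cst.
Qed.

End finite_valued.

Section unif_nat_X.
Context {R : realType} {X : completeNormedModType R} (n : nat).
Local Notation P := (@unif_nat R n).

Lemma Lpnorm_unif_nat p (f : nat -> X) :
  Lpnorm P p f = ((n.+1%:R^-1 * \sum_(k < n.+1) `|f k| `^ p) `^ p^-1)%:E.
Proof.
by rewrite LpnormE integral_unif_nat ?poweR_EFin// => k; exact: powR_ge0.
Qed.

Lemma step_int_level_unif_nat (f : nat -> R) (s : seq R) (c : X) :
  (forall t, f t \in s) ->
  step_int P (level_list f s c) = (n.+1%:R^-1 * \sum_(k < n.+1) f k) *: c.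
Proof.
move=> fs; rewrite /step_int big_map/=.
under eq_bigr do rewrite unif_natE/= scalerA.
rewrite -scaler_suml; congr (_ *: _).
rewrite (eq_bigr (fun v => n.+1%:R^-1 *
  \sum_(k < n.+1) \1_(f @^-1` [set v]) (k : nat) * v)); last first.
  by move=> v _; rewrite -mulrA mulr_suml.
rewrite -mulr_sumr exchange_big /=; congr (_ * _); apply: eq_bigr => k _.
rewrite (bigD1_seq (f k)) ?undup_uniq ?mem_undup//=.
rewrite big1 ?addr0; first by rewrite indicE mem_set// mul1r.
move=> v vf; rewrite indicE memNset ?mul0r//= => /esym/eqP.
by rewrite (negbTE vf).
Qed.

End unif_nat_X.

(** The norm of L^p for the uniform probability on T. *)
HB.lock Definition avgnorm {R : realType} {X : completeNormedModType R}
    (T : finType) (p : R) (f : T -> X) : R :=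
  (#|T|%:R^-1 * \sum_t `|f t| `^ p) `^ p^-1.
Arguments avgnorm {R X T} p f.

(** The reversal of [f i] maps each common level set of the earlier members to
    itself, so that [f i] has mean zero on it: [f i] is a martingale difference
    for the filtration generated by the family. *)
Definition alternating_family {R : realType} (T : Type) (n : nat) (f : nat -> T -> R) :=
  forall i, (i < n)%N -> exists s : T -> T,
    [/\ injective s, forall t, f i (s t) = - f i t &
        forall j t, (j < i)%N -> f j (s t) = f j t].

Section umd_finite.
Context {R : realType} {X : completeNormedModType R} (T : finType) (t0 : T).
Variables (p b : R) (n : nat) (f : nat -> T -> R) (c : nat -> X).
Hypotheses (p1 : 1 < p) (bX : umd_bound X p b) (altf : alternating_family n f).

Let N := #|T|.-1.
Let NT : N.+1 = #|T|. Proof. by rewrite prednK//; apply/card_gt0P; exists t0. Qed.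
Let e k := nth t0 (enum T) k.
Let fn i k : R := if (i < n)%N then f i (e k) else 0.

Let sum_e (F : nat -> R) : \sum_(k < N.+1) F k = \sum_(t : T) F (enum_rank t).
Proof. by rewrite NT (reindex enum_rank)//=; exact/onW_bij/enum_rank_bij. Qed.

Let eK (t : T) : e (enum_rank t) = t. Proof. exact: nth_enum_rank. Qed.

Let fn_s i : forall k, fn i k \in 0 :: [seq f i (e k) | k <- iota 0 #|T|] ++ [:: f i t0].
Proof.
move=> k; rewrite /fn; case: ifP => _; last by rewrite mem_head.
rewrite inE mem_cat; apply/orP; right.
have [kT|kT] := ltnP k #|T|.
  by apply/orP; left; apply/mapP; exists k => //; rewrite mem_iota.
by apply/orP; right; rewrite /e nth_default ?inE// -cardE.
Qed.

Let F (j : nat) : set (set nat) :=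
  [set A | forall k l, (forall i, (i <= j)%N -> fn i k = fn i l) -> A k -> A l].

Let F_fn i j v : (i <= j)%N -> F j (fn i @^-1` [set v]).
Proof. by move=> ij k l /(_ i ij) /= <-. Qed.

Let mdF : martingale_difference (@unif_nat R N) p F (fun j k => fn j k *: c j).
Proof.
split.
- split=> [j|j A FA k l kl]; last by apply: FA => i ij; apply: kl; rewrite leqW.
  split=> //; split.
  + by move=> k l.
  + move=> A FA k l kl; rewrite !setTD => nAk Al; apply: nAk.
    by apply: (FA l k) => // i ij; rewrite kl.
  + by move=> A FA k l kl [i _ Ak]; exists i => //; exact: (FA i k l).
- move=> j; split; first exact: (strongly_measurable_level (unif_nat N) _ (fn_s j)).
  by rewrite Lpnorm_unif_nat ltry.
- by move=> j; apply: (strongly_measurable_level (unif_nat N) _ (fn_s j)) => // v; exact: F_fn.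
move=> j A FA.
have h k : \1_A k * fn j.+1 k \in 0 :: [seq f j.+1 (e k) | k <- iota 0 #|T|] ++ [:: f j.+1 t0].
  by rewrite indicE; case: (k \in A); rewrite ?mul1r// mul0r mem_head.
under eq_fun do rewrite scalerA.
have := is_bochner_level (unif_nat N) (c j.+1) h.
rewrite step_int_level_unif_nat// [Y in Y *: _](_ : _ = 0) ?scale0r.
  by apply=> v.
rewrite (sum_e (fun k => \1_A k * fn j.+1 k)).
apply/eqP; rewrite mulf_eq0; apply/orP; right.
have [jn|jn] := boolP (j.+1 < n)%N; last first.
  by rewrite big1// => t _; rewrite /fn (negbTE jn) mulr0.
have [s [s_inj sf sfj]] := altf jn.
set S := \sum_t _.
suff : S = - S by move/eqP; rewrite -addr_eq0 -mulr2n mulrn_eq0.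
(* A is a union of common level sets of the first members, so it is invariant
   under the reversal of the next one. *)
rewrite {1}/S (reindex_inj s_inj)/= /S -sumrN; apply: eq_bigr => t _.
rewrite /fn jn !eK sf mulrN; congr (- (_ * _)).
have hst i : (i <= j)%N -> fn i (enum_rank (s t)) = fn i (enum_rank t).
  by move=> ij; rewrite /fn !eK; case: ifP => // _; rewrite sfj.
rewrite !indicE; congr (_%:R); congr nat_of_bool; apply/idP/idP.
  by rewrite !inE; apply: FA.
by rewrite !inE; apply: FA => i ij; rewrite hst.
Qed.

Lemma umd_alternating_bound (eps : nat -> bool) :
  avgnorm p (fun t => \sum_(i < n) ((-1) ^+ (eps i) * f i t) *: c i) <=
  b * avgnorm p (fun t => \sum_(i < n) f i t *: c i).
Proof.
have := bX mdF n eps.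
rewrite !Lpnorm_unif_nat -EFinM lee_fin avgnorm.unlock.
rewrite (sum_e (fun k => `|\sum_(j < n) (-1) ^+ eps j *: (fn j k *: c j)| `^ p)).
rewrite (sum_e (fun k => `|\sum_(j < n) fn j k *: c j| `^ p)) NT.
rewrite (eq_bigr (fun t => `|\sum_(i < n) ((-1) ^+ eps i * f i t) *: c i| `^ p)).
  rewrite [in X in _ <= X -> _](eq_bigr (fun t => `|\sum_(i < n) f i t *: c i| `^ p)) => [//|t _].
  by congr (`|_| `^ _); apply: eq_bigr => i _; rewrite /fn ltn_ord eK.
move=> t _; congr (`|_| `^ _).
by apply: eq_bigr => i _; rewrite /fn ltn_ord eK scalerA.
Qed.

End umd_finite.

(** The form in which UMD is used from here on: a statement about finite sets. *)
Definition unconditional_bound {R : realType} (X : completeNormedModType R)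
    (p b : R) : Prop :=
  forall (T : finType) (n : nat) (f : nat -> T -> R) (c : nat -> X)
    (eps : nat -> bool), alternating_family n f ->
  avgnorm p (fun t => \sum_(i < n) ((-1) ^+ (eps i) * f i t) *: c i) <=
  b * avgnorm p (fun t => \sum_(i < n) f i t *: c i).

Section umd_constant_lemmas.
Context {R : realType} {X : completeNormedModType R}.
Variables (p : R).
Hypotheses (p1 : 1 < p) (UX : UMD X).

Lemma avgnorm_ge0 (T : finType) (f : T -> X) : 0 <= avgnorm p f.
Proof. rewrite avgnorm.unlock; exact: powR_ge0. Qed.

Lemma avgnorm_card0 (T : finType) (f : T -> X) : #|T| = 0%N -> avgnorm p f = 0.
Proof.
move=> /card0_eq T0; rewrite avgnorm.unlock big_pred0//.
by rewrite mulr0 powR0// invr_eq0 gt_eqF// (lt_trans _ p1).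
Qed.

(** A negative bound can only occur for trivial X; replacing it by 0 keeps it a
    bound and makes the set nonempty. *)
Lemma umd_constant_has_inf :
  has_inf [set b : R | 0 <= b /\ umd_bound X p b].
Proof.
split; last by exists 0 => b [].
have [b bX] := UX p1; exists (Num.max b 0) => /=; split.
  by rewrite le_max lexx orbT.
move=> d T P F D mD n eps; apply: (le_trans (bX d T P F D mD n eps)).
by apply: lee_wpmul2r; [exact: Lpnorm_ge0|rewrite lee_fin le_max lexx].
Qed.

Lemma umd_constant_ge0 : 0 <= umd_constant X p.
Proof.
by apply: lb_le_inf; [case: umd_constant_has_inf|move=> b []].
Qed.

(** The infimum need not be known to be a UMD bound itself: the inequality for one
    family is closed in the constant. *)
Lemma umd_constant_unconditional : unconditional_bound X p (umd_constant X p).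
Proof.
move=> T n f c eps altf.
have [T0|T0] := posnP #|T|; first by rewrite !avgnorm_card0// mulr0.
have [t0 _] : exists t0 : T, t0 \in T by apply/card_gt0P.
set A := avgnorm p _; set B := avgnorm p _.
have AbB b : 0 <= b /\ umd_bound X p b -> A <= b * B.
  by move=> [b0 bX]; exact: umd_alternating_bound.
have [B0|B0] := eqVneq B 0.
  have [b bP] := umd_constant_has_inf.1.
  by rewrite B0 mulr0 (le_trans (AbB _ bP))// B0 mulr0.
have {}B0 : 0 < B by rewrite lt_neqAle eq_sym B0 avgnorm_ge0.
rewrite -ler_pdivrMr//; apply: lb_le_inf; first by case: umd_constant_has_inf.
by move=> b bP; rewrite ler_pdivrMr// AbB.
Qed.

End umd_constant_lemmas.

Section avgnorm_theory.
Context {R : realType} {X : completeNormedModType R}.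
Variables (p : R).
Hypotheses (p1 : 1 < p).
Let p0 : 0 < p. Proof. exact: lt_trans p1. Qed.
Implicit Types (T : finType).

Lemma avgnorm_powR T (f : T -> X) :
  avgnorm p f `^ p = #|T|%:R^-1 * \sum_t `|f t| `^ p.
Proof.
rewrite avgnorm.unlock -powRrM mulVf ?gt_eqF// powRr1//.
by rewrite mulr_ge0 ?invr_ge0// sumr_ge0// => t _; exact: powR_ge0.
Qed.

Lemma le_powR_inj (x y : R) : 0 <= x -> 0 <= y -> (x `^ p <= y `^ p) = (x <= y).
Proof.
by move=> x0 y0; apply/idP/idP; [apply: contraTT; rewrite -!ltNge => yx;
  apply: gt0_ltr_powR|apply: ge0_ler_powR; rewrite ?nnegrE// ltW].
Qed.

Lemma eq_avgnorm T (f g : T -> X) : f =1 g -> avgnorm p f = avgnorm p g.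
Proof. by move=> /funext ->. Qed.

Lemma avgnormZ T (a : R) (f : T -> X) :
  avgnorm p (fun t => a *: f t) = `|a| * avgnorm p f.
Proof.
apply: (powR_injective p0); first by rewrite nnegrE avgnorm_ge0.
  by rewrite nnegrE mulr_ge0// avgnorm_ge0.
rewrite (powRM _ (normr_ge0 a) (avgnorm_ge0 p f)) !avgnorm_powR mulrCA.
congr (_ * _); rewrite mulr_sumr; apply: eq_bigr => t _.
by rewrite normrZ (powRM _ (normr_ge0 a) (normr_ge0 _)).
Qed.

Lemma avgnormD T (f g : T -> X) :
  avgnorm p (fun t => f t + g t) <= avgnorm p f + avgnorm p g.
Proof.
have [T0|T0] := posnP #|T|; first by rewrite !(avgnorm_card0 p1)// addr0.
have [t0 _] : exists t0 : T, t0 \in T by apply/card_gt0P.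
pose e k := nth t0 (enum T) k.
have eK (t : T) : e (enum_rank t) = t by exact: nth_enum_rank.
have avgE (h : T -> R) : ('N[unif_nat #|T|.-1]_p%:E [EFin \o (h \o e)] =
    ((#|T|%:R^-1 * \sum_t `|h t| `^ p) `^ p^-1)%:E)%E.
  rewrite Lnorm.unlock; under eq_integral do rewrite /=.
  rewrite integral_unif_nat; last by move=> k; exact: powR_ge0.
  rewrite poweR_EFin prednK// (reindex enum_rank)/=.
    by under eq_bigr do rewrite eK.
  exact/onW_bij/enum_rank_bij.
have mh (h : nat -> R) : measurable_fun [set: nat] h by [].
have := minkowski_EFin (unif_nat #|T|.-1)
  (mh (fun k => `|f (e k)|)) (mh (fun k => `|g (e k)|)) (ltW p1).
rewrite (avgE (fun t => `|f t|)) (avgE (fun t => `|g t|)).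
rewrite (avgE (fun t => `|f t| + `|g t|)) -EFinD lee_fin => H.
rewrite avgnorm.unlock.
have nn (h : T -> X) : \sum_t `| `|h t| | `^ p = \sum_t `|h t| `^ p.
  by apply: eq_bigr => t _; rewrite normr_id.
rewrite !nn in H; apply: le_trans H.
have mean_ge0 (h : T -> R) : 0 <= #|T|%:R^-1 * \sum_t `|h t| `^ p.
  apply: mulr_ge0; first by rewrite invr_ge0.
  by apply: sumr_ge0 => t _; exact: powR_ge0.
apply: ge0_ler_powR.
- by rewrite invr_ge0 ltW.
- by rewrite nnegrE -nn; exact: mean_ge0.
- by rewrite nnegrE; exact: mean_ge0.
apply: ler_wpM2l; first by rewrite invr_ge0.
apply: ler_sum => t _; apply: ge0_ler_powR; rewrite ?nnegrE ?(ltW p0)//.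
exact: le_trans (ler_normD _ _) (ler_norm _).
Qed.

End avgnorm_theory.

(** * Randomised sums and exchanges *)

Section fubini_avgnorm.
Context {R : realType} {X : completeNormedModType R}.
Variables (p : R).
Hypotheses (p1 : 1 < p).
Let p0 : 0 < p. Proof. exact: lt_trans p1. Qed.
Variables (T W : finType) (F : T * W -> X).

Lemma avgnorm_prod : avgnorm p F `^ p =
  #|W|%:R^-1 * \sum_w avgnorm p (fun t => F (t, w)) `^ p.
Proof.
rewrite avgnorm_powR//.
rewrite (eq_bigr (fun w => #|T|%:R^-1 * \sum_t `|F (t, w)| `^ p)); last first.
  by move=> w _; rewrite avgnorm_powR.
rewrite -mulr_sumr mulrA card_prod natrM invfM mulrC [RHS]mulrC.
rewrite exchange_big/= pair_big/=; congr (_ * _); last by rewrite mulrC.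
by apply: eq_bigr => -[].
Qed.

Lemma avgnorm_prod_le (K : R) : 0 <= K ->
  (forall w, avgnorm p (fun t => F (t, w)) <= K) -> avgnorm p F <= K.
Proof.
move=> K0 FK; rewrite -(le_powR_inj p1) ?avgnorm_ge0// avgnorm_prod.
have [W0|W0] := posnP #|W|; first by rewrite W0 invr0 mul0r powR_ge0.
rewrite ler_pdivrMl ?ltr0n// mulr_natl -sumr_const ler_sum// => w _.
by rewrite le_powR_inj ?avgnorm_ge0.
Qed.

Lemma avgnorm_prod_ge (K : R) : 0 <= K -> (0 < #|W|)%N ->
  (forall w, K <= avgnorm p (fun t => F (t, w))) -> K <= avgnorm p F.
Proof.
move=> K0 W0 FK; rewrite -(le_powR_inj p1) ?avgnorm_ge0// avgnorm_prod.
rewrite ler_pdivlMl ?ltr0n// mulr_natl -sumr_const ler_sum// => w _.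
by rewrite le_powR_inj ?avgnorm_ge0.
Qed.

End fubini_avgnorm.

Section rademacher.
Context {R : realType} {X : completeNormedModType R}.
Variables (p b : R) (T : finType) (n : nat) (c : nat -> X).
Hypotheses (p1 : 1 < p) (b0 : 0 <= b) (bX : unconditional_bound X p b).
Implicit Types f g e : nat -> T -> R.

Local Notation signs := {ffun 'I_n -> bool}.

(** The L^p norm, over T and over independent signs r_i, of the sum of the
    r_i f_i c_i. *)
Definition radnorm f : R :=
  avgnorm p (fun x : T * signs => \sum_(i < n) ((-1) ^+ x.2 i * f i x.1) *: c i).

Local Notation norm f := (avgnorm p (fun t => \sum_(i < n) f i t *: c i)).

Lemma radnorm_ge0 f : 0 <= radnorm f. Proof. exact: avgnorm_ge0. Qed.

Let sgn (w : signs) (i : nat) : bool := if insub i is Some j then w j else false.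

Let sgnE w (i : 'I_n) : sgn w i = w i. Proof. by rewrite /sgn valK. Qed.

Lemma alternating_sign f (w : nat -> bool) : alternating_family n f ->
  alternating_family n (fun i t => (-1) ^+ w i * f i t).
Proof.
move=> altf i /altf[s [sinj sf sj]]; exists s; split=> //.
  by move=> t; rewrite sf mulrN.
by move=> j t ji; rewrite sj.
Qed.

(** For each choice of signs the signed sum dominates the original one up to b,
    signs being their own inverses; so does the average over all choices. *)
Lemma avgnorm_le_radnorm f : alternating_family n f -> norm f <= b * radnorm f.
Proof.
move=> altf; have fw (w : signs) : norm f <=
    b * avgnorm p (fun t => \sum_(i < n) ((-1) ^+ w i * f i t) *: c i).
  have := bX c (sgn w) (alternating_sign (sgn w) altf).
  under [X in _ <= _ * X -> _]eq_avgnorm => t.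
    under eq_bigr => i _ do rewrite sgnE. over.
  apply: le_trans; rewrite le_eqVlt; apply/orP; left; apply/eqP.
  by apply: eq_avgnorm => t; apply: eq_bigr => i _; rewrite mulrA -signr_addb addbb mul1r.
have [b_eq0|b_neq0] := eqVneq b 0.
  by have := fw [ffun=> false]; rewrite b_eq0 !mul0r.
have b_gt0 : 0 < b by rewrite lt_neqAle eq_sym b_neq0.
rewrite -ler_pdivrMl//; apply: avgnorm_prod_ge => //.
- by rewrite mulr_ge0 ?avgnorm_ge0// invr_ge0.
- by apply/card_gt0P; exists [ffun=> false].
- by move=> w; rewrite ler_pdivrMl//; exact: fw.
Qed.

Lemma radnorm_le_avgnorm f : alternating_family n f -> radnorm f <= b * norm f.
Proof.
move=> altf; apply: avgnorm_prod_le => //; first by rewrite mulr_ge0 ?avgnorm_ge0.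
move=> w /=; have := bX c (sgn w) altf; apply: le_trans.
rewrite le_eqVlt; apply/orP; left; apply/eqP.
by apply: eq_avgnorm => t; apply: eq_bigr => i _; rewrite sgnE.
Qed.

Lemma eq_radnorm f g : (forall i t, (i < n)%N -> f i t = g i t) -> radnorm f = radnorm g.
Proof. by move=> fg; apply: eq_avgnorm => x; apply: eq_bigr => i _; rewrite fg. Qed.

Lemma radnormD f g : radnorm (fun i t => f i t + g i t) <= radnorm f + radnorm g.
Proof.
apply: le_trans (avgnormD p1 _ _); rewrite le_eqVlt; apply/orP; left; apply/eqP.
apply: eq_avgnorm => x; rewrite -big_split/=; apply: eq_bigr => i _.
by rewrite mulrDr scalerDl.
Qed.

Lemma radnormZ a f : radnorm (fun i t => a * f i t) = `|a| * radnorm f.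
Proof.
rewrite -avgnormZ//; apply: eq_avgnorm => x; rewrite scaler_sumr; apply: eq_bigr => i _.
by rewrite scalerA mulrCA.
Qed.

(** The signs absorb the sign of each [f i t]: at a fixed point the
    distribution of the random sum depends on the absolute values only. *)
Lemma radnorm_abs f g : (forall i t, (i < n)%N -> `|f i t| = `|g i t|) ->
  radnorm f = radnorm g.
Proof.
move=> fg; apply: (powR_injective (lt_trans ltr01 p1)).
- by rewrite nnegrE radnorm_ge0.
- by rewrite nnegrE radnorm_ge0.
rewrite !avgnorm_powR//; congr (_ * _).
rewrite -(pair_bigA _ (fun t w => `|\sum_(i < n) ((-1) ^+ (w : signs) i * f i t) *: c i| `^ p)).
rewrite -(pair_bigA _ (fun t w => `|\sum_(i < n) ((-1) ^+ (w : signs) i * g i t) *: c i| `^ p)).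
apply: eq_bigr => t _.
pose h (w : signs) : signs := [ffun i : 'I_n => w i (+) (f i t != g i t)].
have hK : involutive h by move=> w; apply/ffunP => i; rewrite !ffunE addbK.
rewrite (reindex_inj (inv_inj hK))/=; apply: eq_bigr => w _; congr (`|_| `^ _).
apply: eq_bigr => i _; rewrite ffunE; congr (_ *: _).
have [->|fgi] := eqVneq (f i t) (g i t); first by rewrite addbF.
have /eqP := fg i t (ltn_ord i); rewrite eqr_norm2 (negbTE fgi) /= => /eqP ->.
by rewrite addbT signrN mulrNN.
Qed.

(** A function equal to 0 or to [g i t] is the mean of [g i t] and of a function
    of the same absolute value. *)
Lemma radnorm_contract f g :
    (forall i t, (i < n)%N -> f i t = 0 \/ `|f i t| = `|g i t|) ->
  radnorm f <= radnorm g.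
Proof.
move=> fg; pose h (s : R) i t := if f i t == 0 then s * g i t else f i t.
have hE s : `|s| = 1 -> radnorm (h s) = radnorm g.
  move=> s1; apply: radnorm_abs => i t ni; rewrite /h; case: ifPn => [_|f0].
    by rewrite normrM s1 mul1r.
  by have [fi0|//] := fg i t ni; rewrite fi0 eqxx in f0.
have -> : radnorm f = radnorm (fun i t => 2^-1 * (h 1 i t + h (-1) i t)).
  apply: eq_radnorm => i t _; rewrite /h; case: ifPn => [/eqP ->|_].
    by rewrite mul1r mulN1r subrr mulr0.
  by rewrite mulrDr ![2^-1 * _]mulrC -splitr.
rewrite radnormZ ger0_norm// ler_pdivrMl//.
by rewrite (le_trans (radnormD _ _))// !hE ?normrN ?normr1// mulr_natl mulr2n.
Qed.

(** Fixing the earlier [e j] and [e' j] separately, and not only their difference,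
    is what leaves both [e j + e' j] and [e j - e' j] unchanged. *)
Definition swappable (e e' : nat -> T -> R) := forall i, (i < n)%N ->
  exists s : T -> T, [/\ injective s, forall t, e i (s t) = e' i t,
    forall t, e' i (s t) = e i t &
    forall j t, (j < i)%N -> e j (s t) = e j t /\ e' j (s t) = e' j t].

Let half_sum (F : nat -> X) :
  \sum_(k < n.*2) F k = \sum_(i < n) (F i.*2 + F i.*2.+1).
Proof.
elim: n => [|m IHm]; first by rewrite !big_ord0.
by rewrite doubleS !big_ord_recr/= IHm addrA.
Qed.

(** The functions [r_i (e_i + e'_i)] and [r_i (e_i - e'_i)], taken alternately,
    form an alternating family: the first is reversed by flipping the sign
    [r_i], the second by exchanging [e_i] and [e'_i]. Changing the sign of
    every second member turns [r_i e_i] into [r_i e'_i]. *)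
Lemma radnorm_swap e e' : swappable e e' -> radnorm e' <= b * radnorm e.
Proof.
move=> swe.
(* The members with even index 2 i are r_i (e_i + e'_i), those with odd index
   2 i + 1 are r_i (e_i - e'_i). *)
pose F k (x : T * signs) : R := (-1) ^+ sgn x.2 k./2 *
  (if odd k then e k./2 x.1 - e' k./2 x.1 else e k./2 x.1 + e' k./2 x.1).
pose c' k := 2^-1 *: c k./2.
have altF : alternating_family n.*2 F.
  move=> k kn2; have ni : (k./2 < n)%N by rewrite ltn_half_double.
  have halfW j : (j < k)%N -> (j./2 <= k./2)%N by move=> jk; exact/half_leq/ltnW.
  case ok : (odd k).
    have [s [sinj se se' sj]] := swe _ ni.
    exists (fun x => (s x.1, x.2)); split=> [[t w] [t' w'] [/sinj -> ->]//| |].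
      by move=> [t w]; rewrite /F ok /= se se' -mulrN opprB.
    move=> j [t w] jk; rewrite /F /=; have := halfW _ jk.
    rewrite leq_eqVlt => /orP[/eqP jk2|/(sj _ t)[-> ->]//].
    have -> : odd j = false.
      apply/negbTE/negP => oj; move: jk.
      by rewrite -(odd_double_half j) -(odd_double_half k) oj ok jk2 ltnn.
    by rewrite jk2 se se' addrC.
  pose flip (w : signs) : signs := [ffun l => w l (+) (l == Ordinal ni)].
  have flipK : involutive flip by move=> w; apply/ffunP => l; rewrite !ffunE addbK.
  exists (fun x => (x.1, flip x.2)); split=> [[t w] [t' w'] [-> /(inv_inj flipK) ->]//| |].
    move=> [t w]; rewrite /F ok /= -mulNr -signrN; congr ((-1) ^+ nat_of_bool _ * _).
    have sgni v : sgn v k./2 = v (Ordinal ni) by rewrite -[RHS]sgnE.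
    by rewrite !sgni ffunE eqxx addbT.
  move=> j [t w] jk; rewrite /F /=; congr ((-1) ^+ nat_of_bool _ * _).
  rewrite /sgn; case: insubP => //= l _ lj; rewrite ffunE.
  have [lk|//] := eqVneq l (Ordinal ni); last by rewrite addbF.
  move: jk; rewrite -(odd_double_half j) -(odd_double_half k) -lj lk ok /= add0n.
  by rewrite -[X in (_ < X)%N]add0n ltn_add2r.
have := bX c' odd altF.
have FE (i : 'I_n) x : F i.*2 x = (-1) ^+ x.2 i * (e i x.1 + e' i x.1).
  by rewrite /F odd_double doubleK sgnE.
have FoE (i : 'I_n) x : F i.*2.+1 x = (-1) ^+ x.2 i * (e i x.1 - e' i x.1).
  by rewrite /F /= odd_double /= uphalf_double sgnE.
have c'E (i : 'I_n) : c' i.*2 = 2^-1 *: c i by rewrite /c' doubleK.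
have c'oE (i : 'I_n) : c' i.*2.+1 = 2^-1 *: c i by rewrite /c' /= uphalf_double.
have eqe' : (fun x => \sum_(k < n.*2) ((-1) ^+ odd k * F k x) *: c' k) =1
    fun x : T * signs => \sum_(i < n) ((-1) ^+ x.2 i * e' i x.1) *: c i.
  move=> x; rewrite (half_sum (fun k => ((-1) ^+ odd k * F k x) *: c' k)).
  apply: eq_bigr => i _; rewrite /= odd_double /= expr0 expr1 mul1r mulN1r.
  by rewrite FE FoE c'E c'oE -scalerDl scalerA; congr (_ *: _); field.
have eqe : (fun x => \sum_(k < n.*2) F k x *: c' k) =1
    fun x : T * signs => \sum_(i < n) ((-1) ^+ x.2 i * e i x.1) *: c i.
  move=> x; rewrite (half_sum (fun k => F k x *: c' k)); apply: eq_bigr => i _.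
  by rewrite FE FoE c'E c'oE -scalerDl scalerA; congr (_ *: _); field.
rewrite (eq_avgnorm p eqe') (eq_avgnorm p eqe).
exact.
Qed.

Lemma swappable_sym e e' : swappable e e' -> swappable e' e.
Proof.
move=> swe i /swe[s [sinj se se' sj]]; exists s; split=> // j t /(sj j t)[-> ->//].
Qed.

Lemma swappable_alternating e e' : swappable e e' ->
  alternating_family n (fun i t => e' i t - e i t).
Proof.
move=> swe i /swe[s [sinj se se' sj]]; exists s; split=> [//|t|j t ji].
  by rewrite se se' opprB.
by have [-> ->] := sj j t ji.
Qed.

Lemma radnormB f g : radnorm (fun i t => f i t - g i t) <= radnorm f + radnorm g.
Proof.
apply: le_trans (radnormD _ _) _; rewrite lerD2l le_eqVlt; apply/orP; left.
by apply/eqP; apply: radnorm_abs => i t _; rewrite normrN.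
Qed.

Lemma sum_normD f g : norm (fun i t => f i t + g i t) <= norm f + norm g.
Proof.
apply: le_trans (avgnormD p1 _ _); rewrite le_eqVlt; apply/orP; left; apply/eqP.
by apply: eq_avgnorm => t; rewrite -big_split/=; apply: eq_bigr => i _; rewrite scalerDl.
Qed.

Lemma sum_normZ a f : norm (fun i t => a * f i t) = `|a| * norm f.
Proof.
rewrite -avgnormZ//; apply: eq_avgnorm => t; rewrite scaler_sumr.
by apply: eq_bigr => i _; rewrite scalerA.
Qed.

(** The differences are themselves alternating, so they may be randomised, and
    then the two terms are estimated separately. *)
Lemma swappable_difference e e' : swappable e e' ->
  norm (fun i t => e' i t - e i t) <= b * (radnorm e' + radnorm e).
Proof.
move=> swe; apply: le_trans (avgnorm_le_radnorm (swappable_alternating swe)) _.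
by rewrite ler_wpM2l// radnormB.
Qed.

(** Applied with Haar functions h, with e the indicator functions of their supports
    and with e' those of the translated supports: randomised sums do not
    distinguish h from its absolute value. *)
Lemma shift_estimate h e e' : alternating_family n h ->
    (forall i t, (i < n)%N -> `|h i t| = e i t) -> swappable e e' ->
  norm (fun i t => e' i t - e i t) <= b ^+ 2 * (b + 1) * norm h.
Proof.
move=> alth he swe; apply: le_trans (swappable_difference swe) _.
have re : radnorm e <= b * norm h.
  apply: le_trans (radnorm_le_avgnorm alth); rewrite le_eqVlt; apply/orP; left.
  by apply/eqP; apply: radnorm_abs => i t ni; rewrite -he// normr_id.
have -> : b ^+ 2 * (b + 1) * norm h = b * ((b + 1) * (b * norm h)) by ring.
apply: ler_wpM2l => //; apply: le_trans (_ : (b + 1) * radnorm e <= _).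
  by rewrite mulrDl mul1r lerD2r radnorm_swap.
by apply: ler_wpM2l => //; rewrite addr_ge0.
Qed.

(** The indices 0, 1, 2 stand for the left, middle and right thirds of an interval
    and the primed functions for the thirds of its translate. Only differences
    along exchangeable pairs are estimated: the sum of the primed functions minus
    the sum of the others is three times the move of the middle third, corrected
    by the four moves between outer and middle thirds. *)
Lemma third_estimate h (e0 e1 e2 e0' e1' e2' : nat -> T -> R) :
    alternating_family n h ->
    (forall i t, (i < n)%N -> [/\ e0 i t = 0 \/ `|e0 i t| = `|h i t|,
       e1 i t = 0 \/ `|e1 i t| = `|h i t| & e2 i t = 0 \/ `|e2 i t| = `|h i t|]) ->
    swappable e1 e1' -> swappable e0 e1 -> swappable e2 e1 ->
    swappable e0' e1' -> swappable e2' e1' ->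
  norm (fun i t => (e0' i t + e1' i t + e2' i t) - (e0 i t + e1 i t + e2 i t)) <=
  b ^+ 2 * (2 * b ^+ 2 + 5 * b + 7) * norm h.
Proof.
move=> alth he s1 s01 s21 s01' s21'.
pose r := radnorm h.
have r0 : 0 <= r by exact: radnorm_ge0.
have rh : r <= b * norm h by exact: radnorm_le_avgnorm.
have re0 : radnorm e0 <= r by apply: radnorm_contract => i t /(he i t)[].
have re1 : radnorm e1 <= r by apply: radnorm_contract => i t /(he i t)[].
have re2 : radnorm e2 <= r by apply: radnorm_contract => i t /(he i t)[].
have re1' : radnorm e1' <= b * r.
  by apply: le_trans (radnorm_swap s1) _; rewrite ler_wpM2l.
have re0' : radnorm e0' <= b * (b * r).
  by apply: le_trans (radnorm_swap (swappable_sym s01')) _; rewrite ler_wpM2l.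
have re2' : radnorm e2' <= b * (b * r).
  by apply: le_trans (radnorm_swap (swappable_sym s21')) _; rewrite ler_wpM2l.
have d1 := swappable_difference s1.
have d01 := swappable_difference s01.
have d21 := swappable_difference s21.
have d01' := swappable_difference s01'.
have d21' := swappable_difference s21'.
(* e0' + e1' + e2' is 3 e1' minus the two differences to the outer thirds, and
   likewise without primes. *)
pose f1 i t := 3 * (e1' i t - e1 i t).
pose f2 i t := - 1 * (e1' i t - e0' i t); pose f3 i t := - 1 * (e1' i t - e2' i t).
pose f4 i t := e1 i t - e0 i t; pose f5 i t := e1 i t - e2 i t.
have split5 i t : (e0' i t + e1' i t + e2' i t) - (e0 i t + e1 i t + e2 i t) =
    (f1 i t + (f2 i t + f3 i t)) + (f4 i t + f5 i t).
  by rewrite /f1 /f2 /f3 /f4 /f5; ring.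
under eq_avgnorm => t do under eq_bigr => i _ do rewrite split5.
apply: le_trans (sum_normD (fun i t => f1 i t + (f2 i t + f3 i t))
  (fun i t => f4 i t + f5 i t)) _.
apply: le_trans (lerD (sum_normD f1 (fun i t => f2 i t + f3 i t)) (sum_normD f4 f5)) _.
apply: le_trans (lerD (lerD (lexx (norm f1)) (sum_normD f2 f3)) (lexx _)) _.
rewrite (sum_normZ 3 (fun i t => e1' i t - e1 i t)).
rewrite (sum_normZ (- 1) (fun i t => e1' i t - e0' i t)).
rewrite (sum_normZ (- 1) (fun i t => e1' i t - e2' i t)).
rewrite normrN normr1 !mul1r ger0_norm//.
have bD (x y : R) : x <= y -> b * x <= b * y by move=> xy; rewrite ler_wpM2l.
apply: le_trans (_ : b * (2 * b ^+ 2 + 5 * b + 7) * r <= _).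
  have D1 := le_trans d1 (bD _ _ (lerD re1' re1)).
  have D2 := le_trans d01 (bD _ _ (lerD re1 re0)).
  have D3 := le_trans d21 (bD _ _ (lerD re1 re2)).
  have D4 := le_trans d01' (bD _ _ (lerD re1' re0')).
  have D5 := le_trans d21' (bD _ _ (lerD re1' re2')).
  rewrite expr2; lra.
have k0 : 0 <= b * (2 * b ^+ 2 + 5 * b + 7).
  by rewrite mulr_ge0// !addr_ge0// mulr_ge0// exprn_ge0.
by apply: le_trans (ler_wpM2l k0 rh) _; rewrite le_eqVlt; apply/orP; left; apply/eqP; ring.
Qed.

End rademacher.

(** * Exchanges of blocks of integers *)

(** Intervals of integers given by left end and length. *)
Definition block (a v y : int) : bool := (a <= y) && (y < a + v).

Definition swap (a a' v y : int) : int :=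
  if block a v y then y + (a' - a) else
  if block a' v y then y - (a' - a) else y.

Definition apart (a u b v : int) : Prop := a + u <= b \/ b + v <= a.

(** A cut at x does not separate two points of the interval from lo to hi. *)
Definition outside (x lo hi : int) : Prop := x <= lo \/ hi <= x.

Lemma swapK a a' v : apart a v a' v -> involutive (swap a a' v).
Proof.
move=> h y; rewrite /swap; case h1: (block a v y).
  case: ifP => h3; last case: ifP => h4; move: h h1 h3; rewrite /apart /block; try lia.
  by move: h4; rewrite /block; lia.
case h2: (block a' v y).
  by case: ifP => h3; move: h h2 h3; rewrite /apart /block; lia.
by rewrite h1 h2.
Qed.

Lemma block_swapl a a' v y : apart a v a' v ->
  block a v (swap a a' v y) = block a' v y.
Proof.
rewrite /apart /swap => h; case h1: (block a v y);
  last case h2: (block a' v y); move: h1; try move: h2; rewrite /block; lia.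
Qed.

Lemma block_swapr a a' v y : apart a v a' v ->
  block a' v (swap a a' v y) = block a v y.
Proof.
rewrite /apart /swap => h; case h1: (block a v y);
  last case h2: (block a' v y); move: h1; try move: h2; rewrite /block; lia.
Qed.

Lemma block_swap_apart b u a a' v y : apart b u a v -> apart b u a' v ->
  block b u (swap a a' v y) = block b u y.
Proof.
rewrite /apart /swap => h h'; case h1: (block a v y);
  last case h2: (block a' v y); move: h1; try move: h2; rewrite /block; lia.
Qed.

(** A block none of whose ends is interior to [lo, hi] contains that interval or
    is disjoint from it; an exchange inside the interval preserves it. *)
Lemma block_swap_outside lo hi b u a a' v y :
    lo <= a -> a + v <= hi -> lo <= a' -> a' + v <= hi ->
    outside b lo hi -> outside (b + u) lo hi ->
  block b u (swap a a' v y) = block b u y.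
Proof.
rewrite /outside /swap => h1 h2 h3 h4 h5 h6; case h7: (block a v y);
  last case h8: (block a' v y); move: h7; try move: h8; rewrite /block; lia.
Qed.

Section families.
Context {R : realType} (A : nat).

(** A symmetric window of 2 A consecutive integers, used as the finite set on which
    alternating families live. *)
Definition cellpos (t : 'I_(A.*2)) : int := t%:Z - A%:Z.

Definition ind (a v : int) (t : 'I_(A.*2)) : R := (block a v (cellpos t))%:R.

Definition in_range (a v : int) : Prop := - A%:Z <= a /\ a + v <= A%:Z.

Lemma lift_swap a a' v : apart a v a' v -> in_range a v -> in_range a' v ->
  exists s : 'I_(A.*2) -> 'I_(A.*2), injective s /\
    forall t, cellpos (s t) = swap a a' v (cellpos t).
Proof.
move=> ap [r1 r2] [r3 r4].
pose s (t : 'I_(A.*2)) := insubd t (absz (swap a a' v (cellpos t) + A%:Z)).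
have sE t : cellpos (s t) = swap a a' v (cellpos t).
  have := ltn_ord t; rewrite {1}/cellpos /s => tA.
  have : 0 <= swap a a' v (cellpos t) + A%:Z < A.*2%:Z.
    rewrite /swap; case h1: (block a v (cellpos t)); last
      case h2: (block a' v (cellpos t)); move: h1; try move: h2;
      by rewrite /block /cellpos; lia.
  by move=> h; rewrite val_insubd; case: ifP; lia.
exists s; split=> // t t' /(congr1 cellpos); rewrite !sE => /(can_inj (swapK ap)).
by rewrite /cellpos => h; apply: val_inj => /=; lia.
Qed.

Variables (n : nat) (a a' v : nat -> int).
Hypothesis ap : forall i, (i < n)%N -> apart (a i) (v i) (a' i) (v i).
Hypothesis ra : forall i, (i < n)%N -> in_range (a i) (v i).
Hypothesis ra' : forall i, (i < n)%N -> in_range (a' i) (v i).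
Hypothesis later : forall i j y, (i < n)%N -> (j < i)%N ->
  block (a j) (v j) (swap (a i) (a' i) (v i) y) = block (a j) (v j) y /\
  block (a' j) (v j) (swap (a i) (a' i) (v i) y) = block (a' j) (v j) y.

Lemma swappable_blocks :
  swappable n (fun i => ind (a i) (v i)) (fun i => ind (a' i) (v i)).
Proof.
move=> i ni; have [s [sinj sE]] := lift_swap (ap ni) (ra ni) (ra' ni).
exists s; split=> //.
- by move=> t; rewrite /ind sE block_swapl//; exact: ap.
- by move=> t; rewrite /ind sE block_swapr//; exact: ap.
- by move=> j t ji; rewrite /ind sE; have [-> ->] := later (cellpos t) ni ji.
Qed.

End families.

(** * Dyadic intervals in cell coordinates *)

Lemma pow2_mod3 (r : nat) : exists e : int, 2 ^+ r = 3 * e + 1 \/ 2 ^+ r = 3 * e + 2 :> int.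
Proof.
elim: r => [|r [e [IHe|IHe]]]; first by exists 0; left.
- by exists (2 * e); right; rewrite exprS IHe; lia.
- by exists (2 * e + 1); left; rewrite exprS IHe; lia.
Qed.

(** In units of 2^lambda |I| / 3 the points which cut a longer interval into thirds
    are the integers 2^r (3 k + a), never multiples of 3, while the endpoints of
    dyadic intervals of length 2^lambda |I| are the multiples 3 M. *)
Lemma third_gap (r : nat) (k M a : int) : a = 1 \/ a = 2 ->
  2 ^+ r * (3 * k + a) <= 3 * M - 1 \/ 3 * M + 1 <= 2 ^+ r * (3 * k + a).
Proof.
have [e re] := pow2_mod3 r => ha.
have -> : 2 ^+ r * (3 * k + a) = 3 * (2 ^+ r * k) + 2 ^+ r * a :> int by ring.
by case: ha => ->; case: re => ->; move: ((3 * e + _) * k) => x; lia.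
Qed.

Lemma multiple_outside (v M k : int) : 0 <= v -> outside (v * M) (v * k) (v * k + v).
Proof.
move=> v0; rewrite /outside; have [Mk|kM] := lerP M k.
  by left; apply: ler_wpM2l.
by right; rewrite -[X in _ + X]mulr1 -mulrDr ler_wpM2l//; lia.
Qed.

Lemma multiple_apart (v k l : int) : 0 <= v -> k != l -> apart (v * k) v (v * l) v.
Proof.
move=> v0 kl; rewrite /apart; have [h|h] := ltrP k l.
  by left; rewrite -[X in _ + X]mulr1 -mulrDr ler_wpM2l//; lia.
by right; rewrite -[X in _ + X]mulr1 -mulrDr ler_wpM2l//; lia.
Qed.

Section dyadic_blocks.
Variable N : int.
Implicit Types I J : dyadic.

(** The number of cells in one sixth of the interval, for cells of length
    2^-N / 6: halves consist of three sixths, thirds of two. *)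
Definition width I : int := 2 ^+ absz (N - I.1).

Lemma width_gt0 I : 0 < width I. Proof. exact: exprn_gt0. Qed.

Lemma width_tau m I : width (tau m I) = width I. Proof. by []. Qed.

Lemma width_coarser I J : I.1 <= N -> J.1 <= I.1 ->
  width J = width I * 2 ^+ absz (I.1 - J.1).
Proof. by move=> IN JI; rewrite /width -exprD; congr (_ ^+ _); lia. Qed.

(** Left ends of the parts number [a] of [I], counted from 0. *)
Definition thirdI (a : int) I : int := 6 * width I * I.2 + 2 * width I * a.
Definition halfI (a : int) I : int := 6 * width I * I.2 + 3 * width I * a.

End dyadic_blocks.

Section dyadic_pairs.
Variables (N : int) (I J : dyadic).
Hypotheses (IN : I.1 <= N) (JI : J.1 <= I.1) (IJ : J != I).
Local Notation w := (width N I).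
Local Notation w' := (width N J).

Let w0 : 0 < w. Proof. exact: width_gt0. Qed.

(** A longer dyadic interval, and each of its halves, contains I or is disjoint
    from it; intervals of equal length are disjoint. *)
Lemma half_later y (a : int) : a = 0 \/ a = 1 ->
  block (halfI N a J) (3 * w') (swap (halfI N 0 I) (halfI N 1 I) (3 * w) y) =
  block (halfI N a J) (3 * w') y.
Proof.
move=> ha; have [e|JIlt] := eqVneq J.1 I.1.
  have kk : J.2 != I.2 by apply: contraNneq IJ => k; apply/eqP; case: (I) (J) e k => ? ? [? ?] /= -> ->.
  have ww : w' = w by rewrite /width e.
  have := @multiple_apart (6 * w) J.2 I.2; rewrite /apart => /(_ _ kk) h.
  by apply: block_swap_apart; rewrite /apart /halfI ww; case: ha => ->; lia.
have ww : w' = w * 2 ^+ absz (I.1 - J.1) by exact: width_coarser.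
have [r rE] : exists r, absz (I.1 - J.1) = r.+1 by exists (absz (I.1 - J.1)).-1; lia.
have out (x : int) : outside (6 * w * x) (6 * w * I.2) (6 * w * I.2 + 6 * w).
  by apply: multiple_outside; lia.
apply: (@block_swap_outside (6 * w * I.2) (6 * w * I.2 + 6 * w)); rewrite ?/halfI; try lia.
- have := out (2 ^+ r * (2 * J.2 + a)); rewrite ww rE exprS.
  by congr outside; ring.
- have := out (2 ^+ r * (2 * J.2 + a + 1)); rewrite ww rE exprS.
  by congr outside; ring.
Qed.

Definition wholeI M I' : int := 6 * width M I' * I'.2.

Variables (l m : nat).
Hypothesis lIJ : (l %| absz (I.1 - J.1))%N.

Let coarser_width : J.1 != I.1 ->
  exists r, w' = w * (2 ^+ l * 2 ^+ r).
Proof.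
move=> e; have /dvdnP[[|s] sl] := lIJ; first by lia.
exists (s * l)%N; rewrite (width_coarser IN JI) sl mulSn exprD//.
Qed.

Let apart_same_level K : J.1 = I.1 -> K.1 = I.1 -> J != K ->
  w' = w /\ apart (6 * w * J.2) (6 * w) (6 * w * K.2) (6 * w).
Proof.
move=> JI1 KI1 JK; split; first by rewrite /width JI1.
apply: multiple_apart; first by lia.
apply: contraNneq JK => k; apply/eqP.
by move: JI1 KI1 k; case: (J) (K) => ? ? [? ?] /= -> -> ->.
Qed.

(** The hypotheses on q place I and its translate in the dyadic interval with index
    q that is 2^l times as long, and the longer intervals J do not cut that one. *)
Lemma shift_later (q : int) y : J != tau m I ->
    2 ^+ l * q <= I.2 -> I.2 + m%:Z + 1 <= 2 ^+ l * (q + 1) ->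
  block (wholeI N J) (6 * w') (swap (wholeI N I) (wholeI N (tau m I)) (6 * w) y) =
  block (wholeI N J) (6 * w') y.
Proof.
move=> JtI qI Iq; have [e|e] := eqVneq J.1 I.1.
  have [-> h] := apart_same_level e erefl IJ.
  have [_ h'] := apart_same_level e (erefl : (tau m I).1 = I.1) JtI.
  apply: block_swap_apart; first by rewrite /wholeI (_ : w' = w)// /width e.
  by rewrite /wholeI width_tau (_ : w' = w)// /width e.
have [r ww] := coarser_width e.
have out (x : int) : outside (6 * w * 2 ^+ l * x)
    (6 * w * 2 ^+ l * q) (6 * w * 2 ^+ l * q + 6 * w * 2 ^+ l).
  by apply: multiple_outside; rewrite !mulr_ge0// ltW.
have lo : 6 * w * (2 ^+ l * q) <= 6 * w * I.2 by apply: ler_wpM2l => //; lia.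
have hi : 6 * w * (I.2 + m%:Z + 1) <= 6 * w * (2 ^+ l * (q + 1)).
  by apply: ler_wpM2l => //; lia.
apply: (@block_swap_outside (6 * w * 2 ^+ l * q) (6 * w * 2 ^+ l * q + 6 * w * 2 ^+ l)).
- by rewrite /wholeI -mulrA.
- move: hi; rewrite /wholeI; set P := 2 ^+ l; nia.
- rewrite /wholeI width_tau /=; nia.
- by move: hi; rewrite /wholeI width_tau /=; set P := 2 ^+ l; nia.
- by have := out (2 ^+ r * J.2); rewrite /wholeI ww; congr outside; ring.
- by have := out (2 ^+ r * (J.2 + 1)); rewrite /wholeI ww; congr outside; ring.
Qed.

Hypothesis ml : 4 * m%:Z < 2 ^+ l.

(** The factor 4 in the bound on m leaves room: m |I| is less than a quarter, hence
    less than a third, of 2^l |I|. *)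
Let third_outside (q b : int) : J.1 != I.1 -> b = 1 \/ b = 2 ->
  outside (thirdI N b J) (6 * w * (2 ^+ l * q - m%:Z)) (6 * w * (2 ^+ l * q + m%:Z)).
Proof.
move=> e hb; have [r ww] := coarser_width e.
have -> : thirdI N b J = 2 * w * 2 ^+ l * (2 ^+ r * (3 * J.2 + b)).
  by rewrite /thirdI ww; ring.
have m0 : 6 * w * m%:Z <= 2 * w * 2 ^+ l.
  rewrite -!mulrA [6 * _]mulrCA [2 * _]mulrCA; apply: ler_wpM2l; lia.
have P0 : 0 <= 2 * w * 2 ^+ l by rewrite !mulr_ge0// ltW.
have [h|h] := third_gap r J.2 q hb; [left|right].
- by have := ler_wpM2l P0 h; lia.
- by have := ler_wpM2l P0 h; lia.
Qed.

(** The middle thirds of I and of its translate lie on the two sides of the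
    boundary point with index q, close enough to it to avoid the ends of the
    middle thirds of longer intervals. *)
Lemma third_shift_later (q : int) y : J != tau m I ->
    2 ^+ l * q - m%:Z <= I.2 -> I.2 + 1 <= 2 ^+ l * q ->
  block (thirdI N 1 J) (2 * w')
    (swap (thirdI N 1 I) (thirdI N 1 (tau m I)) (2 * w) y) =
  block (thirdI N 1 J) (2 * w') y.
Proof.
move=> JtI qI Iq; have [e|e] := eqVneq J.1 I.1.
  have [_ h] := apart_same_level e erefl IJ.
  have [ww h'] := apart_same_level e (erefl : (tau m I).1 = I.1) JtI.
  by apply: block_swap_apart; rewrite /thirdI ?width_tau ww; move: h h'; rewrite /apart /=; lia.
have lo := ler_wpM2l (ltW w0) qI; have hi := ler_wpM2l (ltW w0) Iq.
apply: (block_swap_outside (lo := 6 * w * (2 ^+ l * q - m%:Z))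
  (hi := 6 * w * (2 ^+ l * q + m%:Z))).
- rewrite /thirdI; lia.
- rewrite /thirdI; lia.
- rewrite /thirdI width_tau /=; lia.
- rewrite /thirdI width_tau /=; lia.
- by apply: third_outside => //; left.
- have := third_outside q e (or_intror erefl : 2 = 1 \/ 2 = 2).
  by rewrite /thirdI; congr outside; ring.
Qed.

(** For use with an interval of the class and with its translate, which lie on
    different sides of the boundary point with index q. The points cutting a longer
    interval into thirds are too far from that point to cut I. *)
Lemma third_swap_later (q a b : int) y :
    2 ^+ l * q - m%:Z <= I.2 -> I.2 + 1 <= 2 ^+ l * q + m%:Z ->
    a = 0 \/ a = 2 -> b = 0 \/ b = 1 \/ b = 2 ->
  block (thirdI N b J) (2 * w') (swap (thirdI N a I) (thirdI N 1 I) (2 * w) y) =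
  block (thirdI N b J) (2 * w') y.
Proof.
move=> qI Iq ha hb; have [e|e] := eqVneq J.1 I.1.
  have [ww h] := apart_same_level e erefl IJ.
  apply: block_swap_apart; rewrite /thirdI ww; move: h; rewrite /apart;
    case: ha => ha'; case: hb => [hb'|[hb'|hb']]; rewrite ?ha' ?hb';
    move: (w) w0 (J.2) (I.2) => W W0 x z; clear -W0; try lia.
have [r ww] := coarser_width e.
have lo := ler_wpM2l (ltW w0) qI; have hi := ler_wpM2l (ltW w0) Iq.
have out (c : int) : 0 <= c <= 3 ->
    outside (thirdI N c J) (6 * w * I.2) (6 * w * I.2 + 6 * w).
  move=> hc; have [c12|c03] := boolP ((c == 1) || (c == 2)).
    have : outside (thirdI N c J) (6 * w * (2 ^+ l * q - m%:Z)) (6 * w * (2 ^+ l * q + m%:Z)).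
      by apply: third_outside => //; case/orP: c12 => /eqP ->; [left|right].
    by rewrite /outside; lia.
  have [d cd] : exists d, c = 3 * d by exists (if c == 0 then 0 else 1); case: ifP; lia.
  have := @multiple_outside (6 * w) (2 ^+ l * 2 ^+ r * (J.2 + d)) I.2.
  rewrite /thirdI cd ww => /(_ _).
  have -> : 6 * (w * (2 ^+ l * 2 ^+ r)) * J.2 + 2 * (w * (2 ^+ l * 2 ^+ r)) * (3 * d) =
    6 * w * (2 ^+ l * 2 ^+ r * (J.2 + d)) by ring.
  by apply; lia.
apply: (block_swap_outside (lo := 6 * w * I.2) (hi := 6 * w * I.2 + 6 * w)).
- by rewrite /thirdI; case: ha => ->; lia.
- by rewrite /thirdI; case: ha => ->; lia.
- by rewrite /thirdI; lia.
- by rewrite /thirdI; lia.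
- by apply: out; lia.
- have := out (b + 1); rewrite /thirdI (_ : _ + 2 * w' * (b + 1) = 6 * w' * J.2 + 2 * w' * b + 2 * w'); last by ring.
  by apply; lia.
Qed.

End dyadic_pairs.

(** * The shift on one class of dyadic intervals *)

(** The translation by m leaves the dyadic interval of 2^lambda times the length. *)
Definition wraps (m : nat) (I : dyadic) : bool :=
  2 ^+ lam m - m%:Z <= (I.2 %% (2 ^+ lam m : int))%Z.

(** There are only finitely many classes for given m, and each of the collections of
    the theorem lies in one of them. *)
Definition same_class (m : nat) (I J : dyadic) : Prop :=
  [/\ (I.1 = J.1 %[mod (lam m)%:Z])%Z,
      (2 %| (I.2 %/ m)%Z)%Z = (2 %| (J.2 %/ m)%Z)%Z & wraps m I = wraps m J].

Lemma lam_bound m : 4 * m%:Z < 2 ^+ lam m.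
Proof.
rewrite /lam; case: leqP => m1; first by have -> : 2 ^+ 4 = 16 :> int by []; lia.
have := @trunc_log_ltn 2 m isT; rewrite addnC.
rewrite exprD (_ : 2 ^+ 3 = 8 :> int)// expnS.
have -> : 2 ^+ trunc_log 2 m = (2 ^ trunc_log 2 m)%N%:Z :> int by rewrite -!natz natrX.
by move: (2 ^ _)%N => P; lia.
Qed.

Lemma lam_gt0 m : (0 < lam m)%N.
Proof. by rewrite /lam; case: ifP => //; lia. Qed.

(** The translation by m changes the parity of floor (k / m). *)
Lemma same_class_tau m I J : (0 < m)%N -> same_class m I J -> J != tau m I.
Proof.
move=> m0 [_ IJ _]; apply/eqP => JI; move: IJ; rewrite JI /=.
by rewrite divzDr ?dvdzz// divzz; lia.
Qed.

Section cells.
Context {R : realType}.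
Variables (N : int) (A : nat).

Definition haar_cells (J : dyadic) (t : 'I_(A.*2)) : R :=
  @ind R A (halfI N 0 J) (3 * width N J) t - @ind R A (halfI N 1 J) (3 * width N J) t.

Definition shift_cells (m : nat) (J : dyadic) (t : 'I_(A.*2)) : R :=
  @ind R A (wholeI N (tau m J)) (6 * width N J) t -
  @ind R A (wholeI N J) (6 * width N J) t.

(** The Haar function has absolute value 1 on the interval. *)
Lemma abs_haar_cells J t :
  `|haar_cells J t| = @ind R A (wholeI N J) (6 * width N J) t.
Proof.
have := width_gt0 N J; rewrite /haar_cells /ind; set y := cellpos t => w0.
case h0: (block (halfI N 0 J) _ y); case h1: (block (halfI N 1 J) _ y);
  case h: (block (wholeI N J) _ y); rewrite ?subrr ?subr0 ?sub0r ?normrN ?normr1 ?normr0//;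
  by move: h0 h1 h; rewrite /block /halfI /wholeI; lia.
Qed.

Lemma ind_thirds (J : dyadic) t : @ind R A (wholeI N J) (6 * width N J) t =
  @ind R A (thirdI N 0 J) (2 * width N J) t + @ind R A (thirdI N 1 J) (2 * width N J) t
  + @ind R A (thirdI N 2 J) (2 * width N J) t.
Proof.
have := width_gt0 N J; rewrite /ind; set y := cellpos t => w0.
case h0: (block (thirdI N 0 J) _ y); case h1: (block (thirdI N 1 J) _ y);
  case h2: (block (thirdI N 2 J) _ y); case h: (block (wholeI N J) _ y);
  rewrite ?addr0 ?add0r//;
  by move: h0 h1 h2 h; rewrite /block /thirdI /wholeI; lia.
Qed.

Lemma third_haar (a : int) (J : dyadic) (t : 'I_(A.*2)) : 0 <= a <= 2 ->
  @ind R A (thirdI N a J) (2 * width N J) t = 0 \/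
  `|@ind R A (thirdI N a J) (2 * width N J) t| = `|haar_cells J t|.
Proof.
have := width_gt0 N J; rewrite abs_haar_cells /ind; set y := cellpos t => w0 ha.
have {}ha : a = 0 \/ a = 1 \/ a = 2 by lia.
case h0: (block (thirdI N a J) _ y); case h: (block (wholeI N J) _ y);
  rewrite ?normr1; auto.
exfalso; move: h0 h; rewrite /block /thirdI /wholeI.
by case: ha => [->|[->|->]]; lia.
Qed.

End cells.

Section sequences.
Context {R : realType}.
Variables (N : int) (A n : nat) (I : nat -> dyadic).
Hypothesis IN : forall i, (i < n)%N -> (I i).1 <= N.
Hypothesis sortedI : forall i j, (i < n)%N -> (j < i)%N -> (I j).1 <= (I i).1.
Hypothesis uniqI : forall i j, (i < n)%N -> (j < i)%N -> I j != I i.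
Hypothesis rangeI : forall i, (i < n)%N ->
  in_range A (wholeI N (I i)) (6 * width N (I i)).

Local Notation w i := (width N (I i)).
Let wgt0 i : 0 < w i. Proof. exact: width_gt0. Qed.

Lemma swappable_halves : swappable n
  (fun i => @ind R A (halfI N 0 (I i)) (3 * w i))
  (fun i => @ind R A (halfI N 1 (I i)) (3 * w i)).
Proof.
apply: swappable_blocks.
- by move=> i _; rewrite /apart /halfI; have := wgt0 i; lia.
- by move=> i /rangeI; rewrite /in_range /wholeI /halfI; have := wgt0 i; lia.
- by move=> i /rangeI; rewrite /in_range /wholeI /halfI; have := wgt0 i; lia.
move=> i j y ni ji.
by split; apply: half_later; [exact: IN|exact: sortedI|exact: uniqI|auto..].
Qed.

Lemma alternating_haar : alternating_family n (fun i => @haar_cells R N A (I i)).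
Proof. exact: swappable_alternating (swappable_sym swappable_halves). Qed.

Variable m : nat.
Hypothesis m0 : (0 < m)%N.
Hypothesis rangeT : forall i, (i < n)%N ->
  in_range A (wholeI N (tau m (I i))) (6 * w i).
Hypothesis classI : forall i j, (i < n)%N -> (j < n)%N -> same_class m (I i) (I j).

Let classes i j : (i < n)%N -> (j < i)%N ->
  [/\ (lam m %| absz ((I i).1 - (I j).1))%N, I j != tau m (I i),
      tau m (I j) != I i & tau m (I j) != tau m (I i)].
Proof.
move=> ni ji; have cij := classI ni (ltn_trans ji ni).
have cji := classI (ltn_trans ji ni) ni; split.
- have [/eqP + _ _] := cij; rewrite eqz_mod_dvd dvdzE; exact.
- exact: same_class_tau cij.
- by rewrite eq_sym; exact: same_class_tau cji.
- apply: contraNneq (uniqI ni ji).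
  by case: (I i) (I j) => ? ? [? ?] [-> /addIr ->].
Qed.

Lemma swappable_shift : (forall i, (i < n)%N -> ~~ wraps m (I i)) -> swappable n
  (fun i => @ind R A (wholeI N (I i)) (6 * w i))
  (fun i => @ind R A (wholeI N (tau m (I i))) (6 * w i)).
Proof.
move=> nw; apply: swappable_blocks => //.
  move=> i _; have := @multiple_apart (6 * w i) (I i).2 ((I i).2 + m%:Z).
  by apply; have := wgt0 i; lia.
move=> i j y ni ji; have [lij t1 t2 t3] := classes ni ji.
have L0 : 2 ^+ lam m != 0 :> int by rewrite expf_neq0.
have h1 := divz_eq (I i).2 (2 ^+ lam m).
have h2 := modz_ge0 (I i).2 L0.
have := nw i ni; rewrite /wraps -ltNge => h3.
have q1 : 2 ^+ lam m * ((I i).2 %/ (2 ^+ lam m : int))%Z <= (I i).2 by lia.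
have q2 : (I i).2 + m%:Z + 1 <= 2 ^+ lam m * (((I i).2 %/ (2 ^+ lam m : int))%Z + 1).
  by lia.
split; first exact: (shift_later (IN ni) (sortedI ni ji) (uniqI ni ji) lij _ t1 q1 q2).
have := shift_later (J := tau m (I j)) (IN ni) (sortedI ni ji) t2 lij y t3 q1 q2.
by rewrite width_tau.
Qed.

Hypothesis wrapI : forall i, (i < n)%N -> wraps m (I i).

Let boundary i : (i < n)%N -> exists q : int,
  2 ^+ lam m * q - m%:Z <= (I i).2 /\ (I i).2 + 1 <= 2 ^+ lam m * q.
Proof.
move=> ni; have L0 : 0 < 2 ^+ lam m :> int by exact: exprn_gt0.
exists (((I i).2 %/ (2 ^+ lam m : int))%Z + 1).
have h1 := divz_eq (I i).2 (2 ^+ lam m).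
have h2 := ltz_pmod (I i).2 L0.
have := wrapI ni; rewrite /wraps => h3.
by move: h1 h2 h3; set P := 2 ^+ lam m; lia.
Qed.

Lemma swappable_third_shift : swappable n
  (fun i => @ind R A (thirdI N 1 (I i)) (2 * w i))
  (fun i => @ind R A (thirdI N 1 (tau m (I i))) (2 * w i)).
Proof.
apply: swappable_blocks => //.
- move=> i _; have := @multiple_apart (6 * w i) (I i).2 ((I i).2 + m%:Z).
  rewrite /apart /thirdI width_tau /= => /(_ _ _); have := wgt0 i.
  by move=> wi H; have [] := H; lia.
- by move=> i /rangeI; rewrite /in_range /wholeI /thirdI; have := wgt0 i; lia.
- move=> i /rangeT; rewrite /in_range /wholeI /thirdI width_tau; have := wgt0 i; lia.
move=> i j y ni ji; have [lij t1 t2 t3] := classes ni ji.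
have [q [q1 q2]] := boundary ni; have ml := lam_bound m.
split; first exact: (third_shift_later (IN ni) (sortedI ni ji) (uniqI ni ji) lij ml _ t1 q1 q2).
have := third_shift_later (J := tau m (I j)) (IN ni) (sortedI ni ji) t2 lij ml y t3 q1 q2.
by rewrite width_tau.
Qed.

Lemma swappable_thirds (a : int) : a = 0 \/ a = 2 -> swappable n
  (fun i => @ind R A (thirdI N a (I i)) (2 * w i))
  (fun i => @ind R A (thirdI N 1 (I i)) (2 * w i)).
Proof.
move=> ha; apply: swappable_blocks => //.
- by move=> i _; have := wgt0 i; rewrite /apart /thirdI; case: ha => ->; lia.
- move=> i /rangeI; rewrite /in_range /wholeI /thirdI; have := wgt0 i.
  by case: ha => ->; lia.
- by move=> i /rangeI; rewrite /in_range /wholeI /thirdI; have := wgt0 i; lia.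
move=> i j y ni ji; have [lij t1 t2 t3] := classes ni ji.
have [q [q1 q2]] := boundary ni; have ml := lam_bound m.
have {}q2 : (I i).2 + 1 <= 2 ^+ lam m * q + m%:Z by lia.
split; apply: (third_swap_later (IN ni) (sortedI ni ji) (uniqI ni ji) lij ml _ q1 q2 ha).
  by case: ha; auto.
by auto.
Qed.

Lemma swappable_thirds_tau (a : int) : a = 0 \/ a = 2 -> swappable n
  (fun i => @ind R A (thirdI N a (tau m (I i))) (2 * w i))
  (fun i => @ind R A (thirdI N 1 (tau m (I i))) (2 * w i)).
Proof.
move=> ha; apply: swappable_blocks => //.
- by move=> i _; have := wgt0 i; rewrite /apart /thirdI width_tau; case: ha => ->; lia.
- move=> i /rangeT; rewrite /in_range /wholeI /thirdI width_tau; have := wgt0 i.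
  by case: ha => ->; lia.
- by move=> i /rangeT; rewrite /in_range /wholeI /thirdI width_tau; have := wgt0 i; lia.
move=> i j y ni ji; have [lij t1 t2 t3] := classes ni ji.
have [q [q1 q2]] := boundary ni; have ml := lam_bound m.
have {}q1 : 2 ^+ lam m * q - m%:Z <= (tau m (I i)).2 by rewrite /=; lia.
have {}q2 : (tau m (I i)).2 + 1 <= 2 ^+ lam m * q + m%:Z by rewrite /=; lia.
have tl b' := third_swap_later (I := tau m (I i)) (J := tau m (I j)) (b := b')
  (IN ni) (sortedI ni ji) t3 lij ml y q1 q2 ha.
by split; [have := tl a|have := tl 1]; rewrite !width_tau; apply; case: ha; auto.
Qed.

End sequences.

(** The constant of the argument by thirds; it also majorises b^2 (b + 1), the
    constant of the direct exchange. *)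
Definition shift_constant {R : realType} (b : R) : R :=
  b ^+ 2 * (2 * b ^+ 2 + 5 * b + 7).

Lemma shift_constant_ge0 {R : realType} (b : R) : 0 <= b -> 0 <= shift_constant b.
Proof.
by move=> b0; rewrite /shift_constant mulr_ge0 ?exprn_ge0// !addr_ge0 ?mulr_ge0 ?exprn_ge0.
Qed.

Section cell_estimate.
Context {R : realType} {X : completeNormedModType R}.
Variables (p b : R).
Hypotheses (p1 : 1 < p) (b0 : 0 <= b) (bX : unconditional_bound X p b).
Variables (m : nat) (N : int) (A n : nat) (I : nat -> dyadic) (c : nat -> X).
Hypothesis m0 : (0 < m)%N.
Hypothesis IN : forall i, (i < n)%N -> (I i).1 <= N.
Hypothesis sortedI : forall i j, (i < n)%N -> (j < i)%N -> (I j).1 <= (I i).1.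
Hypothesis uniqI : forall i j, (i < n)%N -> (j < i)%N -> I j != I i.
Hypothesis rangeI : forall i, (i < n)%N ->
  in_range A (wholeI N (I i)) (6 * width N (I i)).
Hypothesis rangeT : forall i, (i < n)%N ->
  in_range A (wholeI N (tau m (I i))) (6 * width N (I i)).
Hypothesis classI : forall i j, (i < n)%N -> (j < n)%N -> same_class m (I i) (I j).

Lemma cell_estimate :
  avgnorm p (fun t => \sum_(i < n) @shift_cells R N A m (I i) t *: c i) <=
  shift_constant b * avgnorm p (fun t => \sum_(i < n) @haar_cells R N A (I i) t *: c i).
Proof.
have alth : alternating_family n (fun i => @haar_cells R N A (I i)).
  exact: alternating_haar.
have [nw|wr] : (forall i, (i < n)%N -> ~~ wraps m (I i)) \/
    (forall i, (i < n)%N -> wraps m (I i)).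
  have [n0|n0] := posnP n; first by left => i; rewrite n0.
  have [w0|w0] := boolP (wraps m (I 0)); [right|left] => i ni.
    by have [_ _ <-] := classI n0 ni.
  by have [_ _ <-] := classI n0 ni.
- have sw := swappable_shift (R := R) IN sortedI uniqI rangeI m0 rangeT classI nw.
  have habs i (t : 'I_(A.*2)) : (i < n)%N -> `|@haar_cells R N A (I i) t| =
      @ind R A (wholeI N (I i)) (6 * width N (I i)) t.
    by move=> _; exact: abs_haar_cells.
  have est := shift_estimate c p1 b0 bX alth habs sw.
  apply: (le_trans est).
  apply: ler_wpM2r; first exact: avgnorm_ge0.
  have b2 := exprn_ge0 2 b0; apply: ler_wpM2l => //.
  by move: (b ^+ 2) b2 b0 => x x0 y0; lra.
have sw1 := swappable_third_shift (R := R) IN sortedI uniqI rangeI m0 rangeT classI wr.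
have sw a ha := swappable_thirds (R := R) IN sortedI uniqI rangeI m0 classI wr (a := a) ha.
have swt a ha := swappable_thirds_tau (R := R) IN sortedI uniqI m0 rangeT classI wr (a := a) ha.
have o0 : (0 : int) = 0 \/ (0 : int) = 2 by left.
have o2 : (2 : int) = 0 \/ (2 : int) = 2 by right.
have := third_estimate c p1 b0 bX alth _ sw1 (sw 0 o0) (sw 2 o2) (swt 0 o0) (swt 2 o2).
under eq_avgnorm => t do under eq_bigr => i _ do
  rewrite -ind_thirds -(width_tau N m) -ind_thirds.
by apply => i t ni; split; exact: third_haar.
Qed.

End cell_estimate.

(** * Haar sums on the real line *)

Lemma integral_sum_indic {R : realType} d (T : measurableType d)
    (mu : {measure set T -> \bar R}) (I : Type) (s : seq I) (A : I -> set T)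
    (r : I -> R) : (forall i, measurable (A i)) -> (forall i, 0 <= r i) ->
  (\int[mu]_t (\sum_(i <- s) r i * \1_(A i) t)%:E =
   \sum_(i <- s) (r i)%:E * mu (A i))%E.
Proof.
move=> mA r0; under eq_integral do rewrite -sumEFin.
rewrite ge0_integral_sum//; first last.
- by move=> i t _; rewrite lee_fin mulr_ge0.
- by move=> i; apply/measurable_EFinP/measurable_funM => //; exact: measurable_indic.
apply: eq_bigr => i _; under eq_integral do rewrite EFinM.
rewrite ge0_integralZl_EFin ?integral_indic ?setIT//.
by apply/measurable_EFinP; exact: measurable_indic.
Qed.

Section real_cells.
Context {R : realType} {X : completeNormedModType R}.
Local Notation mu := (@lebesgue_measure R).
Variables (h : R) (A : nat).
Hypothesis h0 : 0 < h.

Definition cell (t : R) : int := Num.floor (t / h).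

Lemma block_cell a v t :
  block a v (cell t) = (h * a%:~R <= t < h * (a + v)%:~R).
Proof.
rewrite /block /cell floor_lt_int leNgt floor_lt_int -leNgt.
by rewrite ler_pdivlMr// ltr_pdivrMr// !(mulrC h).
Qed.

Definition cellset (z : int) : set R := `[h * z%:~R, h * (z + 1)%:~R[%classic.

Lemma cellsetE z t : cellset z t <-> cell t = z.
Proof.
rewrite /cellset /= in_itv /= -block_cell /block.
by split=> [|->]; lia.
Qed.

Lemma measurable_cellset z : measurable (cellset z). Proof. exact: measurable_itv. Qed.

Lemma mu_cellset z : mu (cellset z) = h%:E.
Proof.
rewrite /cellset lebesgue_measure_itv /= lte_fin ltr_pM2l// ltr_int.
rewrite ltrDl ltr01 -EFinB -mulrBr -intrB.
by rewrite addrAC subrr add0r mulr1.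
Qed.

(** The window sees all values of F. *)
Definition supported {V : zmodType} (F : int -> V) : Prop :=
  forall y, ~~ block (- A%:Z) (A.*2)%:Z y -> F y = 0.

(** The common form of the evaluation of step functions and of indicator sums: only
    the cell containing the point contributes. *)
Lemma sum_cells (V : zmodType) (F : int -> V) (G : int -> int -> V) y : supported F ->
  (G y y = F y) -> (forall z, z != y -> G z y = 0) ->
  \sum_(z : 'I_(A.*2)) G (cellpos z) y = F y.
Proof.
move=> sF Gy Gz; have [yA|yA] := boolP (block (- A%:Z) (A.*2)%:Z y); last first.
  rewrite sF// big1// => z _; apply: Gz; apply: contraNneq yA => <-.
  by have := ltn_ord z; rewrite /block /cellpos; lia.
have zA : (absz (y + A%:Z)%R < A.*2)%N by move: yA; rewrite /block; lia.
have pz : cellpos (Ordinal zA) = y by move: yA; rewrite /block /cellpos /=; lia.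
rewrite (bigD1 (Ordinal zA))//= pz Gy big1 ?addr0// => z zy.
apply: Gz; apply: contraNneq zy => e; apply/eqP/val_inj => /=.
by move: e yA; rewrite /block /cellpos; lia.
Qed.

Lemma indic_cellset z t : \1_(cellset z) t = (cell t == z)%:R :> R.
Proof.
rewrite indicE; congr (_%:R); congr nat_of_bool; apply/idP/eqP.
  by rewrite inE => /cellsetE.
by move=> /cellsetE; rewrite inE.
Qed.

Lemma integral_cells (G : int -> R) : (forall z, 0 <= G z) -> supported G ->
  (\int[mu]_t (G (cell t))%:E = (h * \sum_(z : 'I_(A.*2)) G (cellpos z))%R%:E)%E.
Proof.
move=> G0 sG.
under eq_integral => t _.
  rewrite -(sum_cells (G := fun z y => G z * (y == z)%:R) sG).
  - under eq_bigr do rewrite -indic_cellset. over.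
  - by rewrite eqxx mulr1.
  - by move=> z zy; rewrite eq_sym (negbTE zy) mulr0.
rewrite (integral_sum_indic mu _ (A := fun z : 'I_(A.*2) => cellset (cellpos z)))//;
  last by move=> z; exact: measurable_cellset.
rewrite mulr_sumr -sumEFin; apply: eq_bigr => z _.
by rewrite EFinM muleC; congr (_ * _)%E; exact: mu_cellset.
Qed.

Definition cell_steps (F : int -> X) : seq (set R * X) :=
  [seq (cellset (cellpos z), F (cellpos z)) | z : 'I_(A.*2)].

Lemma step_fun_cells F t : supported F -> step_fun (cell_steps F) t = F (cell t).
Proof.
move=> sF; rewrite /step_fun big_map big_enum /=.
rewrite (sum_cells (F := F) (G := fun z y => (\1_(cellset z) t : R) *: F z) (y := cell t))//.
  by rewrite indic_cellset eqxx scale1r.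
by move=> z zy; rewrite indic_cellset eq_sym (negbTE zy) scale0r.
Qed.

Lemma step_over_cells F : step_over mu measurable (cell_steps F).
Proof.
move=> e /mapP[z _ ->]; split; first exact: measurable_cellset.
by rewrite [X in (X < _)%E](mu_cellset (cellpos z)) ltry.
Qed.

Lemma step_int_cells F : step_int mu (cell_steps F) =
  h *: \sum_(z : 'I_(A.*2)) F (cellpos z).
Proof.
rewrite /step_int big_map big_enum /= scaler_sumr; apply: eq_bigr => z _.
by congr (_ *: _); rewrite [X in fine X](mu_cellset (cellpos z)).
Qed.

Lemma Lpnorm_cells p (F : int -> X) : 1 < p -> supported F ->
  Lpnorm mu p (fun t => F (cell t)) =
  ((h * (A.*2)%:R) `^ p^-1 * avgnorm p (fun z : 'I_(A.*2) => F (cellpos z)))%:E.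
Proof.
move=> p1 sF; have p0 : 0 < p by exact: lt_trans p1.
rewrite LpnormE (integral_cells (G := fun z => `|F z| `^ p)).
- rewrite poweR_EFin avgnorm.unlock card_ord; congr EFin.
  have [->|A0] := eqVneq A 0%N.
    by rewrite !(mulr0, mul0r) powR0 ?mul0r ?invr_eq0 ?gt_eqF// big_ord0 mulr0 powR0// invr_eq0 gt_eqF.
  have S0 : 0 <= \sum_(z : 'I_(A.*2)) `|F (cellpos z)| `^ p.
    by apply: sumr_ge0 => z _; exact: powR_ge0.
  rewrite -powRM ?mulr_ge0 ?invr_ge0 ?(ltW h0)//.
  by rewrite -mulrA mulVKf// pnatr_eq0 double_eq0.
- by move=> z; exact: powR_ge0.
- by move=> z /sF ->; rewrite normr0 powR0// gt_eqF.
Qed.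

End real_cells.

Section haar_on_cells.
Context {R : realType}.
Variable N : int.
Implicit Types I J : dyadic.

(** With this mesh, dyadic intervals of level at most N have halves and thirds made
    of whole cells. *)
Definition mesh : R := 2 ^ (- N) / 6.

Lemma mesh_gt0 : 0 < mesh.
Proof. by rewrite divr_gt0// exprz_gt0. Qed.

Local Notation cell := (cell mesh).

Lemma dlen_gt0 I : 0 < dlen R I. Proof. exact: exprz_gt0. Qed.

Lemma mu_ditv I : lebesgue_measure (ditv R I) = (dlen R I)%:E.
Proof.
rewrite /ditv lebesgue_measure_itv /= lte_fin ltr_pM2l ?dlen_gt0// ltr_int.
rewrite ltrDl ltr01 -EFinB -mulrBr -intrB.
by rewrite addrAC subrr add0r mulr1.
Qed.

Lemma dlenE I : I.1 <= N -> dlen R I = mesh * (6 * width N I)%:~R.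
Proof.
move=> IN; rewrite /dlen /mesh /width intrM rmorphXn /= exprnP.
rewrite mulrA divfK ?pnatr_eq0// -expfzDr ?pnatr_eq0//; congr (_ ^ _).
by rewrite gez0_abs; lia.
Qed.

Lemma indic_ditv I t : I.1 <= N ->
  \1_(ditv R I) t = (block (wholeI N I) (6 * width N I) (cell t))%:R :> R.
Proof.
move=> IN; rewrite (block_cell mesh_gt0) indicE mem_setE /ditv in_itv /=.
by rewrite dlenE// /wholeI -!(mulrA mesh) -!intrM mulrDr mulr1.
Qed.

Definition haarZ I (y : int) : R :=
  (block (halfI N 0 I) (3 * width N I) y)%:R - (block (halfI N 1 I) (3 * width N I) y)%:R.

Definition shiftZ m I (y : int) : R :=
  (block (wholeI N (tau m I)) (6 * width N I) y)%:R - (block (wholeI N I) (6 * width N I) y)%:R.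

Lemma haarE I t : I.1 <= N -> haar I t = haarZ I (cell t).
Proof.
move=> IN; have w0 : 0 < (width N I)%:~R :> R by rewrite ltr0z width_gt0.
have h0 := mesh_gt0.
rewrite /haar /haar01 /haarZ !(block_cell h0) !indicE !mem_setE !in_itv /=.
rewrite /dinf dlenE// /halfI.
have l0 : 0 < mesh * (6 * width N I)%:~R by rewrite mulr_gt0// intrM mulr_gt0.
rewrite !ler_pdivlMr// !ltr_pdivrMr// mul0r mul1r.
rewrite mulr0 addr0 mulr1 !intrD !intrM.
by congr ((_ && _)%:R - (_ && _)%:R); apply/idP/idP; nra.
Qed.

Lemma shiftE m I t : I.1 <= N ->
  \1_(ditv R (tau m I)) t - \1_(ditv R I) t = shiftZ m I (cell t).
Proof. by move=> IN; rewrite !indic_ditv. Qed.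

Lemma haar_cellsE A I (t : 'I_(A.*2)) : haar_cells N I t = haarZ I (cellpos t).
Proof. by []. Qed.

Lemma supported_block A (a v y : int) : in_range A a v ->
  ~~ block (- A%:Z) (A.*2)%:Z y -> block a v y = false.
Proof. by rewrite /in_range /block; lia. Qed.

Lemma supported_haarZ A I : in_range A (wholeI N I) (6 * width N I) ->
  supported A (haarZ I).
Proof.
move=> rI y yA; have w0 := width_gt0 N I.
rewrite /haarZ; have -> := @supported_block A (halfI N 0 I) (3 * width N I) y _ yA.
  have -> := @supported_block A (halfI N 1 I) (3 * width N I) y _ yA.
    by rewrite subrr.
  by move: rI; rewrite /in_range /wholeI /halfI; lia.
by move: rI; rewrite /in_range /wholeI /halfI; lia.
Qed.

Lemma supported_shiftZ A m I : in_range A (wholeI N I) (6 * width N I) ->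
  in_range A (wholeI N (tau m I)) (6 * width N I) -> supported A (shiftZ m I).
Proof.
by move=> rI rT y yA; rewrite /shiftZ (supported_block rT yA) (supported_block rI yA) subrr.
Qed.

End haar_on_cells.

Lemma dyadics_in_range (m : nat) (s : seq dyadic) : exists (N : int) (A : nat),
  forall I, I \in s -> [/\ I.1 <= N, in_range A (wholeI N I) (6 * width N I) &
    in_range A (wholeI N (tau m I)) (6 * width N I)].
Proof.
have [N NP] : exists N : int, forall I, I \in s -> I.1 <= N.
  elim: s => [|I s [N NP]]; first by exists 0.
  exists (Num.max I.1 N) => J; rewrite inE => /predU1P[->|/NP JN]; first by rewrite le_max lexx.
  by rewrite le_max JN orbT.
exists N.
have [A AP] : exists A : nat, forall I, I \in s ->
    in_range A (wholeI N I) (6 * width N I) /\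
    in_range A (wholeI N (tau m I)) (6 * width N I).
  elim: s {NP} => [|I s [A AP]]; first by exists 0%N.
  have w0 := width_gt0 N I.
  exists (A + absz (wholeI N I) + absz (wholeI N (tau m I)) + absz (6 * width N I)%R)%N => J.
  rewrite inE => /predU1P[->|/AP]; rewrite /in_range; lia.
by exists A => I sI; have [] := AP I sI; split=> //; exact: NP.
Qed.

(** Sorting by level puts long intervals first, the order in which the Haar functions
    are alternating. *)
Lemma dyadic_enum (S : {fset dyadic}) : exists I : nat -> dyadic,
  [/\ forall i, (i < #|` S|)%N -> I i \in S,
      forall i j, (i < #|` S|)%N -> (j < i)%N -> (I j).1 <= (I i).1,
      forall i j, (i < #|` S|)%N -> (j < i)%N -> I j != I i &
      forall (V : zmodType) (F : dyadic -> V),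
        \sum_(J <- S) F J = \sum_(i < #|` S|) F (I i)].
Proof.
pose le (I J : dyadic) := I.1 <= J.1.
pose s := sort le (enum_fset S).
have ps : perm_eq s (enum_fset S) by rewrite perm_sort.
have szs : size s = #|` S| by rewrite (perm_size ps).
exists (nth (0, 0) s); rewrite -szs; split.
- by move=> i ni; rewrite -(perm_mem ps) mem_nth.
- move=> i j ni ji; have le_tr : transitive le by move=> a b c; exact: le_trans.
  have le_tot : total le by move=> a b; exact: le_total.
  by apply: (sorted_ltn_nth le_tr _ (sort_sorted le_tot _)) => //; rewrite inE// (ltn_trans ji).
- move=> i j ni ji; rewrite nth_uniq ?(ltn_trans ji)//; first by rewrite ltn_eqF.
  by rewrite (perm_uniq ps) fset_uniq.
- by move=> V F; rewrite -(perm_big _ ps)/= (big_nth (0,0)) big_mkord.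
Qed.

Section haar_estimates.
Context {R : realType} {X : completeNormedModType R}.
Local Notation mu := (@lebesgue_measure R).
Variables (p b : R).
Hypotheses (p1 : 1 < p) (b0 : 0 <= b) (bX : unconditional_bound X p b).
Implicit Types (S : {fset dyadic}) (c : dyadic -> X).

Let sum_sup (A : nat) S (f : dyadic -> int -> R) c :
  (forall I, I \in S -> supported A (f I)) ->
  supported A (fun y => \sum_(I <- S) f I y *: c I).
Proof.
move=> sf y yA; rewrite big1_fset// => I IS _.
by rewrite sf// scale0r.
Qed.

Lemma shift_haar_sum_le m S c : (0 < m)%N ->
    (forall I J, I \in S -> J \in S -> same_class m I J) ->
  (Lpnorm mu p (U_haar_sum m S c) <=
   (shift_constant b)%:E * Lpnorm mu p (haar_sum S c))%E.
Proof.
move=> m0 clS; have [N [A NA]] := dyadics_in_range m (enum_fset S).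
have [I [IS sI uI sumI]] := dyadic_enum S.
have NAI i (ni : (i < #|` S|)%N) := NA _ (IS i ni).
have e1 : U_haar_sum m S c =1
    fun t => \sum_(I <- S) @shiftZ R N m I (cell (@mesh R N) t) *: c I.
  by move=> t; apply: eq_big_seq => J /NA[JN _ _]; rewrite (shiftE m _ JN).
have e2 : haar_sum S c =1
    fun t => \sum_(I <- S) @haarZ R N I (cell (@mesh R N) t) *: c I.
  by move=> t; apply: eq_big_seq => J /NA[JN _ _]; rewrite (haarE _ JN).
rewrite (eq_Lpnorm mu p e1) (eq_Lpnorm mu p e2).
rewrite (Lpnorm_cells (A := A) (@mesh_gt0 R N)
  (F := fun y => \sum_(I <- S) @shiftZ R N m I y *: c I))//; last first.
  by apply: sum_sup => J /NA[_ r1 r2]; exact: supported_shiftZ.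
rewrite (Lpnorm_cells (A := A) (@mesh_gt0 R N)
  (F := fun y => \sum_(I <- S) @haarZ R N I y *: c I))//; last first.
  by apply: sum_sup => J /NA[_ r1 r2]; exact: supported_haarZ.
rewrite -EFinM lee_fin mulrCA ler_wpM2l ?powR_ge0//.
have := @cell_estimate R X p b p1 b0 bX m N A #|` S| I (c \o I) m0.
have E1 : (fun t : 'I_(A.*2) => \sum_(I <- S) @shiftZ R N m I (cellpos t) *: c I) =1
    (fun t => \sum_(i < #|` S|) shift_cells N m (I i) t *: (c \o I) i).
  by move=> t; rewrite sumI.
have E2 : (fun t : 'I_(A.*2) => \sum_(I <- S) @haarZ R N I (cellpos t) *: c I) =1
    (fun t => \sum_(i < #|` S|) haar_cells N (I i) t *: (c \o I) i).
  by move=> t; rewrite sumI.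
rewrite (eq_avgnorm p E1) (eq_avgnorm p E2); apply => //.
- by move=> i /NAI[].
- by move=> i /NAI[].
- by move=> i /NAI[].
by move=> i j ni nj; apply: clS; exact: IS.
Qed.

(** The partial sum is half the sum of the whole and of the whole with the signs of
    the omitted terms reversed; this costs at most (1 + b) / 2, hence 1 + b. *)
Lemma haar_sum_sub_le S S' c : (S' `<=` S)%fset ->
  (Lpnorm mu p (haar_sum S' c) <= (1 + b)%:E * Lpnorm mu p (haar_sum S c))%E.
Proof.
move=> S'S; have [N [A NA]] := dyadics_in_range 0 (enum_fset S).
have [I [IS sI uI sumI]] := dyadic_enum S.
have NAI i (ni : (i < #|` S|)%N) := NA _ (IS i ni).
pose c' J := if J \in S' then c J else 0.
have e1 : haar_sum S' c =1
    fun t => \sum_(I <- S) @haarZ R N I (cell (@mesh R N) t) *: c' I.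
  move=> t; transitivity (haar_sum S' c' t).
    by apply: eq_big_seq => J JS'; rewrite /c' JS'.
  rewrite /haar_sum (big_fset_incl _ S'S) => [|J _ JS']; last first.
    by rewrite /c' (negbTE JS') scaler0.
  by apply: eq_big_seq => J /NA[JN _ _]; rewrite (haarE _ JN).
have e2 : haar_sum S c =1
    fun t => \sum_(I <- S) @haarZ R N I (cell (@mesh R N) t) *: c I.
  by move=> t; apply: eq_big_seq => J /NA[JN _ _]; rewrite (haarE _ JN).
rewrite (eq_Lpnorm mu p e1) (eq_Lpnorm mu p e2).
rewrite (Lpnorm_cells (A := A) (@mesh_gt0 R N)
  (F := fun y => \sum_(I <- S) @haarZ R N I y *: c' I))//; last first.
  by apply: sum_sup => J /NA[_ r1 r2]; exact: supported_haarZ.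
rewrite (Lpnorm_cells (A := A) (@mesh_gt0 R N)
  (F := fun y => \sum_(I <- S) @haarZ R N I y *: c I))//; last first.
  by apply: sum_sup => J /NA[_ r1 r2]; exact: supported_haarZ.
rewrite -EFinM lee_fin mulrCA ler_wpM2l ?powR_ge0//.
have alth : alternating_family #|` S| (fun i => @haar_cells R N A (I i)).
  by apply: alternating_haar => // i /NAI[].
have := bX (c \o I) (fun i => I i \notin S') alth.
have E2 : (fun t : 'I_(A.*2) => \sum_(I <- S) @haarZ R N I (cellpos t) *: c I) =1
    (fun t => \sum_(i < #|` S|) haar_cells N (I i) t *: (c \o I) i).
  by move=> t; rewrite sumI.
have E1 : (fun t : 'I_(A.*2) => \sum_(I <- S) @haarZ R N I (cellpos t) *: c' I) =1
    (fun t => 2^-1 *: (\sum_(i < #|` S|) haar_cells N (I i) t *: (c \o I) i +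
     \sum_(i < #|` S|) ((-1) ^+ (I i \notin S') * haar_cells N (I i) t) *: (c \o I) i)).
  move=> t; rewrite sumI -big_split scaler_sumr; apply: eq_bigr => i _ /=.
  rewrite -scalerDl scalerA /c' /=; case: (I i \in S') => /=.
    by rewrite expr0 mul1r mulrDr ![2^-1 * _]mulrC -splitr.
  by rewrite expr1 mulN1r subrr mulr0 scale0r scaler0.
rewrite (eq_avgnorm p E1) (eq_avgnorm p E2) => H.
pose Y := avgnorm p (fun t : 'I_(A.*2) =>
  \sum_(i < #|` S|) (haar_cells N (I i) t : R) *: (c \o I) i).
have Y0 : 0 <= Y by exact: avgnorm_ge0.
rewrite avgnormZ// ger0_norm// ler_pdivrMl//.
apply: le_trans (avgnormD p1 _ _) _; apply: le_trans (lerD (lexx _) H) _.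
by rewrite -/Y; have := mulr_ge0 b0 Y0; lra.
Qed.

(** Orthogonality of the Haar functions, packaged for the Bochner integral, whose
    definition asks for step functions. *)
Lemma haar_steps S c (J : dyadic) : exists s : seq (set R * X),
  [/\ step_over mu measurable s,
      forall t, step_fun s t = haar J t *: haar_sum S c t &
      step_int mu s = dlen R J *: (if J \in S then c J else 0)].
Proof.
have [N [A NA]] := dyadics_in_range 0 (J :: enum_fset S).
have NAJ := NA J (mem_head _ _).
have {}NA I (IS : I \in S) := NA I (mem_behead (s := J :: enum_fset S) IS).
have h0 := @mesh_gt0 R N.
pose F y := @haarZ R N J y *: \sum_(I <- S) @haarZ R N I y *: c I.
have [JN rJ _] := NAJ.
have sF : supported A F by move=> y yA; rewrite /F (supported_haarZ rJ yA) scale0r.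
exists (cell_steps (@mesh R N) A F); split.
- exact: step_over_cells.
- move=> t; rewrite step_fun_cells// /F (haarE _ JN); congr (_ *: _).
  by apply: eq_big_seq => I /NA[IN _ _]; rewrite (haarE _ IN).
(* The reversal of the Haar function of the shorter interval leaves that of the
   longer one unchanged, hence changes the sign of the sum. *)
have orth I K : I != K -> I.1 <= K.1 -> K.1 <= N ->
    in_range A (wholeI N I) (6 * width N I) -> in_range A (wholeI N K) (6 * width N K) ->
    \sum_(z : 'I_(A.*2)) @haarZ R N I (cellpos z) * @haarZ R N K (cellpos z) = 0.
  move=> IK IKl KN rI rK; pose L i := if i is 0%N then I else K.
  have altL : alternating_family 2 (fun i => @haar_cells R N A (L i)).
    apply: alternating_haar.
    - by move=> [|[|//]] _ //=; exact: le_trans KN.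
    - by move=> [|[|//]] [|//].
    - by move=> [|[|//]] [|//].
    - by move=> [|[|//]].
  have [s [sinj s1 s0]] := altL 1%N isT.
  set T := \sum_z _; suff : T = - T by move/eqP; rewrite -addr_eq0 -mulr2n mulrn_eq0 => /eqP.
  rewrite {1}/T (reindex_inj sinj) /T -sumrN; apply: eq_bigr => z _ /=.
  have /= e1 := s1 z; have /= e0 := s0 0%N z isT.
  by rewrite -!haar_cellsE e0 e1 mulrN.
have orthJ I : I \in S -> I != J ->
    \sum_(z : 'I_(A.*2)) @haarZ R N J (cellpos z) * @haarZ R N I (cellpos z) = 0.
  move=> /NA[IN rI _] IJ; have [IJl|/ltW JIl] := lerP I.1 J.1.
    by under eq_bigr do rewrite mulrC; exact: orth.
  by apply: orth => //; rewrite eq_sym.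
have normJ : @mesh R N * \sum_(z : 'I_(A.*2)) @haarZ R N J (cellpos z) * @haarZ R N J (cellpos z) = dlen R J.
  apply: EFin_inj.
  have sw : supported A (fun y => (block (wholeI N J) (6 * width N J) y)%:R : R).
    by move=> y yA; rewrite (supported_block rJ yA).
  transitivity (mu (ditv R J)); last exact: mu_ditv.
  transitivity (\int[mu]_t (\1_(ditv R J) t)%:E)%E; last first.
    by rewrite integral_indic// ?setIT//; exact: measurable_itv.
  under [RHS]eq_integral do rewrite (indic_ditv _ JN).
  rewrite (integral_cells h0 _ sw)//; congr (_ * _)%:E; apply: eq_bigr => z _.
  have := @abs_haar_cells R N A J z; rewrite haar_cellsE /ind.
  by rewrite -expr2 -real_normK ?num_real// => ->; case: block; rewrite ?expr1n// expr0n.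
rewrite step_int_cells// /F; under eq_bigr do rewrite scaler_sumr.
rewrite exchange_big /=.
have [JS|JS] := boolP (J \in S).
  rewrite (big_fsetD1 J JS)/= [X in _ + X]big1_seq ?addr0.
    by under eq_bigr do rewrite scalerA; rewrite -scaler_suml scalerA normJ.
  move=> I /= /fsetD1P[IJ IS]; under eq_bigr do rewrite scalerA.
  by rewrite -scaler_suml orthJ// scale0r.
rewrite big1_seq ?scaler0// => I /= IS; under eq_bigr do rewrite scalerA.
by rewrite -scaler_suml orthJ ?scale0r//; apply: contraNneq JS => <-.
Qed.

End haar_estimates.

(** * Strongly measurable functions and their norm *)

Section ae_monotone.
Context {R : realType} d (T : measurableType d) (mu : {measure set T -> \bar R}).
Import HBNNSimple.
Local Open Scope ereal_scope.

(** No measurability is assumed, as a strongly measurable function is only almost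
    everywhere equal to a measurable one. A simple function below f is cut off on
    the exceptional null set to lie below g. *)
Lemma ae_le_integral (f g : T -> \bar R) :
    (forall t, 0 <= f t) -> (forall t, 0 <= g t) ->
    {ae mu, forall t, f t <= g t} -> \int[mu]_t f t <= \int[mu]_t g t.
Proof.
move=> f0 g0 [N [mN N0 fgN]].
rewrite !ge0_integralTE//; apply: ub_ereal_sup => _ /= [G Gf <-].
have mNC : measurable (~` N) by exact: measurableC.
pose H := mul_nnsfun G (indic_nnsfun R mNC).
have HE t : H t = (G t * \1_(~` N) t)%R by [].
have -> : sintegral mu G = sintegral mu H.
  have sE (K : {nnsfun T >-> R}) : sintegral mu K = \int[mu]_t (K t)%:E.
    by rewrite integral_nnsfun// patch_setT.
  rewrite !sE; apply: ae_eq_integral => //; [exact/measurable_EFinP..|].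
  exists N; split=> // t /= /not_implyP[_ h]; apply: contrapT => Nt; apply: h.
  by rewrite mindicE mem_set// mulr1.
apply: ereal_sup_ubound; exists H => // t.
rewrite [X in (X%:E <= _)%E]HE indicE; have [tN|tN] := boolP (t \in ~` N); last by rewrite mulr0.
rewrite mulr1 (le_trans (Gf t))//; apply: contrapT => fgt.
by move: tN; rewrite inE; apply; exact: fgN.
Qed.

End ae_monotone.

Section Lp_monotone.
Context {R : realType} {X Y : completeNormedModType R}.
Context d (T : measurableType d) (mu : {measure set T -> \bar R}).

Lemma ae_le_Lpnorm p (f : T -> X) (g : T -> Y) : 0 < p ->
  {ae mu, forall t, `|f t| <= `|g t|} -> (Lpnorm mu p f <= Lpnorm mu p g)%E.
Proof.
move=> p0 fg; have pow_ge0 (Z : completeNormedModType R) (h : T -> Z) t :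
    (0 <= (`|h t| `^ p)%:E)%E by rewrite lee_fin powR_ge0.
rewrite !LpnormE; apply: gt0_ler_poweR.
- by rewrite invr_ge0 ltW.
- by rewrite in_itv /= leey andbT; exact: integral_ge0.
- by rewrite in_itv /= leey andbT; exact: integral_ge0.
apply: ae_le_integral => //; apply: filterS fg => t fgt.
by rewrite lee_fin ge0_ler_powR ?nnegrE// ltW.
Qed.

End Lp_monotone.

Section strongly_measurable_theory.
Context {R : realType} {X : completeNormedModType R}.
Context d (T : measurableType d) (mu : {measure set T -> \bar R}).
Implicit Types (f g : T -> X) (s : seq (set T * X)).
Local Notation smeas := (strongly_measurable mu measurable).
Local Notation step := (step_over mu measurable).

Lemma ae_eq_Lpnorm p f g : 0 < p -> {ae mu, forall t, f t = g t} ->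
  Lpnorm mu p f = Lpnorm mu p g.
Proof.
move=> p0 fg; apply/eqP; rewrite eq_le !ae_le_Lpnorm//.
  by apply: filterS fg => t ->.
by apply: filterS fg => t ->.
Qed.

Lemma step_fun_cat s s' t : step_fun (s ++ s') t = step_fun s t + step_fun s' t.
Proof. by rewrite /step_fun big_cat. Qed.

Lemma step_over_cat s s' : step s -> step s' -> step (s ++ s').
Proof. by move=> h h' e; rewrite mem_cat => /orP[/h|/h']. Qed.

Definition scale_step (a : R) s : seq (set T * X) := [seq (e.1, a *: e.2) | e <- s].

Lemma step_fun_scale a s t : step_fun (scale_step a s) t = a *: step_fun s t.
Proof.
rewrite /step_fun big_map scaler_sumr; apply: eq_bigr => e _ /=.
by rewrite !scalerA mulrC.
Qed.

Lemma step_over_scale a s : step s -> step (scale_step a s).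
Proof. by move=> h _ /mapP[e /h[m1 m2] ->]. Qed.

Lemma step_int_cat s s' : step_int mu (s ++ s') = step_int mu s + step_int mu s'.
Proof. by rewrite /step_int big_cat. Qed.

Lemma step_int_scale a s : step_int mu (scale_step a s) = a *: step_int mu s.
Proof.
rewrite /step_int big_map scaler_sumr; apply: eq_bigr => e _ /=.
by rewrite !scalerA mulrC.
Qed.

Definition restrict_step (B : set T) s : seq (set T * X) :=
  [seq (e.1 `&` B, e.2) | e <- s].

Lemma step_fun_restrict B s t :
  step_fun (restrict_step B s) t = (\1_B t : R) *: step_fun s t.
Proof.
rewrite /step_fun big_map scaler_sumr; apply: eq_bigr => e _ /=.
by rewrite scalerA indicI /= mulrC.
Qed.

Lemma step_over_restrict B s : measurable B -> step s -> step (restrict_step B s).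
Proof.
move=> mB h _ /mapP[e /h[m1 m2] ->] /=; split; first exact: measurableI.
by apply: le_lt_trans m2; apply: le_measure; rewrite ?inE//; exact: measurableI.
Qed.

Lemma measurable_step (phi : X -> R) s : step s ->
  measurable_fun [set: T] (fun t => phi (step_fun s t)).
Proof.
move=> ss; suff : forall y, measurable_fun [set: T] (fun t => phi (y + step_fun s t)).
  move=> /(_ 0); congr measurable_fun.
  by apply/funext => t; rewrite add0r.
elim: s ss => [|[A x] s IHs] ss y.
  rewrite (_ : (fun _ => _) = cst (phi y)); first exact: measurable_cst.
  by apply/funext => t; rewrite /step_fun big_nil addr0.
have {}IHs : forall y, measurable_fun [set: T] (fun t => phi (y + step_fun s t)).
  by apply: IHs => e es; apply: ss; rewrite inE es orbT.
have [mA _] := ss (A, x) (mem_head _ _).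
rewrite (_ : (fun _ => _) = (fun t => if t \in A then phi ((y + x) + step_fun s t)
  else phi (y + step_fun s t))); last first.
  apply/funext => t; rewrite {1}/step_fun big_cons /= indicE.
  by case: (t \in A); rewrite ?scale1r ?scale0r ?add0r// addrA.
apply: measurable_fun_ifT => //.
apply: (measurable_fun_bool true).
rewrite setTI (_ : _ @^-1` _ = A)//.
by apply/seteqP; split=> t /=; [move/set_mem|move/mem_set].
Qed.

(** Restricting the approximating step functions to the complement of a null set
    makes them converge everywhere, and the limit then has a measurable norm. *)
Lemma smeas_regular f : smeas f -> exists (s : nat -> seq (set T * X)) f',
  [/\ forall n, step (s n), forall t, step_fun (s n) t @[n --> \oo] --> f' t &
      {ae mu, forall t, f t = f' t}].
Proof.
move=> [s [ss [N [mN N0 sN]]]].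
have mNC : measurable (~` N) by exact: measurableC.
exists (fun n => restrict_step (~` N) (s n)), (fun t => (\1_(~` N) t : R) *: f t); split.
- by move=> n; exact: step_over_restrict.
- move=> t; under eq_fun do rewrite step_fun_restrict.
  rewrite indicE; have [tN|tN] := boolP (t \in ~` N).
    rewrite scale1r; under eq_fun do rewrite scale1r.
    by apply: contrapT => h; move: tN; rewrite inE; apply; exact: sN.
  by rewrite scale0r; under eq_fun do rewrite scale0r; exact: cvg_cst.
exists N; split=> // t /= ft; apply: contrapT => Nt; apply: ft.
by rewrite indicE mem_set// scale1r.
Qed.

Lemma measurable_norm_limit (s : nat -> seq (set T * X)) f : (forall n, step (s n)) ->
  (forall t, step_fun (s n) t @[n --> \oo] --> f t) ->
  measurable_fun [set: T] (fun t => `|f t|).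
Proof.
move=> ss sf; apply: (measurable_fun_cvg (h := fun n t => `|step_fun (s n) t|)).
  by move=> n; exact: measurable_step.
by move=> t _; apply: cvg_norm; exact: sf.
Qed.

Lemma smeas_norm f : smeas f -> exists f', [/\ {ae mu, forall t, f t = f' t} &
  measurable_fun [set: T] (fun t => `|f' t|)].
Proof.
by move=> /smeas_regular[s [f' [ss sf ff']]]; exists f'; split=> //; exact: measurable_norm_limit sf.
Qed.

Lemma smeas_step s : step s -> smeas (step_fun s).
Proof. by move=> ss; exists (fun=> s); split=> //; apply: aeW => t; exact: cvg_cst. Qed.

Lemma smeasD f g : smeas f -> smeas g -> smeas (fun t => f t + g t).
Proof.
move=> [s [ss sf]] [s' [ss' sf']]; exists (fun n => s n ++ s' n); split.
  by move=> n; exact: step_over_cat.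
apply: filterS2 sf sf' => t ft gt; under eq_fun do rewrite step_fun_cat.
exact: cvgD.
Qed.

Lemma smeasZ a f : smeas f -> smeas (fun t => a *: f t).
Proof.
move=> [s [ss sf]]; exists (fun n => scale_step a (s n)); split.
  by move=> n; exact: step_over_scale.
apply: filterS sf => t ft; under eq_fun do rewrite step_fun_scale.
exact: cvgZr.
Qed.

Lemma smeasB f g : smeas f -> smeas g -> smeas (fun t => f t - g t).
Proof.
move=> sf sg; under eq_fun do rewrite -scaleN1r.
by apply: smeasD => //; exact: smeasZ.
Qed.

Lemma smeas_indic (B : set T) f : measurable B -> smeas f ->
  smeas (fun t => (\1_B t : R) *: f t).
Proof.
move=> mB [s [ss sf]]; exists (fun n => restrict_step B (s n)); split.
  by move=> n; exact: step_over_restrict.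
apply: filterS sf => t ft; under eq_fun do rewrite step_fun_restrict.
exact: cvgZr.
Qed.

Lemma LpnormD p f g : 1 <= p -> smeas f -> smeas g ->
  (Lpnorm mu p (fun t => (f t + g t)%R) <= Lpnorm mu p f + Lpnorm mu p g)%E.
Proof.
move=> p1 /smeas_norm[f' [ff' mf]] /smeas_norm[g' [gg' mg]].
have p0 : 0 < p by exact: lt_le_trans p1.
rewrite (ae_eq_Lpnorm p0 ff') (ae_eq_Lpnorm p0 gg').
apply: le_trans (minkowski_EFin mu mf mg p1).
pose h : T -> R^o := fun t => `|f' t| + `|g' t|.
have -> : Lnorm mu p%:E (EFin \o ((fun t => `|f' t|) \+ (fun t => `|g' t|))%R) = Lpnorm mu p h.
  by apply: eq_Lnorm => t /=; rewrite ger0_norm ?addr_ge0.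
apply: ae_le_Lpnorm => //; apply: filterS2 ff' gg' => t -> ->.
by rewrite /h (le_trans (ler_normD _ _))// ler_norm.
Qed.

Lemma LpnormN p f : Lpnorm mu p (fun t => - f t) = Lpnorm mu p f.
Proof. by apply: eq_Lnorm => t; rewrite normrN. Qed.

Lemma LpnormB p f g : 1 <= p -> smeas f -> smeas g ->
  (Lpnorm mu p (fun t => (f t - g t)%R) <= Lpnorm mu p f + Lpnorm mu p g)%E.
Proof.
move=> p1 sf sg; rewrite -(LpnormN p g); apply: LpnormD => //.
by under eq_fun do rewrite -scaleN1r; exact: smeasZ.
Qed.

Lemma Lpnorm_distC p f g :
  Lpnorm mu p (fun t => f t - g t) = Lpnorm mu p (fun t => g t - f t).
Proof. by apply: eq_Lnorm => t; rewrite distrC. Qed.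

Lemma Lpnorm_triangle p g f h : 1 <= p -> smeas f -> smeas g -> smeas h ->
  (Lpnorm mu p (fun t => (f t - h t)%R) <=
   Lpnorm mu p (fun t => (f t - g t)%R) + Lpnorm mu p (fun t => (g t - h t)%R))%E.
Proof.
move=> p1 sf sg sh.
apply: le_trans (LpnormD p1 (smeasB sf sg) (smeasB sg sh)).
by rewrite le_eqVlt; apply/orP; left; apply/eqP/eq_Lpnorm => t; rewrite addrA subrK.
Qed.

End strongly_measurable_theory.

(** * Limits and completeness in L^p *)

Lemma cvg_powR {R : realType} (p : R) (u : nat -> R) x : 0 < p ->
  (forall n, 0 <= u n) -> u n @[n --> \oo] --> x ->
  u n `^ p @[n --> \oo] --> x `^ p.
Proof.
move=> p0 u0 ux; have : 0 <= x.
  by apply: (cvgr_to_ge ux); apply: nearW.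
rewrite le_eqVlt => /predU1P[x0|x0].
  rewrite -x0 powR0 ?gt_eqF//; apply/cvgr0Pnorm_lt => e e0.
  have d0 : 0 < e `^ p^-1 by exact: powR_gt0.
  rewrite -x0 in ux; move/cvgr0Pnorm_lt : ux => /(_ _ d0).
  apply: filterS => n; rewrite !ger0_norm ?powR_ge0// => un.
  have := @gt0_ltr_powR _ p p0 (u n) (e `^ p^-1).
  rewrite !nnegrE => /(_ (u0 n) (ltW d0) un) /lt_le_trans; apply.
  by rewrite -powRrM mulVf ?gt_eqF// powRr1 ?(ltW e0).
apply: (@cvg_comp _ _ _ u (fun y : R => y `^ p) _ _ _ ux).
have dx : derivable (fun y : R => y `^ p) x 1.
  by apply: derivable_powR; rewrite in_itv /= x0.
by move/derivable1_diffP/differentiable_continuous : dx.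
Qed.

Lemma ge0_le_poweR {R : realType} (r : R) (x y : \bar R) : 0 <= r ->
  (0 <= x)%E -> (x <= y)%E -> (x `^ r <= y `^ r)%E.
Proof.
move=> r0 x0 xy; apply: gt0_ler_poweR => //; rewrite in_itv /= leey andbT//.
exact: le_trans xy.
Qed.

Section Lp_limits.
Context {R : realType} {X : completeNormedModType R}.
Context d (T : measurableType d) (mu : {measure set T -> \bar R}).
Variable p : R.
Hypothesis p1 : 1 <= p.
Let p0 : 0 < p. Proof. exact: lt_le_trans p1. Qed.
Implicit Types (f g : T -> X) (s : nat -> seq (set T * X)).
Local Notation smeas := (strongly_measurable mu measurable).
Local Notation step := (step_over mu measurable).
Local Notation N := (Lpnorm mu p).

Lemma Lpnorm_fatou f s (M : R) : (forall n, step (s n)) ->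
  {ae mu, forall t, step_fun (s n) t @[n --> \oo] --> f t} -> 0 <= M ->
  (forall n, N (step_fun (s n)) <= M%:E)%E -> (N f <= M%:E)%E.
Proof.
move=> ss sf M0 sM.
pose h n t : \bar R := (`|step_fun (s n) t| `^ p)%:E.
have h0 n t : (0 <= h n t)%E by rewrite lee_fin powR_ge0.
have mh n : measurable_fun [set: T] (h n).
  apply/measurable_EFinP.
  exact: (measurable_step (fun x => `|x| `^ p) (ss n)).
have hM n : (\int[mu]_t h n t <= (M `^ p)%:E)%E.
  have := ge0_le_poweR (ltW p0) (Lpnorm_ge0 mu p _) (sM n).
  rewrite LpnormE -poweRrM mulVf ?gt_eqF// poweRe1; last by apply: integral_ge0.
  by rewrite poweR_EFin.
have -> : M%:E = ((M `^ p)%:E `^ p^-1)%E.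
  by rewrite poweR_EFin -powRrM mulfV ?gt_eqF// powRr1.
rewrite LpnormE; apply: ge0_le_poweR; first by rewrite invr_ge0 ltW.
  by apply: integral_ge0 => t _; rewrite lee_fin powR_ge0.
apply: (@le_trans _ _ (\int[mu]_t limn_einf (h ^~ t))%E).
  apply: ae_le_integral.
  - by move=> t; rewrite lee_fin powR_ge0.
  - move=> t; rewrite limn_einf_lim; apply: lime_ge; first exact: is_cvg_einfs.
    by apply: nearW => n; apply: le_ereal_inf_tmp => _ [k _ <-].
  apply: filterS sf => t sft.
  have : h n t @[n --> \oo] --> (`|f t| `^ p)%:E.
    apply: cvg_EFin; first exact: nearW.
    by apply: cvg_powR => //; exact: cvg_norm.
  by move=> /cvg_limn_einf_sup[-> _].
apply: le_trans (fatou mu measurableT mh (fun n t _ => h0 n t)) _.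
rewrite limn_einf_lim; apply: lime_le; first exact: is_cvg_einfs.
apply: nearW => n; apply: le_trans (hM n).
by apply: ereal_inf_lbound; exists n => //=.
Qed.

(** The explicit remainder, rather than a bare bound, makes the induction on k work. *)
Lemma Lpnorm_telescope s : (forall n, step (s n)) ->
    (forall n, N (fun t => step_fun (s n.+1) t - step_fun (s n) t)%R <= (2^-1 ^+ n)%:E)%E ->
  forall n k, (N (fun t => step_fun (s (n + k)%N) t - step_fun (s n) t)%R <=
    (2 * 2^-1 ^+ n - 2 * 2^-1 ^+ (n + k))%:E)%E.
Proof.
move=> ss sN n; elim=> [|k IHk].
  rewrite addn0 subrr; under eq_fun do rewrite subrr.
  by rewrite /Lpnorm; under eq_fun do rewrite normr0; rewrite Lnorm0// eqe gt_eqF.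
have sm j := smeas_step (ss j).
rewrite addnS; apply: le_trans (Lpnorm_triangle p1 (sm _) (sm (n + k)%N) (sm _)) _.
apply: le_trans (leeD (sN _) IHk) _; rewrite -EFinD lee_fin exprS.
by rewrite mulrA mulfV// mul1r; lra.
Qed.

(** As in the Riesz-Fischer theorem: the sum of the norms of the increments is in L^p
    by monotone convergence, hence almost everywhere finite, and the increments
    converge absolutely in X. Fatou's lemma gives the rate. *)
Lemma Lp_complete s : (forall n, step (s n)) ->
    (forall n, N (fun t => step_fun (s n.+1) t - step_fun (s n) t)%R <= (2^-1 ^+ n)%:E)%E ->
  exists2 w, smeas w &
    forall n, (N (fun t => w t - step_fun (s n) t)%R <= (2 * 2^-1 ^+ n)%:E)%E.
Proof.
move=> ss sN.
pose u t k := step_fun (s k.+1) t - step_fun (s k) t.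
(* The series of norms stays below 2 = 1 + 1/2 + 1/4 + ... in L^p. *)
pose G n t := \sum_(k < n) `|u t k|.
have mu_ k : measurable_fun [set: T] (fun t => `|u t k|).
  have -> : (fun t => `|u t k|) =
      (fun t => `|step_fun (s k.+1 ++ scale_step (-1) (s k)) t|).
    by apply/funext => t; rewrite step_fun_cat step_fun_scale scaleN1r.
  apply: (measurable_step (mu := mu) (fun x => `|x|)).
  by apply: step_over_cat => //; exact: step_over_scale.
have mG n : measurable_fun [set: T] (G n) by apply: measurable_sum.
have G0 n t : 0 <= G n t by apply: sumr_ge0.
have GN n : (Lnorm mu p%:E (EFin \o G n) <= (2 - 2 * 2^-1 ^+ n)%:E)%E.
  elim: n => [|n IHn].
    rewrite (_ : EFin \o G 0%N = cst 0%E); last first.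
      by apply/funext => t; rewrite /G /= big_ord0.
    by rewrite Lnorm0 ?eqe ?gt_eqF// expr0 mulr1 subrr.
  rewrite (_ : G n.+1 = (G n \+ (fun t => `|u t n|))%R); last first.
    by apply/funext => t; rewrite /G big_ord_recr.
  apply: le_trans (minkowski_EFin mu (mG n) (mu_ n) p1) _.
  have := sN n; rewrite /Lpnorm => sNn; apply: le_trans (leeD IHn sNn) _.
  by rewrite -EFinD lee_fin exprS mulrA mulfV// mul1r; lra.
pose h n t : \bar R := (G n t `^ p)%:E.
have h0 n t : (0 <= h n t)%E by rewrite lee_fin powR_ge0.
have mh n : measurable_fun [set: T] (h n).
  apply/measurable_EFinP.
  exact: (measurableT_comp (measurable_powR p) (mG n)).
have ndh t : nondecreasing_seq (h ^~ t).
  apply/nondecreasing_seqP => n; rewrite lee_fin ge0_ler_powR ?nnegrE ?(ltW p0)//.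
  by rewrite /G big_ord_recr/= lerDl.
have hM n : (\int[mu]_t h n t <= (2 `^ p)%:E)%E.
  have : (Lnorm mu p%:E (EFin \o G n) <= 2%:E)%E.
    by apply: le_trans (GN n) _; rewrite lee_fin gerBl mulr_ge0// exprn_ge0.
  move=> /(ge0_le_poweR (ltW p0) (Lnorm_ge0 _ _ _)).
  rewrite (poweR_Lnorm mu _ (lt0r_neq0 p0)); apply: le_trans.
  rewrite le_eqVlt; apply/orP; left; apply/eqP/eq_integral => t _ /=.
  by rewrite ger0_norm.
have mL : measurable_fun [set: T] (fun t => limn (h ^~ t)).
  apply: (emeasurable_fun_cvg h) => // t _.
  by apply: ereal_nondecreasing_is_cvgn.
have L0 t : (0 <= limn (h ^~ t))%E.
  by apply: lime_ge; [exact: ereal_nondecreasing_is_cvgn|exact: nearW].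
have iL : mu.-integrable [set: T] (fun t => limn (h ^~ t)).
  apply/integrableP; split=> //.
  under eq_integral do rewrite gee0_abs//.
  rewrite monotone_convergence//.
  apply: (@le_lt_trans _ _ (2 `^ p)%:E); last exact: ltry.
  apply: lime_le; last by apply: nearW.
  apply: ereal_nondecreasing_is_cvgn => a c ac.
  by apply: ge0_le_integral => // t _; exact: ndh.
have cvg_s : {ae mu, forall t, cvgn (fun n => step_fun (s n) t)}.
  apply: filterS (integrable_ae measurableT iL) => t /(_ Logic.I) Lfin.
  have hL n : (h n t <= limn (h ^~ t))%E.
    rewrite (cvg_lim _ (ereal_nondecreasing_cvgn (ndh t)))//.
    by apply: ereal_sup_ubound; exists n.
  have GL n : G n t <= fine (limn (h ^~ t)) `^ p^-1.
    rewrite -[leLHS](powRr1 (G0 n t)) -(mulfV (lt0r_neq0 p0)) powRrM.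
    apply: ge0_ler_powR; rewrite ?nnegrE ?powR_ge0 ?fine_ge0 ?invr_ge0 ?(ltW p0)//.
    by rewrite -lee_fin fineK//; exact: hL.
  have cu : cvgn [normed series (u t)].
    apply: nondecreasing_is_cvgn.
      apply/nondecreasing_seqP => n.
      by rewrite /series /= [leRHS]big_nat_recr//= lerDl.
    exists (fine (limn (h ^~ t)) `^ p^-1) => _ [n _ <-].
    by rewrite /= seriesEord; exact: GL.
  have /normed_cvg/cvg_ex[l ul] := cu.
  apply/cvg_ex; exists (l + step_fun (s 0%N) t).
  rewrite (_ : (fun n => _) = (fun n => series (u t) n + step_fun (s 0%N) t)); last first.
    apply/funext => n; rewrite /series /= /u (telescope_sumr (fun k => step_fun (s k) t))// subrK//.
  exact: cvgD ul (cvg_cst _).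
pose w t := lim (step_fun (s n) t @[n --> \oo]).
exists w.
  by exists s; split=> //; apply: filterS cvg_s => t.
move=> n; pose s' k := s (n + k)%N ++ scale_step (-1) (s n).
have s'E k t : step_fun (s' k) t = step_fun (s (n + k)%N) t - step_fun (s n) t.
  by rewrite step_fun_cat step_fun_scale scaleN1r.
apply: (@Lpnorm_fatou _ s').
- by move=> k; apply: step_over_cat => //; exact: step_over_scale.
- apply: filterS cvg_s => t ct; under eq_fun do rewrite s'E.
  have cs : step_fun (s (n + k)%N) t @[k --> \oo] --> w t.
    under eq_fun do rewrite addnC.
    by have := ct; rewrite -(cvg_shiftn n (fun k => step_fun (s k) t)).
  exact: cvgB cs (cvg_cst _).
- by rewrite mulr_ge0// exprn_ge0.
move=> k; rewrite (eq_Lpnorm mu p (s'E k)).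
apply: le_trans (Lpnorm_telescope ss sN n k) _.
by rewrite lee_fin gerBl mulr_ge0// exprn_ge0.
Qed.

End Lp_limits.

(** * Step functions and the Bochner integral *)

(** The epsilon form of convergence to 0, for nonnegative extended reals. *)
Lemma ecvg0P {R : realType} (a : nat -> \bar R) : (forall n, (0 <= a n)%E) ->
  a @ \oo --> 0%E <->
  forall e : R, 0 < e -> exists n, forall k, (n <= k)%N -> (a k <= e%:E)%E.
Proof.
move=> a0; split=> [/fine_cvgP[fin_a /cvgr_lt a_lt] e e0|a_le].
  have [n _ hn] := filterI fin_a (a_lt _ e0); exists n => k nk.
  by have [/fineK <- /ltW] := hn k nk.
have fin_a k e : (a k <= e%:E)%E -> a k \is a fin_num.
  by move=> ake; rewrite ge0_fin_numE// (le_lt_trans ake) ?ltry.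
apply/fine_cvgP; split.
  by have [n hn] := a_le 1 ltr01; exists n => // k /= /hn /fin_a.
apply/cvgr0Pnorm_le => e e0; have [n hn] := a_le e e0.
exists n => // k /= /hn ak; rewrite ger0_norm ?fine_ge0//.
by rewrite -lee_fin fineK//; exact: fin_a ak.
Qed.

Section step_density.
Context {R : realType} {X : completeNormedModType R}.
Context d (T : measurableType d) (mu : {measure set T -> \bar R}).
Variable p : R.
Hypothesis p1 : 1 <= p.
Let p0 : 0 < p. Proof. exact: lt_le_trans p1. Qed.
Implicit Types (f g : T -> X) (s : nat -> seq (set T * X)).
Local Notation smeas := (strongly_measurable mu measurable).
Local Notation step := (step_over mu measurable).
Local Notation N := (Lpnorm mu p).

(** The approximating step functions are cut off where they exceed 2 |f|. They still
    converge pointwise and are dominated by a multiple of |f|. *)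
Lemma step_dense f (e : R) : in_Lp mu p f -> 0 < e ->
  exists2 s, step s & (N (fun t => f t - step_fun s t)%R <= e%:E)%E.
Proof.
move=> [sf Nf] e0; have [s [f' [ss sf' ff']]] := smeas_regular sf.
have mf' : measurable_fun [set: T] (fun t => `|f' t|) by exact: measurable_norm_limit sf'.
have ms n : measurable_fun [set: T] (fun t => `|step_fun (s n) t|).
  exact: (measurable_step (fun x => `|x|) (ss n)).
(* The factor 2 lets the cut-off disappear in the limit wherever f' is nonzero. *)
pose A n := [set t | `|step_fun (s n) t| <= 2 * `|f' t|].
have mA n : measurable (A n).
  have m2 : measurable_fun [set: T] (fun t => 2 * `|f' t|).
    by apply: measurable_funM => //; exact: measurable_cst.
  by have := measurable_fun_le measurableT (ms n) m2; rewrite setTI.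
pose s' n := restrict_step (A n) (s n).
have ss' n : step (s' n) by exact: step_over_restrict.
have s'f t : step_fun (s' n) t @[n --> \oo] --> f' t.
  have [f0|f0] := eqVneq (f' t) 0.
    rewrite f0 (_ : (fun n => _) = cst 0); first exact: cvg_cst.
    apply/funext => n; rewrite step_fun_restrict indicE.
    have [tA|_] := boolP (t \in A n); last by rewrite scale0r.
    move: tA; rewrite inE /A /= f0 normr0 mulr0 normr_le0 => /eqP ->.
    by rewrite scaler0.
  have nf0 : 0 < `|f' t| by rewrite normr_gt0.
  have : \forall n \near \oo, `|step_fun (s n) t| < 2 * `|f' t|.
    by apply: (cvgr_lt _ (cvg_norm (sf' t))); rewrite mulr_natl mulr2n ltrDl.
  move=> nearA; apply: cvg_trans (sf' t); apply: near_eq_cvg.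
  apply: filterS nearA => n tA; rewrite step_fun_restrict indicE mem_set ?scale1r//.
  exact: ltW.
have s'le n t : `|step_fun (s' n) t| <= 2 * `|f' t|.
  rewrite step_fun_restrict indicE; have [tA|tA] := boolP (t \in A n).
    by rewrite scale1r; move: tA; rewrite inE.
  by rewrite scale0r normr0 mulr_ge0.
pose h n t : \bar R := (`|f' t - step_fun (s' n) t| `^ p)%:E.
have mh n : measurable_fun [set: T] (h n).
  apply/measurable_EFinP; apply: (measurableT_comp (measurable_powR p)).
  apply: (measurable_norm_limit (mu := mu)
    (s := fun k => s k ++ scale_step (-1) (s' n))).
    by move=> k; apply: step_over_cat => //; exact: step_over_scale.
  move=> t; under eq_fun do rewrite step_fun_cat step_fun_scale scaleN1r.
  exact: cvgB (sf' t) (cvg_cst _).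
pose G t : \bar R := (3 `^ p * `|f' t| `^ p)%:E.
have iG : mu.-integrable [set: T] G.
  apply/integrableP; split.
    apply/measurable_EFinP; apply: measurable_funM; first exact: measurable_cst.
    exact: (measurableT_comp (measurable_powR p)).
  under eq_integral do rewrite /G gee0_abs ?lee_fin ?mulr_ge0 ?powR_ge0// EFinM.
  rewrite ge0_integralZl_EFin ?powR_ge0//.
    have -> : (\int[mu]_t (`|f' t| `^ p)%:E = N f `^ p)%E.
      rewrite (ae_eq_Lpnorm p0 ff') LpnormE -poweRrM mulVf ?gt_eqF// poweRe1//.
      by apply: integral_ge0 => t _; rewrite lee_fin powR_ge0.
    by rewrite lte_mul_pinfty ?lee_fin ?powR_ge0// poweR_lty.
  by apply/measurable_EFinP; exact: (measurableT_comp (measurable_powR p)).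
have h_to0 t : h n t @[n --> \oo] --> 0%:E.
  apply: cvg_EFin; first exact: nearW.
  rewrite -(powR0 (lt0r_neq0 p0)); apply: cvg_powR => //.
  rewrite -[X in _ --> X](normr0 X); apply: cvg_norm.
  by rewrite -(subrr (f' t)); exact: cvgB (cvg_cst _) (s'f t).
have hG n t : (`|h n t| <= G t)%E.
  rewrite gee0_abs ?lee_fin ?powR_ge0// -powRM//.
  apply: ge0_ler_powR; rewrite ?nnegrE ?(ltW p0) ?mulr_ge0//.
  apply: le_trans (ler_normB _ _) _.
  by have := s'le n t; lra.
have [_ _] := dominated_convergence measurableT mh (measurable_cst _)
  (aeW _ (fun t _ => h_to0 t)) iG (aeW _ (fun t n _ => hG n t)).
rewrite integral0 => /fine_cvgP[fin_h /cvgr_lt/(_ (e `^ p))].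
rewrite powR_gt0// => /(_ isT) lt_h.
have [n [hfin hlt]] : exists n, (\int[mu]_t h n t)%E \is a fin_num /\
    fine (\int[mu]_t h n t)%E < e `^ p.
  have [n _ hn] := filterI fin_h lt_h; exists n; split.
    by have [] := hn n (leqnn n).
  by have [_] := hn n (leqnn n).
exists (s' n) => //.
rewrite (@ae_eq_Lpnorm _ _ _ _ _ _ _ (fun t => f' t - step_fun (s' n) t))//; last first.
  by apply: filterS ff' => t ->.
have -> : e%:E = ((e `^ p)%:E `^ p^-1)%E.
  by rewrite poweR_EFin -powRrM mulfV ?gt_eqF// powRr1 ?(ltW e0).
rewrite LpnormE; apply: ge0_le_poweR; first by rewrite invr_ge0 ltW.
  by apply: integral_ge0 => t _; rewrite lee_fin powR_ge0.
by rewrite -(fineK hfin) lee_fin ltW.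
Qed.

End step_density.

Section bochner_integral.
Context {R : realType} {X : completeNormedModType R}.
Context d (T : measurableType d) (mu : {measure set T -> \bar R}).
Implicit Types (f g : T -> X) (s : seq (set T * X)).
Local Notation smeas := (strongly_measurable mu measurable).
Local Notation step := (step_over mu measurable).

Let fin_mu (A : set T) : (mu A < +oo)%E -> mu A \is a fin_num.
Proof. by move=> h; rewrite ge0_fin_numE. Qed.

(** The sets of a step function may overlap. The induction removes one of them at a
    time, dividing the domain D into its parts inside and outside of that set;
    y collects the values of the sets removed so far that contain D. *)
Lemma norm_step_int_on s (y : X) (D : set T) : step s -> measurable D ->
    (mu D < +oo)%E ->
  ((`|fine (mu D) *: y + \sum_(e <- s) fine (mu (e.1 `&` D)) *: e.2|)%:E <=
   \int[mu]_(t in D) (`|y + step_fun s t|)%:E)%E.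
Proof.
elim: s y D => [|[A x] s IHs] y D ss mD muD.
  rewrite big_nil addr0; under eq_integral do rewrite /step_fun big_nil addr0.
  rewrite integral_cst// normrZ ger0_norm ?fine_ge0// EFinM fineK ?fin_mu//.
  by rewrite muleC.
have ss' : step s by move=> e es; apply: ss; rewrite inE es orbT.
have [mA _] := ss (A, x) (mem_head _ _).
have mDA : measurable (D `&` A) by exact: measurableI.
have mDB : measurable (D `\` A) by exact: measurableD.
have muS B : measurable B -> B `<=` D -> (mu B < +oo)%E.
  by move=> mB BD; apply: le_lt_trans muD; apply: le_measure; rewrite ?inE.
have muDA : (mu (D `&` A) < +oo)%E by apply: muS => //; exact: subIsetl.
have muDB : (mu (D `\` A) < +oo)%E by apply: muS => //; exact: subDsetl.
have split_mu B : measurable B ->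
    fine (mu (B `&` D)) = fine (mu (B `&` (D `&` A))) + fine (mu (B `&` (D `\` A))).
  move=> mB; rewrite -fineD ?fin_mu//; last 2 first.
  - by apply: muS; [exact: measurableI|move=> t [_ []]].
  - by apply: muS; [exact: measurableI|move=> t [_ []]].
  congr fine; rewrite -measureU//; [|exact: measurableI|exact: measurableI|].
    by rewrite -setIUr setUIDK.
  by apply/seteqP; split=> t // [[_ [_ At]] [_ [_]]].
have splitD : D = (D `&` A) `|` (D `\` A) by rewrite setUIDK.
have disj : [disjoint (D `&` A) & (D `\` A)].
  by apply/disj_setPS => t [[_ At] [_]].
have mstep : measurable_fun [set: T] (fun t => (`|y + step_fun ((A, x) :: s) t|)%:E).
  by apply/measurable_EFinP; exact: (measurable_step (fun z => `|y + z|) ss).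
rewrite [X in (_ <= \int[mu]_(t in X) _)%E]splitD ge0_integral_setU//; last first.
  exact: measurable_funTS.
have -> : fine (mu D) *: y + \sum_(e <- (A, x) :: s) fine (mu (e.1 `&` D)) *: e.2 =
  (fine (mu (D `&` A)) *: (y + x) + \sum_(e <- s) fine (mu (e.1 `&` (D `&` A))) *: e.2) +
  (fine (mu (D `\` A)) *: y + \sum_(e <- s) fine (mu (e.1 `&` (D `\` A))) *: e.2).
  have -> : fine (mu D) = fine (mu (D `&` A)) + fine (mu (D `\` A)).
    by have := split_mu setT measurableT; rewrite !setTI.
  rewrite big_cons /= [A `&` D]setIC.
  have -> : \sum_(e <- s) fine (mu (e.1 `&` D)) *: e.2 =
     \sum_(e <- s) fine (mu (e.1 `&` (D `&` A))) *: e.2 +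
     \sum_(e <- s) fine (mu (e.1 `&` (D `\` A))) *: e.2.
    rewrite -big_split; apply: eq_big_seq => e /ss'[me _].
    by rewrite split_mu// scalerDl.
  by rewrite scalerDl scalerDr [LHS](AC (2*(1*2)) (((1*3)*4)*(2*5))).
apply: (@le_trans _ _ (`|fine (mu (D `&` A)) *: (y + x) +
    \sum_(e <- s) fine (mu (e.1 `&` (D `&` A))) *: e.2|%:E +
  `|fine (mu (D `\` A)) *: y + \sum_(e <- s) fine (mu (e.1 `&` (D `\` A))) *: e.2|%:E)%E).
  by rewrite -EFinD lee_fin ler_normD.
apply: leeD.
  apply: le_trans (IHs (y + x) _ ss' mDA muDA) _.
  rewrite le_eqVlt; apply/orP; left; apply/eqP/eq_integral => t.
  by rewrite inE => -[_ At]; rewrite /step_fun big_cons /= indicE mem_set// scale1r addrA.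
apply: le_trans (IHs y _ ss' mDB muDB) _.
rewrite le_eqVlt; apply/orP; left; apply/eqP/eq_integral => t.
by rewrite inE => -[_ At]; rewrite /step_fun big_cons /= indicE memNset// scale0r add0r.
Qed.

(** All sets of the step function lie in the domain D, their union. *)
Lemma norm_step_int s : step s ->
  ((`|step_int mu s|)%:E <= \int[mu]_t (`|step_fun s t|)%:E)%E.
Proof.
move=> ss; pose D := \big[setU/set0]_(e <- s) e.1.
have [mD muD] : measurable D /\ (mu D < +oo)%E.
  rewrite /D; elim: s ss {D} => [|e s IHs] ss; first by rewrite big_nil measure0.
  have [m1 m2] := ss e (mem_head _ _).
  have [|m3 m4] := IHs; first by move=> e' es; apply: ss; rewrite inE es orbT.
  rewrite big_cons; split; first exact: measurableU.
  apply: (@le_lt_trans _ _ (mu e.1 + mu (\big[setU/set0]_(e <- s) e.1))%E).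
    exact: measureU2.
  exact: lte_add_pinfty.
have := norm_step_int_on 0 ss mD muD; rewrite scaler0 add0r.
have -> : \sum_(e <- s) fine (mu (e.1 `&` D)) *: e.2 = step_int mu s.
  apply: eq_big_seq => e es; congr (fine (mu _) *: _).
  apply/setIidPl; rewrite /D; elim: s es {ss D mD muD} => // e' s IHs.
  by rewrite inE big_cons => /predU1P[<- t|/IHs es t /es]; [left|right].
under eq_integral do rewrite add0r.
move=> /le_trans; apply; apply: ge0_subset_integral => //.
by apply/measurable_EFinP; exact: (measurable_step (fun z => `|z|) ss).
Qed.

Lemma Lpnorm1 f : Lpnorm mu 1 f = (\int[mu]_t (`|f t|)%:E)%E.
Proof. by rewrite /Lpnorm Lnorm1; under eq_integral do rewrite /= normr_id. Qed.

Lemma step_int_dist f s s' : smeas f -> step s -> step s' ->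
  ((`|step_int mu s - step_int mu s'|)%:E <=
   Lpnorm mu 1 (fun t => f t - step_fun s t)%R +
   Lpnorm mu 1 (fun t => f t - step_fun s' t)%R)%E.
Proof.
move=> sf ss ss'; rewrite -scaleN1r -step_int_scale -step_int_cat.
apply: le_trans (norm_step_int _) _.
  by apply: step_over_cat => //; exact: step_over_scale.
rewrite -Lpnorm1 (Lpnorm_distC mu 1 f (step_fun s)).
apply: le_trans (Lpnorm_triangle (lexx 1) (smeas_step ss) sf (smeas_step ss')).
rewrite le_eqVlt; apply/orP; left; apply/eqP/eq_Lpnorm => t.
by rewrite step_fun_cat step_fun_scale scaleN1r.
Qed.

Lemma is_bochner_unique f v v' : is_bochner mu f v -> is_bochner mu f v' -> v = v'.
Proof.
move=> [sf [s [ss fs0 sv]]] [_ [s' [ss' fs0' sv']]].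
have fs := (ecvg0P (fun n => Lpnorm_ge0 mu 1 (fun t => f t - step_fun (s n) t))).1.
have fs' := (ecvg0P (fun n => Lpnorm_ge0 mu 1 (fun t => f t - step_fun (s' n) t))).1.
apply/eqP; rewrite -subr_eq0 -normr_le0; apply/ler_addgt0Pr => e e0; rewrite add0r.
have e2 : 0 < e / 2 by rewrite divr_gt0.
have [|n hn] := fs _ _ e2; first by under eq_fun do rewrite Lpnorm1.
have [|n' hn'] := fs' _ _ e2; first by under eq_fun do rewrite Lpnorm1.
apply: (cvgr_to_le (cvg_norm (cvgB sv sv'))).
exists (maxn n n') => // k /=; rewrite geq_max => /andP[/hn nk /hn' n'k].
rewrite -lee_fin; apply: le_trans (step_int_dist sf (ss k) (ss' k)) _.
by rewrite [e]splitr EFinD leeD.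
Qed.

(** The integrals of the step functions form a Cauchy sequence, and the Bochner
    integral is unique, so that the choice in its definition returns the limit. *)
Lemma bochner_limit f (s : nat -> seq (set T * X)) : smeas f -> (forall n, step (s n)) ->
    Lpnorm mu 1 (fun t => f t - step_fun (s n) t) @[n --> \oo] --> 0%E ->
  step_int mu (s n) @[n --> \oo] --> bochner mu f.
Proof.
move=> sf ss fs.
have fs' := (ecvg0P (fun n => Lpnorm_ge0 mu 1 _)).1 fs.
have : cvgn (fun n => step_int mu (s n)).
  apply/cauchy_cvgP/cauchy_exP => e e0.
  have e4 : 0 < e / 4 by rewrite divr_gt0.
  have [n hn] := fs' _ e4; exists (step_int mu (s n)).
  exists n => // k /= nk; rewrite -ball_normE /=.
  apply: (@le_lt_trans _ _ (e / 2)); last by lra.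
  rewrite -lee_fin; apply: le_trans (step_int_dist sf (ss n) (ss k)) _.
  have -> : (e / 2)%:E = ((e / 4)%:E + (e / 4)%:E)%E by rewrite -EFinD; congr EFin; lra.
  by apply: leeD; exact: hn.
move=> /cvg_ex[v sv].
have bv : is_bochner mu f v.
  by split=> //; exists s; split=> //; under eq_fun do rewrite -Lpnorm1.
have := xgetPex 0 (ex_intro _ v bv); rewrite -/(bochner mu f) => bb.
by rewrite (is_bochner_unique bb bv).
Qed.

End bochner_integral.

(** * Density of the Haar sums *)

Section Lp_indicators.
Context {R : realType} {X : completeNormedModType R}.
Context d (T : measurableType d) (mu : {measure set T -> \bar R}).
Variable p : R.
Hypothesis p1 : 1 <= p.
Let p0 : 0 < p. Proof. exact: lt_le_trans p1. Qed.

Lemma Lpnorm_indic (B : set T) (x : X) : measurable B -> (mu B < +oo)%E ->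
  Lpnorm mu p (fun t => (\1_B t : R) *: x) = (`|x| * fine (mu B) `^ p^-1)%:E.
Proof.
move=> mB muB; have muB' : mu B \is a fin_num by rewrite ge0_fin_numE.
rewrite LpnormE (_ : (fun t => _) = (fun t => (`|x| `^ p)%:E * (\1_B t)%:E)%E); last first.
  apply/funext => t; rewrite indicE; case: (t \in B).
    by rewrite scale1r mule1.
  by rewrite scale0r normr0 powR0 ?gt_eqF// mule0.
rewrite ge0_integralZl_EFin ?powR_ge0//; last first.
  by apply/measurable_EFinP; exact: measurable_indic.
rewrite integral_indic// setIT -(fineK muB') -EFinM poweR_EFin powRM ?powR_ge0 ?fine_ge0//.
by rewrite -powRrM mulfV ?gt_eqF// powRr1.
Qed.

Lemma Lpnorm_step_lty (s : seq (set T * X)) : step_over mu measurable s ->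
  (Lpnorm mu p (step_fun s) < +oo)%E.
Proof.
elim: s => [|[A x] s IHs] ss.
  have -> : step_fun [::] = (fun t => (\1_set0 t : R) *: (0 : X)) :> (T -> X).
    by apply/funext => t; rewrite /step_fun big_nil scaler0.
  by rewrite Lpnorm_indic ?measure0 ?ltry.
have ss' : step_over mu measurable s by move=> e es; apply: ss; rewrite inE es orbT.
have [mA muA] := ss (A, x) (mem_head _ _).
have sA : step_over mu measurable [:: (A, x)] by move=> e; rewrite inE => /eqP ->.
have -> : step_fun ((A, x) :: s) = (fun t => step_fun [:: (A, x)] t + step_fun s t).
  by apply/funext => t; rewrite -step_fun_cat.
apply: le_lt_trans (LpnormD p1 (smeas_step sA) (smeas_step ss')) _.
apply: lte_add_pinfty; last exact: IHs.
have -> : step_fun [:: (A, x)] = (fun t => (\1_A t : R) *: x).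
  by apply/funext => t; rewrite /step_fun big_seq1.
by rewrite Lpnorm_indic ?ltry.
Qed.

End Lp_indicators.

Section dyadic_children.
Context {R : realType}.
Implicit Type I : dyadic.

Definition left_child I : dyadic := (I.1 + 1, 2 * I.2).
Definition right_child I : dyadic := (I.1 + 1, 2 * I.2 + 1).

Lemma indic_children I t :
  \1_(ditv R I) t = \1_(ditv R (left_child I)) t + \1_(ditv R (right_child I)) t :> R.
Proof.
have w : width (I.1 + 1) I = 2 by rewrite /width addrAC subrr add0r.
have w' J : J.1 = I.1 + 1 -> width (I.1 + 1) J = 1 by move=> J1; rewrite /width J1 subrr.
rewrite !(indic_ditv (N := I.1 + 1))//=; [|by lia].
rewrite /wholeI w !w'//= /block; set y := cell _ _.
case h1: (_ && _); case h2: (_ && _); case h3: (_ && _);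
  rewrite ?addr0 ?add0r//; by move: h1 h2 h3; lia.
Qed.

Lemma haar_children I t :
  haar I t = \1_(ditv R (left_child I)) t - \1_(ditv R (right_child I)) t :> R.
Proof.
have w : width (I.1 + 1) I = 2 by rewrite /width addrAC subrr add0r.
have w' J : J.1 = I.1 + 1 -> width (I.1 + 1) J = 1 by move=> J1; rewrite /width J1 subrr.
rewrite !(indic_ditv (N := I.1 + 1))//= (haarE (N := I.1 + 1)); last by lia.
rewrite /haarZ /halfI /wholeI w !w'//= /block; set y := cell _ _.
by congr (_%:R - _%:R); congr nat_of_bool; lia.
Qed.

Lemma measurable_ditv I : measurable (ditv R I). Proof. exact: measurable_itv. Qed.

(** The indicator function of an interval is half that of its parent plus or minus half
    the Haar function of the parent. *)
Lemma indic_parent I : exists J : dyadic, J.1 = I.1 - 1 /\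
  exists e : R, forall t, \1_(ditv R I) t = 2^-1 * \1_(ditv R J) t + e * haar J t.
Proof.
exists (I.1 - 1, (I.2 %/ 2)%Z); split=> //.
have eI : I.2 = 2 * (I.2 %/ 2)%Z + (I.2 %% 2)%Z by rewrite mulrC -divz_eq.
have : (I.2 %% 2)%Z = 0 \/ (I.2 %% 2)%Z = 1 by lia.
case=> i2; [exists 2^-1|exists (- 2^-1)] => t;
  rewrite [in RHS]indic_children haar_children.
  rewrite (_ : left_child _ = I); last first.
    case: I eI i2 => e k eI i2; rewrite /= in eI i2.
    change ((e - 1 + 1, 2 * (k %/ 2)%Z) = (e, k) :> dyadic).
    by rewrite subrK; congr pair; lia.
  by field.
rewrite (_ : right_child _ = I); last first.
  case: I eI i2 => e k eI i2; rewrite /= in eI i2.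
  change ((e - 1 + 1, 2 * (k %/ 2)%Z + 1) = (e, k) :> dyadic).
  by rewrite subrK; congr pair; lia.
by field.
Qed.

End dyadic_children.

Section haar_sums.
Context {R : realType} {X : completeNormedModType R}.
Local Notation mu := (@lebesgue_measure R).
Implicit Types (S : {fset dyadic}) (c : dyadic -> X).

Definition ditv_step (F : dyadic -> dyadic) (a : R) S c : seq (set R * X) :=
  [seq (ditv R (F J), a *: c J) | J <- enum_fset S].

Lemma step_over_ditv F a S c : step_over mu measurable (ditv_step F a S c).
Proof.
move=> _ /mapP[I _ ->]; split; first exact: measurable_ditv.
by rewrite [X in (X < _)%E](mu_ditv (F I)) ltry.
Qed.

Lemma step_fun_ditv F a S c t : step_fun (ditv_step F a S c) t =
  \sum_(I <- S) (a * \1_(ditv R (F I)) t) *: c I.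
Proof.
rewrite /step_fun big_map; apply: eq_bigr => I _ /=.
by rewrite scalerA mulrC.
Qed.

Definition haar_step S c := ditv_step left_child 1 S c ++ ditv_step right_child (-1) S c.

Lemma step_over_haar S c : step_over mu measurable (haar_step S c).
Proof. by apply: step_over_cat; exact: step_over_ditv. Qed.

Lemma step_fun_haar S c : step_fun (haar_step S c) = haar_sum S c.
Proof.
apply/funext => t; rewrite step_fun_cat !step_fun_ditv -big_split.
apply: eq_bigr => I _ /=.
by rewrite -scalerDl mul1r mulN1r haar_children.
Qed.

Definition shift_step m S c := ditv_step (tau m) 1 S c ++ ditv_step id (-1) S c.

Lemma step_over_shift m S c : step_over mu measurable (shift_step m S c).
Proof. by apply: step_over_cat; exact: step_over_ditv. Qed.

Lemma step_fun_shift m S c : step_fun (shift_step m S c) = U_haar_sum m S c.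
Proof.
apply/funext => t; rewrite step_fun_cat !step_fun_ditv -big_split.
apply: eq_bigr => I _ /=.
by rewrite -scalerDl mul1r mulN1r.
Qed.

Lemma smeas_haar S c : strongly_measurable mu measurable (haar_sum S c).
Proof. by rewrite -step_fun_haar; apply: smeas_step; exact: step_over_haar. Qed.

Lemma smeas_shift m S c : strongly_measurable mu measurable (U_haar_sum m S c).
Proof. by rewrite -step_fun_shift; apply: smeas_step; exact: step_over_shift. Qed.

(** Extending by zero brings sums over different sets to a common index set. *)
Definition coef S c I : X := if I \in S then c I else 0.

Lemma sum_coef (phi : dyadic -> R) S S' c : (S `<=` S')%fset ->
  \sum_(I <- S') phi I *: coef S c I = \sum_(I <- S) phi I *: c I.
Proof.
move=> SS'; rewrite [RHS](eq_big_seq (fun I => phi I *: coef S c I)); last first.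
  by move=> I IS; rewrite /coef IS.
by rewrite [RHS](big_fset_incl _ SS') => // I _ IS; rewrite /coef (negbTE IS) scaler0.
Qed.

Lemma haar_sum_coef S S' c : (S `<=` S')%fset ->
  haar_sum S' (coef S c) = haar_sum S c.
Proof. by move=> SS'; apply/funext => t; exact: sum_coef. Qed.

Lemma haar_sum_diff S S' c c' :
  (fun t => haar_sum S c t - haar_sum S' c' t) =
  haar_sum (S `|` S')%fset (fun I => coef S c I - coef S' c' I).
Proof.
apply/funext => t.
rewrite -(haar_sum_coef c (fsubsetUl S S')) -(haar_sum_coef c' (fsubsetUr S S')).
by rewrite /haar_sum -sumrB; apply: eq_bigr => I _; rewrite scalerBr.
Qed.

Lemma U_haar_sum_diff m S S' c c' :
  (fun t => U_haar_sum m S c t - U_haar_sum m S' c' t) =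
  U_haar_sum m (S `|` S')%fset (fun I => coef S c I - coef S' c' I).
Proof.
apply/funext => t; rewrite /U_haar_sum.
rewrite -(sum_coef (fun I => \1_(ditv R (tau m I)) t - \1_(ditv R I) t) c (fsubsetUl S S')).
rewrite -(sum_coef (fun I => \1_(ditv R (tau m I)) t - \1_(ditv R I) t) c' (fsubsetUr S S')).
by rewrite -sumrB; apply: eq_bigr => I _; rewrite scalerBr.
Qed.

Lemma haar_sum_add S S' c c' : exists S'' c'',
  (fun t => haar_sum S c t + haar_sum S' c' t) = haar_sum S'' c''.
Proof.
have E : haar_sum S' (fun I => - c' I) =1 (fun t => - haar_sum S' c' t).
  by move=> t; rewrite /haar_sum -sumrN; apply: eq_bigr => I _; rewrite scalerN.
have := haar_sum_diff S S' c (fun I => - c' I).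
under eq_fun do rewrite E opprK.
by move=> ->; do 2!eexists.
Qed.

End haar_sums.

Section haar_density.
Context {R : realType} {X : completeNormedModType R}.
Local Notation mu := (@lebesgue_measure R).
Variable p : R.
Hypothesis p1 : 1 < p.
Let p1' : 1 <= p. Proof. exact: ltW. Qed.
Let p0 : 0 < p. Proof. exact: lt_trans p1. Qed.
Local Notation smeas := (strongly_measurable mu measurable).
Local Notation N := (Lpnorm mu p).

Definition haar_dense (f : R -> X) : Prop := smeas f /\ forall e : R, 0 < e ->
  exists S c, (N (fun t => f t - haar_sum S c t)%R <= e%:E)%E.

Lemma haar_denseD f g : haar_dense f -> haar_dense g -> haar_dense (fun t => f t + g t).
Proof.
move=> [sf df] [sg dg]; split; first exact: smeasD.
move=> e e0; have e2 : 0 < e / 2 by rewrite divr_gt0.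
have [S [c Sc]] := df _ e2; have [S' [c' Sc']] := dg _ e2.
have [S'' [c'' E]] := haar_sum_add S S' c c'; exists S'', c''; rewrite -E.
have -> : (fun t => f t + g t - (haar_sum S c t + haar_sum S' c' t)) =
    (fun t => (f t - haar_sum S c t) + (g t - haar_sum S' c' t)).
  by apply/funext => t; rewrite opprD addrACA.
apply: le_trans (LpnormD p1' _ _) _; [exact/smeasB/smeas_haar|exact/smeasB/smeas_haar|].
by rewrite [e]splitr EFinD leeD.
Qed.

Lemma haar_dense_closed f : smeas f ->
    (forall e : R, 0 < e -> exists2 g, haar_dense g & (N (fun t => f t - g t)%R <= e%:E)%E) ->
  haar_dense f.
Proof.
move=> sf df; split=> // e e0; have e2 : 0 < e / 2 by rewrite divr_gt0.
have [g [sg dg] fg] := df _ e2; have [S [c Sc]] := dg _ e2; exists S, c.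
apply: le_trans (Lpnorm_triangle p1' sf sg (smeas_haar S c)) _.
by rewrite [e]splitr EFinD leeD.
Qed.

(** Iterating the step to the parent removes one Haar function at a time and leaves
    the mean over the n-th ancestor. *)
Lemma indic_ancestor (x : X) (n : nat) (I : dyadic) : exists (J : dyadic) S c,
  J.1 = I.1 - n%:Z /\ forall t, (\1_(ditv R I) t : R) *: x - haar_sum S c t =
    (\1_(ditv R J) t : R) *: (2^-1 ^+ n *: x).
Proof.
elim: n => [|n [J [S [c [JI Sc]]]]].
  exists I, fset0, (fun=> 0); rewrite subr0; split=> // t.
  by rewrite /haar_sum big_seq_fset0 subr0 expr0 scale1r.
have [K [KJ [e Ke]]] := @indic_parent R J.
have [S' [c' E]] := haar_sum_add S [fset J]%fset c (fun=> 0 : X).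
have [S'' [c'' E']] := haar_sum_add S [fset K]%fset c (fun=> e *: (2^-1 ^+ n *: x)).
exists K, S'', c''; split; first by rewrite KJ JI; lia.
move=> t; rewrite -E' opprD addrA Sc Ke /haar_sum big_seq_fset1.
rewrite scalerDl [haar K t *: _]scalerA [haar K t * e]mulrC addrK !scalerA.
by congr (_ *: _); rewrite exprS; ring.
Qed.

(** The L^p norm of the mean over the n-th ancestor is of order 2^(n/p - n), which tends
    to 0. This is where p > 1 is needed: the Haar sums are not dense in L^1. *)
Lemma haar_dense_ditv (x : X) I : haar_dense (fun t => (\1_(ditv R I) t : R) *: x).
Proof.
have sI (J : dyadic) (y : X) : smeas (fun t => (\1_(ditv R J) t : R) *: y).
  have -> : (fun t => (\1_(ditv R J) t : R) *: y) = step_fun [:: (ditv R J, y)].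
    by apply/funext => t; rewrite /step_fun big_seq1.
  apply: smeas_step => e; rewrite inE => /eqP ->; split; first exact: measurable_ditv.
  by rewrite [X in (X < _)%E](mu_ditv J) ltry.
split=> // e e0.
(* r^n is the ratio of the norm of the mean over the n-th ancestor to that of the
   original function. *)
pose r : R := 2^-1 * 2 `^ p^-1.
have r1 : `|r| < 1.
  have r0 : 0 <= r by rewrite mulr_ge0 ?invr_ge0 ?powR_ge0.
  rewrite ger0_norm// ltr_pdivrMl// mulr1.
  rewrite /powR pnatr_eq0 /= -[ltRHS]lnK ?posrE// ltr_expR.
  by rewrite gtr_pMl ?ln_gt0 ?ltr1n// invf_lt1.
have := cvg_geometric (`|x| * dlen R I `^ p^-1) r1.
move=> /cvgr0Pnorm_le/(_ _ e0)[n _ hn]; have {hn} := hn n (leqnn n).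
rewrite /geometric /= => hn.
have [J [S [c [JI Sc]]]] := indic_ancestor x n I.
exists S, c; under eq_Lpnorm do rewrite Sc.
rewrite Lpnorm_indic//; last 2 first.
- exact: measurable_ditv.
- by rewrite [X in (X < _)%E](mu_ditv J) ltry.
rewrite lee_fin; apply: le_trans hn; apply: le_trans (ler_norm _); rewrite le_eqVlt.
apply/orP; left; apply/eqP; rewrite [X in fine X](mu_ditv J) /=.
have -> : dlen R J = 2 ^+ n * dlen R I.
  by rewrite /dlen JI opprB expfzDr ?pnatr_eq0// -exprnP.
rewrite powRM ?exprn_ge0 ?ltW ?dlen_gt0// normrZ ger0_norm ?exprn_ge0 ?invr_ge0//.
rewrite /r exprMn -[2 ^+ n]powR_mulrn// -[(2 `^ p^-1) ^+ n]powR_mulrn ?powR_ge0//.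
by rewrite -!powRrM [n%:R * _]mulrC; ring.
Qed.

Lemma haar_dense_step s : (forall e, e \in s -> haar_dense (fun t => (\1_(e.1) t : R) *: e.2)) ->
  haar_dense (step_fun s).
Proof.
elim: s => [|e s IHs] hs.
  have -> : step_fun [::] = haar_sum fset0 (fun=> 0) :> (R -> X).
    by apply/funext => t; rewrite /step_fun /haar_sum big_nil big_seq_fset0.
  split; first exact: smeas_haar.
  move=> e e0; exists fset0, (fun=> 0); under eq_Lpnorm do rewrite subrr.
  by rewrite /Lpnorm; under eq_fun do rewrite normr0; rewrite Lnorm0 ?lee_fin ?ltW// eqe gt_eqF.
have -> : step_fun (e :: s) = (fun t => (\1_(e.1) t : R) *: e.2 + step_fun s t).
  by apply/funext => t; rewrite /step_fun big_cons.
apply: haar_denseD; first exact: hs (mem_head _ _).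
by apply: IHs => e' es; apply: hs; rewrite inE es orbT.
Qed.

(** It remains to approximate sets in measure. *)
Lemma Lpnorm_indic_small (x : X) (e : R) : 0 < e -> exists2 del : R, 0 < del &
  forall B : set R, measurable B -> (mu B <= del%:E)%E ->
    (N (fun t => (\1_B t : R) *: x) <= e%:E)%E.
Proof.
move=> e0; have x1 : 0 < 1 + `|x| by rewrite ltr_pwDl.
have ex : 0 < e / (1 + `|x|) by rewrite divr_gt0.
exists ((e / (1 + `|x|)) `^ p) => [|B mB muB]; first exact: powR_gt0.
have muBy : (mu B < +oo)%E by apply: le_lt_trans muB _; rewrite ltry.
have muBf : mu B \is a fin_num by rewrite ge0_fin_numE.
rewrite Lpnorm_indic// lee_fin.
apply: (@le_trans _ _ (`|x| * (e / (1 + `|x|)))).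
  apply: ler_wpM2l => //.
  have -> : e / (1 + `|x|) = ((e / (1 + `|x|)) `^ p) `^ p^-1.
    by rewrite -powRrM mulfV ?gt_eqF// powRr1// ltW.
  apply: ge0_ler_powR; rewrite ?nnegrE ?powR_ge0 ?fine_ge0 ?invr_ge0 ?(ltW p0)//.
  by have := muB; rewrite -{1}(fineK muBf) lee_fin.
by rewrite mulrCA ger_pMr// ler_pdivrMr// mul1r lerDr.
Qed.

Lemma smeas_indic_cst (A : set R) (x : X) : measurable A -> (mu A < +oo)%E ->
  smeas (fun t => (\1_A t : R) *: x).
Proof.
move=> mA muA; have -> : (fun t => (\1_A t : R) *: x) = step_fun [:: (A, x)].
  by apply/funext => t; rewrite /step_fun big_seq1.
by apply: smeas_step => e; rewrite inE => /eqP ->.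
Qed.

Section open_set.
Variable U : set R.
Hypotheses (oU : open U) (muU : (mu U < +oo)%E).

Let h (n : nat) : R := dlen R (n%:Z, 0).
Let A (n : nat) : nat := (n * 2 ^ n)%N.
Let F n (z : int) : R :=
  (block (- (A n)%:Z) ((A n).*2)%:Z z && `[< ditv R (n%:Z, z) `<=` U >])%:R.
Let g n t := F n (cell (h n) t).

Let h_gt0 n : 0 < h n. Proof. exact: dlen_gt0. Qed.

Let hE n : h n = (2 ^+ n)^-1. Proof. by rewrite /h /dlen /= exprnN. Qed.

Let supF n : supported (A n) (F n).
Proof. by move=> z zA; rewrite /F (negbTE zA). Qed.

Let g_in n t : g n t = 1 \/ g n t = 0.
Proof. by rewrite /g /F; case: (_ && _); auto. Qed.

Let g_sub n t : g n t = 1 -> U t.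
Proof.
rewrite /g /F; case: andP => [[_ /asboolP tU] _|_ /eqP]; last by rewrite eq_sym oner_eq0.
by apply: tU; apply/(cellsetE (h_gt0 n)).
Qed.

Let g_near t : U t -> exists n, forall k, (n <= k)%N -> g k t = 1.
Proof.
move=> Ut; have /nbhs_ballP[e /= e0 eU] : nbhs t U by exact: open_nbhs_nbhs.
have [n0 n0P] : exists n0, forall k, (n0 <= k)%N -> h k < e.
  have half1 : `|2^-1 : R| < 1 by rewrite ger0_norm// invf_lt1// ltr1n.
  have /cvgr0Pnorm_lt/(_ _ e0)[n0 _ hn0] := cvg_expr half1.
  exists n0 => k /hn0 /=; rewrite ger0_norm ?exprn_ge0// => /le_lt_trans; apply.
  by rewrite hE exprVn.
have [n1 n1P] : exists n1 : nat, `|t| < n1%:R.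
  by exists (Num.trunc `|t|).+1; exact: truncnS_gt.
exists (maxn n0 n1) => k; rewrite geq_max => /andP[n0k n1k].
have tk : `|t| < k%:R by apply: lt_le_trans n1P _; rewrite ler_nat.
have hA : h k * (A k)%:R = k%:R.
  by rewrite hE /A natrM natrX mulrCA mulVf ?mulr1// expf_neq0// pnatr_eq0.
have cellk := block_cell (h_gt0 k).
rewrite /g /F (_ : _ && _ = true)//; apply/andP; split.
  rewrite cellk -addnn PoszD addrA addNr add0r mulrNz mulrN.
  by rewrite -[(Posz _)%:~R]/((A k)%:R) hA; move: tk; rewrite ltr_norml => /andP[/ltW -> ->].
apply/asboolP => y; rewrite /ditv /= in_itv /= => /andP[y1 y2].
apply: eU; rewrite -ball_normE /=; apply: le_lt_trans (n0P k n0k).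
have /(cellsetE (h_gt0 k)) : cell (h k) t = cell (h k) t by [].
rewrite /cellset /= in_itv /= => /andP[t1 t2].
have hD : h k * (cell (h k) t + 1)%:~R = h k * (cell (h k) t)%:~R + h k.
  by rewrite intrD mulrDr mulr1.
have y1' : h k * (cell (h k) t)%:~R <= y := y1.
have y2' : y < h k * (cell (h k) t + 1)%:~R := y2.
by rewrite ler_distl; apply/andP; split; lra.
Qed.

Let mg n : measurable_fun [set: R] (g n).
Proof.
have -> : g n = (fun t => \sum_(z : 'I_((A n).*2))
    F n (cellpos z) * \1_(cellset (h n) (cellpos z)) t).
  apply/funext => t; rewrite /g.
  rewrite -(sum_cells (h_gt0 n) (G := fun z y => F n z * (y == z)%:R) (@supF n)).
  - by apply: eq_bigr => z _; rewrite (indic_cellset (h_gt0 n)).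
  - by rewrite eqxx mulr1.
  - by move=> z zy; rewrite eq_sym (negbTE zy) mulr0.
apply: measurable_sum => z; apply: measurable_funM; first exact: measurable_cst.
by apply: measurable_indic; exact: measurable_itv.
Qed.

(** The dyadic intervals of length 2^-n contained in the open set and in a window of
    radius n exhaust it as n grows. Their number is finite, so their union has an
    indicator function in the span of those of dyadic intervals. *)
Lemma haar_dense_open (x : X) : haar_dense (fun t => (\1_U t : R) *: x).
Proof.
have mU : measurable U by exact: open_measurable.
apply: haar_dense_closed; first exact: smeas_indic_cst.
move=> e e0; have [del del0 small] := Lpnorm_indic_small x e0.
pose B n := U `\` (g n @^-1` [set 1]).
have mB n : measurable (B n).
  apply: measurableD => //; rewrite -[_ @^-1` _]setTI.
  by apply: mg => //; exact: measurable_set1.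
have BE n t : \1_U t - g n t = \1_(B n) t :> R.
  rewrite !indicE; have [Ut|Ut] := pselect (U t).
    rewrite (mem_set Ut); have [gt|gt] := g_in n t; rewrite gt.
      by rewrite memNset ?subrr// => -[_]; apply.
    by rewrite mem_set ?subr0//; split=> //=; rewrite gt => /esym/eqP; rewrite oner_eq0.
  rewrite !memNset// ?sub0r; last by case.
  have [/g_sub//|->] := g_in n t; by rewrite oppr0.
have [n muBn] : exists n, (mu (B n) <= del%:E)%E.
  have := @dominated_convergence _ _ _ mu setT measurableT
    (fun n t => (\1_(B n) t)%:E) (cst 0%E) (fun t => (\1_U t)%:E).
  case.
  - by move=> n; apply/measurable_EFinP; apply: measurable_indic; exact: mB.
  - exact: measurable_cst.
  - apply: aeW => t _; have [Ut|Ut] := pselect (U t).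
      have [n hn] := g_near Ut; apply: cvg_near_cst.
      by exists n => // k /= nk; rewrite -BE hn// indicE mem_set// subrr.
    apply: cvg_near_cst; apply: nearW => n /=.
    by rewrite indicE memNset// => -[].
  - apply/integrableP; split; first by apply/measurable_EFinP; exact: measurable_indic.
    under eq_integral do rewrite gee0_abs ?lee_fin//.
    by rewrite integral_indic// setIT.
  - apply: aeW => t n _; rewrite gee0_abs ?lee_fin// !indicE ler_nat.
    by case: (boolP (t \in B n)) => //; rewrite inE => -[Ut _]; rewrite mem_set.
  move=> _ _; rewrite integral0 => /ecvg0P.
  have i0 n : (0 <= \int[mu]_t (\1_(B n) t)%:E)%E by apply: integral_ge0 => t _; rewrite lee_fin.
  move=> /(_ i0 _ del0)[n hn]; exists n; have := hn n (leqnn n).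
  by rewrite /= integral_indic ?setIT//; exact: mB.
exists (fun t => g n t *: x).
  have -> : (fun t => g n t *: x) =
      step_fun (cell_steps (h n) (A n) (fun z => F n z *: x)).
    apply/funext => t; rewrite (step_fun_cells (h_gt0 n))//.
    by move=> z zA; rewrite supF// scale0r.
  apply: haar_dense_step => _ /mapP[z _ ->] /=.
  exact: (haar_dense_ditv _ (n%:Z, cellpos z)).
under eq_Lpnorm do rewrite -scalerBl BE.
exact: small.
Qed.

End open_set.

(** By outer regularity of Lebesgue measure. *)
Lemma haar_dense_indic (A : set R) (x : X) : measurable A -> (mu A < +oo)%E ->
  haar_dense (fun t => (\1_A t : R) *: x).
Proof.
move=> mA muA; apply: haar_dense_closed; first exact: smeas_indic_cst.
move=> e e0; have [del del0 small] := Lpnorm_indic_small x e0.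
have [U [oU AU muUA]] := lebesgue_regularity_outer mA muA del0.
have mU : measurable U by exact: open_measurable.
have muU : (mu U < +oo)%E.
  have -> : U = A `|` (U `\` A) by rewrite setDUK.
  apply: (@le_lt_trans _ _ (mu A + mu (U `\` A))%E).
    by apply: measureU2 => //; exact: measurableD.
  by apply: lte_add_pinfty => //; apply: lt_trans muUA _; rewrite ltry.
exists (fun t => (\1_U t : R) *: x); first exact: haar_dense_open.
rewrite Lpnorm_distC.
have UAE t : \1_U t - \1_A t = \1_(U `\` A) t :> R.
  rewrite !indicE; have [At|At] := pselect (A t).
    by rewrite (mem_set (AU _ At)) (mem_set At) subrr memNset// => -[_]; apply.
  have [Ut|Ut] := pselect (U t).
    by rewrite (mem_set Ut) (memNset At) mem_set ?subr0.
  by rewrite !memNset ?subrr//; case.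
under eq_Lpnorm do rewrite -scalerBl UAE.
by apply: small; [exact: measurableD|exact: ltW].
Qed.

Lemma haar_dense_Lp (u : R -> X) : in_Lp mu p u -> haar_dense u.
Proof.
move=> [su Nu]; apply: haar_dense_closed => // e e0.
have [s ss us] := step_dense p1' (conj su Nu) e0; exists (step_fun s) => //.
by apply: haar_dense_step => -[A x] /ss[mA muA]; exact: haar_dense_indic.
Qed.

End haar_density.

(** * The collections of the theorem *)

Section collections.
Context {R : realType}.
Variable m : nat.
Hypothesis m0 : (0 < m)%N.

Lemma exp2z_inj (a c : int) : (2 : R) ^ a = 2 ^ c -> a = c.
Proof.
by apply: ieexprIz => //; rewrite ?ltr0n// pnatr_eq1.
Qed.

(** Lengths are powers of two, so equations between lengths are equations between
    levels. *)
Lemma dlen_scale (I J : dyadic) (n : nat) :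
  dlen R J = 2 ^- n * dlen R I <-> J.1 = I.1 + n%:Z.
Proof.
have E : 2 ^- n * dlen R I = 2 ^ (- (I.1 + n%:Z)).
  by rewrite /dlen opprD expfzDr ?pnatr_eq0// mulrC exprnN.
by rewrite E /dlen; split=> [/exp2z_inj|->//]; lia.
Qed.

Lemma calA_mod i I J : calA R m i I -> calA R m i J -> (I.1 = J.1 %[mod (lam m)%:Z])%Z.
Proof.
move=> [j /exp2z_inj Ij] [k /exp2z_inj Jk].
apply/eqP; rewrite eqz_mod_dvd; apply/dvdzP; exists (j - k).
by rewrite mulrBl; lia.
Qed.

(** The interval containing both J and its translate has the index
    floor (k / 2^lambda), where k is the index of J; so the remainder of k leaves room
    for m. *)
Lemma calA0_wraps i J : calA0 R m i J -> ~~ wraps m J.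
Proof.
move=> [_ [I [_ /dlen_scale JI sJ sT]]].
have L : dlen R I = 2 ^+ lam m * dlen R J.
  by have /dlen_scale -> := JI; rewrite mulVKf// expf_neq0// pnatr_eq0.
have d0 := @dlen_gt0 R J.
have inf_in (K : dyadic) : ditv R K (dlen R K * K.2%:~R).
  by rewrite /ditv /= in_itv /= lexx ltr_pM2l ?dlen_gt0// ltr_int ltrDl ltr01.
have := sJ _ (inf_in J); have := sT _ (inf_in (tau m J)).
rewrite /ditv /= !in_itv /= [dlen R (tau m J)](_ : _ = dlen R J)// L.
rewrite -!mulrA ![dlen R J * _]mulrC !mulrA !ltr_pM2r// !ler_pM2r//.
have P : (2 : R) ^+ lam m = (2 ^+ lam m : int)%:~R by rewrite rmorphXn.
rewrite P -!intrM !ler_int !ltr_int => /andP[_ h1] /andP[h2 _].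
have L0 : 0 < 2 ^+ lam m :> int by exact: exprn_gt0.
rewrite /wraps -ltNge; move: (2 ^+ lam m) L0 h1 h2 => Q Q0 h1 h2.
have h3 := divz_eq J.2 Q; have h4 := modz_ge0 J.2 (lt0r_neq0 Q0).
have h5 := ltz_pmod J.2 Q0.
have q : (J.2 %/ Q)%Z = I.2.
  have : Q * I.2 <= J.2 < Q * I.2 + Q by apply/andP; split; lia.
  by move: (J.2) => k /andP[k1 k2]; apply/eqP; rewrite eq_le; apply/andP; split; nia.
by rewrite q in h3; lia.
Qed.

Lemma unwrapped_calA0 i J : calA R m i J -> ~~ wraps m J -> calA0 R m i J.
Proof.
move=> AJ; rewrite /wraps -ltNge => nw; split=> //.
have L0 : 0 < 2 ^+ lam m :> int by exact: exprn_gt0.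
have h3 := divz_eq J.2 (2 ^+ lam m).
have h4 := modz_ge0 J.2 (lt0r_neq0 L0).
pose I : dyadic := (J.1 - (lam m)%:Z, (J.2 %/ (2 ^+ lam m : int))%Z).
have JI : J.1 = I.1 + (lam m)%:Z by rewrite /= subrK.
exists I; have := JI => /dlen_scale dJ.
have L : dlen R I = 2 ^+ lam m * dlen R J.
  by rewrite dJ mulVKf// expf_neq0// pnatr_eq0.
have sub (K : dyadic) : K.1 = J.1 -> 2 ^+ lam m * I.2 <= K.2 ->
    K.2 + 1 <= 2 ^+ lam m * (I.2 + 1) -> ditv R K `<=` ditv R I.
  move=> K1 lo hi t; rewrite /ditv /= !in_itv /= => /andP[t1 t2].
  have dK : dlen R K = dlen R J by rewrite /dlen K1.
  have P : (2 : R) ^+ lam m = (2 ^+ lam m : int)%:~R by rewrite rmorphXn.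
  have d0 := @dlen_gt0 R J.
  apply/andP; split.
    apply: le_trans t1; rewrite L dK P mulrAC -intrM mulrC ler_pM2l// ler_int.
    exact: lo.
  apply: lt_le_trans t2 _; rewrite L dK P mulrAC -intrM [leRHS]mulrC ler_pM2l// ler_int.
  exact: hi.
split=> //.
- case: AJ => j /exp2z_inj Jj; exists (j - 1); rewrite /dlen /=; congr (2 ^ _).
  by move: Jj; lia.
- by apply: sub => //=; move: h3 h4 nw; set Q := 2 ^+ lam m; lia.
- by apply: sub => //=; move: h3 h4 nw; set Q := 2 ^+ lam m; lia.
Qed.

Lemma calB0_class i I J : calB0 R m i I -> calB0 R m i J -> same_class m I J.
Proof.
rewrite /calB0; case: ifP => _ [/= AI eI] [AJ eJ].
  split; first by apply: calA_mod AI.1 AJ.1.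
    by rewrite eI eJ.
  by rewrite (negbTE (calA0_wraps AI)) (negbTE (calA0_wraps AJ)).
split; first by apply: calA_mod AI.1 AJ.1.
  by rewrite (negbTE eI) (negbTE eJ).
by rewrite (negbTE (calA0_wraps AI)) (negbTE (calA0_wraps AJ)).
Qed.

Lemma calA1_wraps i J : calA1 R m i J -> wraps m J.
Proof. by move=> [AJ nAJ]; apply: contrapT => /negP/(unwrapped_calA0 AJ). Qed.

Lemma calB1e_class i eps I J :
  calB1e R m i eps I -> calB1e R m i eps J -> same_class m I J.
Proof.
move=> [+ _] [+ _]; rewrite /calB1; case: ifP => _ [/= AI eI] [AJ eJ].
  by split; [exact: calA_mod AI.1 AJ.1|rewrite eI eJ|rewrite (calA1_wraps AI) (calA1_wraps AJ)].
split; [exact: calA_mod AI.1 AJ.1| |by rewrite (calA1_wraps AI) (calA1_wraps AJ)].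
by rewrite (negbTE eI) (negbTE eJ).
Qed.

Lemma K_bound : (K_ m)%:R <= 7 + 2 * (ln (m%:R : R) / ln 2).
Proof.
have ln2 : 0 < ln (2 : R) by rewrite ln_gt0// ltr1n.
rewrite /K_ /L_ /lam; have [m1|m1] := leqP m 1.
  have -> : m = 1%N by lia.
  by rewrite ln1 mul0r mulr0 addr0 ler_nat.
have tl := trunc_logP (p := 2) isT m0.
set l := trunc_log 2 m in tl *.
have : (l%:R : R) <= ln m%:R / ln 2.
  rewrite ler_pdivlMr// mulr_natl -lnXn// ler_ln ?posrE ?exprn_gt0 ?ltr0n//.
  by rewrite -natrX ler_nat.
have -> : (2 * (l + 3 - 1) + 1)%N = (5 + 2 * l)%N by lia.
by rewrite natrD natrM; lra.
Qed.

End collections.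

(** * Haar projections *)

Section pairing.
Context {R : realType} {X : completeNormedModType R}.
Local Notation mu := (@lebesgue_measure R).
Variable p : R.
Hypothesis p1 : 1 < p.
Let p1' : 1 <= p. Proof. exact: ltW. Qed.
Let p0 : 0 < p. Proof. exact: lt_trans p1. Qed.
Local Notation smeas := (strongly_measurable mu measurable).
Local Notation N := (Lpnorm mu p).

Lemma smeas_haarM (J : dyadic) (f : R -> X) : smeas f ->
  smeas (fun t => haar J t *: f t).
Proof.
move=> sf; under eq_fun do rewrite haar_children scalerBl.
by apply: smeasB; apply: smeas_indic => //; exact: measurable_ditv.
Qed.

(** Hoelder's inequality on the support of the Haar function: multiplication with it maps
    L^p continuously to L^1. *)
Lemma haar_localize (J : dyadic) : exists2 K : R, 0 <= K & forall f : R -> X, smeas f ->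
  (Lpnorm mu 1 (fun t => haar J t *: f t) <= K%:E * N f)%E.
Proof.
(* The exponent conjugate to p. *)
pose q := p / (p - 1).
have pm1 : 0 < p - 1 by rewrite subr_gt0.
have q0 : 0 < q by rewrite divr_gt0.
have q1 : 1 <= q by rewrite ler_pdivlMr// mul1r gerBl.
have pq : p^-1 + q^-1 = 1 by rewrite /q invf_div; field; rewrite gt_eqF.
exists (`|1 : R^o| * fine (mu (ditv R J)) `^ q^-1) => [|f sf].
  by rewrite mulr_ge0 ?powR_ge0.
have [f' [ff' mf']] := smeas_norm sf.
have mg : measurable_fun [set: R] (\1_(ditv R J) : R -> R).
  by apply: measurable_indic; exact: measurable_ditv.
have := hoelder mu mf' mg p0 q0 pq.
have -> : ('N[mu]_q%:E [EFin \o \1_(ditv R J)])%E =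
    (`|1 : R^o| * fine (mu (ditv R J)) `^ q^-1)%:E.
  rewrite -(Lpnorm_indic (X := R^o) q1 (1 : R^o)); last 2 first.
  - exact: measurable_ditv.
  - by rewrite [X in (X < _)%E](mu_ditv J) ltry.
  apply: eq_Lnorm => t /=; rewrite indicE /GRing.scale /= mulr1 ger0_norm//.
rewrite muleC => H; rewrite (ae_eq_Lpnorm p0 ff'); apply: le_trans H.
pose G t : R^o := `|f' t| * \1_(ditv R J) t.
have -> : ('N[mu]_1 [EFin \o ((fun t => `|f' t|) \* \1_(ditv R J))%R])%E = Lpnorm mu 1 G.
  by apply: eq_Lnorm => t /=; rewrite ger0_norm// mulr_ge0.
apply: ae_le_Lpnorm => //; apply: filterS ff' => t ->.
rewrite /G normrZ normrM normr_id mulrC; apply: ler_wpM2l => //.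
rewrite haar_children (indic_children J); apply: le_trans (ler_normB _ _) _.
by rewrite [leRHS]ger0_norm ?addr_ge0//; apply: lerD; rewrite ger0_norm.
Qed.

(** For Haar sums the pairings are multiples of the coefficients by orthogonality, and by
    [haar_localize] the pairing is continuous on L^p. *)
Lemma pairing_limit (u : R -> X) (S : nat -> {fset dyadic}) (a : nat -> dyadic -> X) J :
    smeas u -> N (fun t => u t - haar_sum (S n) (a n) t) @[n --> \oo] --> 0%E ->
  coef (S n) (a n) J @[n --> \oo] --> (dlen R J)^-1 *: haar_pairing u J.
Proof.
move=> su uS.
have [s sP] := choice (fun n => haar_steps (S n) (a n) J).
have ss n : step_over mu measurable (s n) by have [] := sP n.
have sE n t : step_fun (s n) t = haar J t *: haar_sum (S n) (a n) t by have [_ ->] := sP n.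
have [K K0 KP] := haar_localize J.
have : step_int mu (s n) @[n --> \oo] --> haar_pairing u J.
  apply: bochner_limit => //; first exact: smeas_haarM.
  have h0 n := Lpnorm_ge0 mu 1 (fun t => haar J t *: u t - step_fun (s n) t).
  apply/(ecvg0P h0) => e e0.
  have uS' := (ecvg0P (fun n => Lpnorm_ge0 mu p _)).1 uS.
  have K1 : 0 < K + 1 by rewrite ltr_wpDl.
  have [n hn] := uS' (e / (K + 1)) (divr_gt0 e0 K1).
  exists n => k nk; under eq_Lpnorm do rewrite sE -scalerBr.
  apply: le_trans (KP _ _) _; first by apply: smeasB => //; exact: smeas_haar.
  apply: (@le_trans _ _ (K%:E * (e / (K + 1))%:E)%E).
    by apply: lee_wpmul2l; [rewrite lee_fin|exact: hn].
  by rewrite -EFinM lee_fin mulrCA ger_pMr// ler_pdivrMr// mul1r lerDl.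
have d0 := @dlen_gt0 R J.
move=> sJ; apply: cvg_trans (cvgZ (cvg_cst (dlen R J)^-1) sJ); apply: near_eq_cvg.
apply: nearW => n; have [_ _ ->] := sP n.
by rewrite scalerA mulVf ?gt_eqF// scale1r.
Qed.

Lemma half_pow_le (e : R) : 0 < e -> exists n, forall k, (n <= k)%N -> 2^-1 ^+ k <= e.
Proof.
move=> e0; have half1 : `|2^-1 : R| < 1 by rewrite ger0_norm// invf_lt1// ltr1n.
have /cvgr0Pnorm_le/(_ _ e0)[n _ hn] := cvg_expr half1.
by exists n => k /hn /=; rewrite ger0_norm ?exprn_ge0.
Qed.

Lemma Lpnorm_cvg0 (f : nat -> R -> X) (K : R) : 0 < K ->
    (forall n, N (f n) <= (K * 2^-1 ^+ n)%:E)%E -> N (f n) @[n --> \oo] --> 0%E.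
Proof.
move=> K0 fK; apply/(ecvg0P (fun n => Lpnorm_ge0 mu p _)) => e e0.
have [n nP] := half_pow_le (divr_gt0 e0 K0); exists n => k /nP hk.
apply: le_trans (fK k) _; rewrite lee_fin; apply: le_trans (ler_wpM2l (ltW K0) hk) _.
by rewrite mulrCA mulfV ?mulr1// gt_eqF.
Qed.

Lemma haar_sum_cvg (S : {fset dyadic}) (c : dyadic -> X) (a : nat -> dyadic -> X) t :
    (forall J, a n J @[n --> \oo] --> c J) ->
  haar_sum S (a n) t @[n --> \oo] --> haar_sum S c t.
Proof.
move=> ac; rewrite /haar_sum; elim: (enum_fset S) => [|J r IHr].
  by rewrite big_nil; under eq_fun do rewrite big_nil; exact: cvg_cst.
rewrite big_cons; under eq_fun do rewrite big_cons.
by apply: cvgD => //; apply: cvgZ => //; exact: cvg_cst.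
Qed.

Variable b : R.
Hypotheses (b0 : 0 <= b) (bX : unconditional_bound X p b).

Definition haar_coef (u : R -> X) (J : dyadic) := (dlen R J)^-1 *: haar_pairing u J.

(** Let v = haar_sum S a be close to u and let S0 be the part of S in B. The terms of the
    series outside S0 but in B are not in S, so they are also the terms, over the
    same set, of the series of u - v. The norm of this partial sum is at most
    (1 + b) times that of u - v, by [haar_sum_sub_le] applied to Haar sums
    approaching u and by Fatou's lemma. *)
Lemma haar_proj_cauchy (B : set dyadic) u e : in_Lp mu p u -> 0 < e ->
  exists S0 : {fset dyadic}, [set` S0] `<=` B /\ forall S : {fset dyadic},
    [set` S0] `<=` [set` S] -> [set` S] `<=` B ->
    (N (fun t => haar_sum S (haar_coef u) t - haar_sum S0 (haar_coef u) t)%R <= e%:E)%E.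
Proof.
move=> uLp e0; set c := haar_coef u; have [su _] := uLp.
have [_ du] := haar_dense_Lp p1 uLp.
pose del : R := e / ((1 + b) * 2).
have b1 : 0 < (1 + b) * 2 by rewrite mulr_gt0// ltr_pwDl.
have del0 : 0 < del by rewrite divr_gt0.
have en n : 0 < del * 2^-1 ^+ n by rewrite mulr_gt0// exprn_gt0.
have [S /choice[a Sa]] := choice (fun n => du _ (en n)).
have half n : (2^-1 : R) ^+ n <= 1 by rewrite exprn_ile1// invf_le1// ler1n.
have Sdel n : (N (fun t => u t - haar_sum (S n) (a n) t)%R <= del%:E)%E.
  by apply: le_trans (Sa n) _; rewrite lee_fin ger_pMr.
have uS := Lpnorm_cvg0 del0 Sa.
pose S0 := [fset J in S 0%N | `[< B J >]]%fset.
exists S0; split=> [J /=|T S0T TB]; first by rewrite !inE => /andP[_ /asboolP].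
have S0T' : (S0 `<=` T)%fset by apply/fsubsetP => J JS; exact: S0T.
rewrite haar_sum_diff; set D := (T `|` S0)%fset.
pose D' := (T `\` S0)%fset.
have D'0 J : J \in D' -> coef (S 0%N) (a 0%N) J = 0.
  move=> /fsetDP[JT JS0]; rewrite /coef; case: ifPn => // JS.
  by case/negP: JS0; rewrite !inE JS /=; apply/asboolP; exact: TB.
have -> : haar_sum D (fun J => coef T c J - coef S0 c J) = haar_sum D' c.
  rewrite -(haar_sum_coef c (_ : D' `<=` D)%fset); last first.
    by apply/fsubsetP => J; rewrite !inE => /andP[_ ->].
  congr haar_sum; apply/funext => J; rewrite /coef in_fsetD.
  have [JS|JS] /= := boolP (J \in S0); last by rewrite subr0.
  by rewrite (fsubsetP S0T')// subrr.
have := @Lpnorm_fatou R X _ _ mu p p1' (haar_sum D' c)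
  (fun k => haar_step D' (coef (S k) (a k))) e; apply.
- by move=> k; exact: step_over_haar.
- apply: aeW => t; under eq_fun do rewrite step_fun_haar.
  by apply: haar_sum_cvg => J; exact: pairing_limit.
- exact: ltW.
- move=> k; rewrite step_fun_haar.
  pose d J := coef (S k) (a k) J - coef (S 0%N) (a 0%N) J.
  have E : haar_sum D' (coef (S k) (a k)) = haar_sum D' d.
    apply/funext => t; apply: eq_big_seq => J JD.
    by rewrite /d D'0// subr0.
  pose V := (D' `|` (S k `|` S 0%N))%fset.
  have EV : haar_sum V d = (fun t => haar_sum (S k) (a k) t - haar_sum (S 0%N) (a 0%N) t).
    rewrite haar_sum_diff; rewrite -(haar_sum_coef _ (fsubsetUr D' (S k `|` S 0%N)%fset)).
    congr haar_sum; apply/funext => J; rewrite /d [RHS]/coef inE /coef.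
    by case: (J \in S k); case: (J \in S 0%N) => //=; rewrite subrr.
  rewrite E; apply: le_trans (haar_sum_sub_le p1 b0 bX d (fsubsetUl D' (S k `|` S 0%N)%fset)) _.
  rewrite -/V EV; apply: (@le_trans _ _ ((1 + b)%:E * (del + del)%:E)%E).
    apply: lee_wpmul2l; first by rewrite lee_fin addr_ge0.
    apply: le_trans (Lpnorm_triangle p1' (smeas_haar _ _) su (smeas_haar _ _)) _.
    by rewrite EFinD; apply: leeD; first rewrite Lpnorm_distC.
  rewrite -EFinM lee_fin -mulr2n -mulr_natr [X in _ <= X](_ : e = (1 + b) * (del * 2))//.
  by rewrite /del; field; lra.
Qed.

End pairing.

(** * The extension of the shift to L^p *)

Section shift.
Context {R : realType} {X : completeNormedModType R}.
Local Notation mu := (@lebesgue_measure R).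
Variables p b : R.
Hypotheses (p1 : 1 < p) (b0 : 0 <= b) (bX : unconditional_bound X p b).
Let p1' : 1 <= p. Proof. exact: ltW. Qed.
Let p0 : 0 < p. Proof. exact: lt_trans p1. Qed.
Local Notation smeas := (strongly_measurable mu measurable).
Local Notation N := (Lpnorm mu p).

Lemma Lp_limit (f : nat -> R -> X) s :
    (forall n, step_over mu measurable (s n)) -> (forall n, step_fun (s n) = f n) ->
    (forall n, N (fun t => f n.+1 t - f n t)%R <= (2^-1 ^+ n)%:E)%E ->
  exists2 w, in_Lp mu p w & forall n, (N (fun t => w t - f n t)%R <= (2 * 2^-1 ^+ n)%:E)%E.
Proof.
move=> ss sf fN; have sN n : (N (fun t => step_fun (s n.+1) t - step_fun (s n) t)%R <= (2^-1 ^+ n)%:E)%E.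
  by rewrite !sf.
have [w sw wN] := Lp_complete p1' ss sN.
exists w => [|n]; last by rewrite -sf.
split=> //; have s0 : smeas (step_fun (s 0%N)) by exact: smeas_step.
have -> : w = (fun t => (w t - step_fun (s 0%N) t) + step_fun (s 0%N) t).
  by apply/funext => t; rewrite subrK.
apply: le_lt_trans (LpnormD p1' (smeasB sw s0) s0) _.
apply: lte_add_pinfty; first by apply: le_lt_trans (wN 0%N) _; rewrite ltry.
exact: Lpnorm_step_lty.
Qed.

Lemma haar_proj_exists (B : set dyadic) (u : R -> X) : in_Lp mu p u ->
  exists w, is_haar_proj p B u w.
Proof.
move=> uLp; set c := haar_coef u.
have en n : 0 < (2^-1 : R) ^+ n / 2 by rewrite divr_gt0// exprn_gt0.
have [S SB] := choice (fun n => haar_proj_cauchy p1 b0 bX B uLp (en n)).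
have [w wLp wN] : exists2 w, in_Lp mu p w &
    forall n, (N (fun t => w t - haar_sum (S n) c t)%R <= (2 * 2^-1 ^+ n)%:E)%E.
  apply: (@Lp_limit (fun n => haar_sum (S n) c) (fun n => haar_step (S n) c)) => n.
  - exact: step_over_haar.
  - exact: step_fun_haar.
  pose T := (S n `|` S n.+1)%fset.
  have TB : [set` T] `<=` B.
    by move=> J /=; rewrite inE => /orP[]; [exact: (SB n).1|exact: (SB n.+1).1].
  have sub k : (S k `<=` T)%fset ->
      (N (fun t => haar_sum T c t - haar_sum (S k) c t)%R <= (2^-1 ^+ k / 2)%:E)%E.
    by move=> kT; apply: (SB k).2 => // J; exact: (fsubsetP kT).
  apply: le_trans (Lpnorm_triangle p1' (smeas_haar _ _) (smeas_haar T c) (smeas_haar _ _)) _.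
  rewrite Lpnorm_distC; apply: le_trans (leeD (sub _ (fsubsetUr _ _)) (sub _ (fsubsetUl _ _))) _.
  rewrite -EFinD lee_fin exprS; have := exprn_ge0 n (_ : 0 <= 2^-1 :> R).
  by rewrite invr_ge0 ler0n => /(_ isT); lra.
exists w; split=> // e e0.
have [n nP] := half_pow_le (divr_gt0 e0 (ltr0n R 3)).
exists (S n); split; first exact: (SB n).1.
move=> T ST TB.
have [sw _] := wLp.
apply: le_trans (Lpnorm_triangle p1' sw (smeas_haar (S n) c) (smeas_haar _ _)) _.
rewrite [X in (_ + X)%E]Lpnorm_distC.
apply: le_trans (leeD (wN n) ((SB n).2 T ST TB)) _.
have := nP n (leqnn n).
by rewrite -EFinD lee_fin; lra.
Qed.

Lemma Lpnorm_sum_le (I : Type) (r : seq I) (f : I -> R -> X) (A : \bar R) :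
    (0 <= A)%E -> (forall k, smeas (f k)) -> (forall k, N (f k) <= A)%E ->
  (N (fun t => \sum_(k <- r) f k t)%R <= (size r)%:R%:E * A)%E.
Proof.
move=> A0 sf fA.
suff [] : smeas (fun t => \sum_(k <- r) f k t) /\
  (N (fun t => \sum_(k <- r) f k t)%R <= (size r)%:R%:E * A)%E by [].
elim: r => [|k r [sr IHr]].
  under eq_fun do rewrite big_nil.
  rewrite mul0e /Lpnorm; split; last by under eq_fun do rewrite normr0; rewrite Lnorm0// eqe gt_eqF.
  by have := @smeas_step R X _ _ mu [::] (fun e => ltac:(by [])); rewrite /step_fun; under eq_fun do rewrite big_nil.
under eq_fun do rewrite big_cons; split; first exact: smeasD.
apply: le_trans (LpnormD p1' (sf k) sr) _; rewrite /= -natr1 EFinD ge0_muleDl ?lee_fin//.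
by rewrite mul1e addeC; apply: leeD.
Qed.

(** The constant depends on m through the number of classes; it serves only to show
    that the extension exists and does not depend on the approximating sums. *)
Lemma shift_bounded m : (0 < m)%N -> exists2 M : R, 0 <= M & forall S (c : dyadic -> X),
  (N (U_haar_sum m S c) <= M%:E * N (haar_sum S c))%E.
Proof.
move=> m0; pose T := ('I_(lam m).-1.+1 * bool * bool)%type.
(* [inord] wants a type of the form 'I_n.+1, here with n + 1 = lambda. *)
pose cls (J : dyadic) : T :=
  (inord (absz (J.1 %% (lam m)%:Z)%Z), (2 %| (J.2 %/ m)%Z)%Z, wraps m J).
have clsP I J : cls I = cls J -> same_class m I J.
  move=> [/(congr1 (@nat_of_ord _)) IJ1 IJ2 IJ3]; split=> //.
  have l0 := lam_gt0 m.
  by clear -l0 IJ1; move: IJ1; rewrite !inordK; lia.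
pose K := shift_constant b * (1 + b).
have sc0 := shift_constant_ge0 b0.
exists ((size (index_enum T))%:R * K) => [|S c]; first by rewrite mulr_ge0// mulr_ge0// addr_ge0.
pose Sk k := [fset J in S | cls J == k]%fset.
have -> : U_haar_sum m S c = (fun t => \sum_(k : T) U_haar_sum m (Sk k) c t).
  apply/funext => t; rewrite /U_haar_sum (partition_big cls xpredT)//=.
  by apply: eq_bigr => k _; rewrite big_fset_condE.
have NK k : (N (U_haar_sum m (Sk k) c) <= K%:E * N (haar_sum S c))%E.
  apply: le_trans (shift_haar_sum_le p1 b0 bX c m0 _) _.
    move=> I J; rewrite !inE => /andP[_ /eqP Ik] /andP[_ /eqP Jk].
    by apply: clsP; rewrite Ik Jk.
  rewrite (EFinM (shift_constant b)) -muleA; apply: lee_wpmul2l; first by rewrite lee_fin.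
  by apply: haar_sum_sub_le => //; exact: fset_sub.
rewrite (EFinM (size _)%:R) -muleA.
apply: Lpnorm_sum_le => // [|k]; last exact: smeas_shift.
by rewrite mule_ge0 ?Lpnorm_ge0// lee_fin mulr_ge0// addr_ge0.
Qed.

Section extension.
Variable m : nat.
Hypothesis m0 : (0 < m)%N.

Lemma U_exists (w : R -> X) : in_Lp mu p w -> exists g, is_U p m w g.
Proof.
move=> wLp; have [M M0 MP] := shift_bounded m0.
have [sw _] := wLp; have [_ dw] := haar_dense_Lp p1 wLp.
pose del : R := (2 * (1 + M))^-1.
have M1 : 0 < 2 * (1 + M) by rewrite mulr_gt0// ltr_pwDl.
have del0 : 0 < del by rewrite invr_gt0.
have en n : 0 < del * 2^-1 ^+ n by rewrite mulr_gt0// exprn_gt0.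
have [S /choice[a Sa]] := choice (fun n => dw _ (en n)).
have [g gLp gN] : exists2 g, in_Lp mu p g &
    forall n, (N (fun t => g t - U_haar_sum m (S n) (a n) t)%R <= (2 * 2^-1 ^+ n)%:E)%E.
  apply: (@Lp_limit (fun n => U_haar_sum m (S n) (a n)) (fun n => shift_step m (S n) (a n))) => n.
  - exact: step_over_shift.
  - exact: step_fun_shift.
  rewrite U_haar_sum_diff; apply: le_trans (MP _ _) _; rewrite -haar_sum_diff.
  have h : (N (fun t => haar_sum (S n.+1) (a n.+1) t - haar_sum (S n) (a n) t)%R <=
      (del * 2^-1 ^+ n.+1 + del * 2^-1 ^+ n)%:E)%E.
    apply: le_trans (Lpnorm_triangle p1' (smeas_haar _ _) sw (smeas_haar _ _)) _.
    by rewrite EFinD; apply: leeD; first rewrite Lpnorm_distC.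
  apply: le_trans (lee_wpmul2l _ h) _; first by rewrite lee_fin.
  rewrite -EFinM lee_fin exprS.
  have -> : M * (del * (2^-1 * 2^-1 ^+ n) + del * 2^-1 ^+ n) = (3 / 4 * (M / (1 + M))) * 2^-1 ^+ n.
    by rewrite /del; field; lra.
  apply: ler_piMl; first by rewrite exprn_ge0.
  have : M / (1 + M) <= 1 by rewrite ler_pdivrMr ?mul1r; lra.
  by lra.
exists g; split=> //; exists S, a; split.
- exact: Lpnorm_cvg0 del0 Sa.
- exact: Lpnorm_cvg0 (ltr0n R 2) gN.
Qed.

(** The sums approaching w in the definition of the extension may use any dyadic
    intervals. By [shift_bounded] they can be replaced by sums over the class B, to
    which [shift_haar_sum_le] applies. *)
Lemma U_proj_le (B : set dyadic) (u w g : R -> X) :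
    (forall I J, B I -> B J -> same_class m I J) -> is_haar_proj p B u w -> is_U p m w g ->
  (N g <= (shift_constant b)%:E * N w)%E.
Proof.
move=> Bcl [wLp wB] [_ [sg _] [S [a [wS gS]]]].
have [M M0 MP] := shift_bounded m0.
have [sw wfin] := wLp; set C := shift_constant b; pose c := haar_coef u.
have C0 : 0 <= C by exact: shift_constant_ge0.
apply/lee_addgt0Pr => e e0.
have K0 : 0 < 1 + 2 * M + C by lra.
pose e' := e / (1 + 2 * M + C).
have e'0 : 0 < e' by rewrite divr_gt0.
have [n1 n1P] := (ecvg0P (fun n => Lpnorm_ge0 mu p _)).1 wS _ e'0.
have [n2 n2P] := (ecvg0P (fun n => Lpnorm_ge0 mu p _)).1 gS _ e'0.
pose n := maxn n1 n2; have {}n1P := n1P n (leq_maxl _ _); have {}n2P := n2P n (leq_maxr _ _).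
have [S' [S'B S'P]] := wB _ e'0.
have {}S'P := S'P S' (fun=> id) S'B.
have sH := smeas_haar (R := R) (X := X); have sU := smeas_shift (R := R) (X := X) m.
have D : (N (fun t => U_haar_sum m (S n) (a n) t - U_haar_sum m S' c t)%R <= (M * (e' + e'))%:E)%E.
  rewrite U_haar_sum_diff; apply: le_trans (MP _ _) _; rewrite -haar_sum_diff EFinM.
  apply: lee_wpmul2l; first by rewrite lee_fin.
  apply: le_trans (Lpnorm_triangle p1' (sH _ _) sw (sH _ _)) _.
  by rewrite EFinD; apply: leeD; first rewrite Lpnorm_distC.
have V : (N (U_haar_sum m S' c) <= C%:E * (N w + e'%:E))%E.
  apply: le_trans (shift_haar_sum_le p1 b0 bX c m0 _) _.
    by move=> I J IS JS; apply: Bcl; exact: S'B.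
  apply: lee_wpmul2l; first by rewrite lee_fin.
  have -> : haar_sum S' c = (fun t => w t - (w t - haar_sum S' c t)).
    by apply/funext => t; rewrite subKr.
  apply: le_trans (LpnormB p1' sw (smeasB sw (sH _ _))) _.
  by apply: leeD.
have -> : g = (fun t => (g t - U_haar_sum m S' c t) + U_haar_sum m S' c t).
  by apply/funext => t; rewrite subrK.
apply: le_trans (LpnormD p1' (smeasB sg (sU _ _)) (sU _ _)) _.
apply: le_trans (leeD (Lpnorm_triangle p1' sg (sU (S n) (a n)) (sU S' c)) V) _.
apply: le_trans (leeD (leeD n2P D) (lexx _)) _.
have w0 := Lpnorm_ge0 mu p w.
have wf : N w \is a fin_num by rewrite ge0_fin_numE.
rewrite -(fineK wf).
rewrite -(EFinD (fine _)).
rewrite -!(EFinM C) -!EFinD lee_fin.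
have E : (1 + 2 * M + C) * e' = e by rewrite /e' mulrCA mulfV ?mulr1// gt_eqF.
by rewrite -E; lra.
Qed.

End extension.

End shift.

Theorem theorem5p4 (R : realType) :
  (exists C : R -> R,
     (forall b : R, 0 < C b) /\
     forall (p : R) (X : completeNormedModType R), 1 < p -> UMD X ->
     forall m : nat, (1 <= m)%N ->
     forall i : nat, (i <= K_ m)%N ->
     forall (eps : bool) (u : R -> X), in_Lp lebesgue_measure p u ->
       U_proj_estimate p m (calB0 R m i) (C (umd_constant X p)) u /\
       U_proj_estimate p m (calB1e R m i eps) (C (umd_constant X p)) u) /\
  (forall m : nat, (1 <= m)%N ->
     (K_ m)%:R <= 7 + 2 * (ln (m%:R : R) / ln 2)).
Proof.
split; last by move=> m m0; exact: K_bound.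
(* The constant must be positive for every real argument; the UMD constant is
   nonnegative, so the absolute value changes nothing where it matters. *)
exists (fun b => 1 + shift_constant `|b|); split=> [b|]; first by rewrite ltr_pwDl ?shift_constant_ge0.
move=> p X p1 UX m m0 i iK eps u uLp.
have b0 : 0 <= umd_constant X p by exact: umd_constant_ge0.
have bX := umd_constant_unconditional p1 UX.
have est B : (forall I J, B I -> B J -> same_class m I J) ->
    U_proj_estimate p m B (1 + shift_constant `|umd_constant X p|) u.
  move=> Bcl; split; first exact: (haar_proj_exists p1 b0 bX B uLp).
  move=> w wB; split; first by apply: (U_exists p1 b0 bX m0); case: wB.
  move=> g wg; apply: le_trans (U_proj_le p1 b0 bX m0 Bcl wB wg) _.
  rewrite ger0_norm//; apply: lee_wpmul2r; first exact: Lpnorm_ge0.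
  by rewrite lee_fin lerDr.
by split; apply: est; [exact: calB0_class|exact: calB1e_class].
Qed.
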